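(* Let $\mathbb D\subset\mathbb C$ be the open unit disc with boundary $b\mathbb D$. 1. For every $\alpha\in\mathbb D$, the reproducing kernel of the Hilbert space $\mathcal H^{1,2}_\alpha(\mathbb D)$ (with inner product $\langle F,G\rangle=\int_{b\mathbb D}\dot{(F')}\,\overline{\dot{(G')}}\,d\sigma$) is $$K^z_\alpha(w)=\sum_{k=1}^\infty\frac{(w^k-\alpha^k)\,\overline{(z^k-\alpha^k)}}{2\pi k^2},\qquad z,w\in\mathbb D.$$ 2. Let $1\le p\le\infty$, $g\in\mathfrak n^p(b\mathbb D)$ and $\alpha:=0$. The unique solution $G\in\mathcal H^{1,p}_0(\mathbb D)$ of the holomorphic Neumann problem ($\bar\partial G=0$ in $\mathbb D$, $\frac{\partial G}{\partial n}=g$ $\sigma$-a.e. on $b\mathbb D$, $(G')^*\in L^p(b\mathbb D,\sigma)$) admits the representation $$G(z)=\frac1{2\pi}\int_{b\mathbb D}g(\zeta)\,\mathrm{Log}\frac{1}{1-z\overline\zeta}\,d\sigma(\zeta),\qquad z\in\mathbb D,$$ where $\mathrm{Log}$ denotes the principal branch of the complex logarithm.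
   Context: $\sigma$ is arc-length measure on $b\mathbb D$, and $T(\zeta)=i\zeta$ is the positively oriented unit tangent vector at $\zeta\in b\mathbb D$. **Nontangential notions.** Let $\{\Gamma(\zeta)\}_{\zeta\in b\mathbb D}$ be a fixed family of nontangential approach regions in $\mathbb D$: truncated one-sided open cones with vertex $\zeta$, contained in $\mathbb D$, of uniformly comparable size and aperture (e.g. rotations of one fixed truncated cone at $1$ with axis the inner normal). For $F$ on $\mathbb D$: $F^*(\zeta)=\sup_{z\in\Gamma(\zeta)}|F(z)|$ and $\dot F(\zeta)=\lim_{z\to\zeta,\,z\in\Gamma(\zeta)}F(z)$ when it exists. **Spaces.** $\vartheta(\mathbb D)$ is the set of holomorphic functions on $\mathbb D$; $\mathcal H^p(\mathbb D)=\{F\in\vartheta(\mathbb D):F^*\in L^p(b\mathbb D,\sigma)\}$ (every such $F$ has a nontangential limit $\dot F$ $\sigma$-a.e.); $\mathcal H^{1,p}(\mathbb D)=\{G\in\vartheta(\mathbb D):G'\in\mathcal H^p(\mathbb D)\}$; $\mathcal H^{1,p}_\alpha(\mathbb D)=\{F\in\mathcal H^{1,p}(\mathbb D):F(\alpha)=0\}$; $$\mathfrak n^p(b\mathbb D)=\{-iT(\zeta)\,\dot{(G')}(\zeta):G\in\mathcal H^{1,p}(\mathbb D)\}.$$ For $G\in\mathcal H^{1,p}(\mathbb D)$, $\frac{\partial G}{\partial n}(\zeta)=-iT(\zeta)\,\dot{(G')}(\zeta)$ for $\sigma$-a.e. $\zeta$. The reproducing kernel is the function with $K^z_\alpha\in\mathcal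 H^{1,2}_\alpha(\mathbb D)$ and $F(z)=\langle F,K^z_\alpha\rangle$ for all $F\in\mathcal H^{1,2}_\alpha(\mathbb D)$, $z\in\mathbb D$.
   Formalization: The cones of the approach family are required to depend on the boundary point in a Borel way and each to contain a cone of fixed aperture about the inner normal; for cones of uniform size and aperture tilted away from the normal arbitrarily, the claims can fail. *)

(* Defs.v *)
From HB Require Import structures.
From mathcomp Require Import all_boot all_order all_algebra.
From mathcomp Require Import complex.
From mathcomp Require Import all_classical all_reals all_analysis.
From mathcomp Require Import measurable_realfun.
Import Order.TTheory GRing.Theory Num.Theory.
Import numFieldNormedType.Exports.

Set Implicit Arguments.
Unset Strict Implicit.
Unset Printing Implicit Defensive.

Local Open Scope classical_set_scope.
Local Open Scope ring_scope.

(* The topology and the normed-module structure of the complex plane are those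
   of a numFieldType over itself; on the concrete type R[i] they are found
   through the alias R[i]^o. *)
Notation Cplx R := (R[i]^o) (only parsing).

Section Plane.
Context {R : realType}.
Local Notation C := (Cplx R).
Implicit Types (z w : C) (F : C -> C).

Definition modulus z : R := complex.Re `|z|.

Definition unit_disc : set C := [set z | modulus z < 1].

Definition holomorphic F : Prop := forall z, unit_disc z -> derivable F z 1.

Definition cderiv F : C -> C := fun z => 'D_1 F z.

(* Value in ]-pi, pi]; meaningful for w != 0. *)
Definition Arg w : R :=
  let a := acos (complex.Re w / modulus w) in
  if complex.Im w < 0 then - a else a.

Definition Log w : C := (ln (modulus w) +i* Arg w)%C.

End Plane.

Section ArcLength.
Context {R : realType}.
Local Notation C := (Cplx R).

Definition expi (t : R) : C := (cos t +i* sin t)%C.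

(* Arc-length measure on the unit circle, carried to the angle t in [0, 2 pi[
   by the unit-speed parametrization expi: a function f on the circle is
   integrated as f \o expi, and a property P of boundary points holds almost
   everywhere when P (expi t) holds for sigma-almost every t. *)
Definition sigma : {measure set (measurableTypeR R) -> \bar R} :=
  mrestr (@lebesgue_measure R) (measurable_itv `[0, (2 * pi)%R[).

Definition circle_integral (f : C -> C) : C :=
  (Rintegral sigma setT (fun t => complex.Re (f (expi t)))
   +i* Rintegral sigma setT (fun t => complex.Im (f (expi t))))%C.

Definition circle_ae (P : C -> Prop) : Prop :=
  {ae sigma, forall t, P (expi t)}.

Definition circle_Lp (p : \bar R) (f : C -> \bar R) : Prop :=
  measurable_fun [set: R] (f \o expi) /\
  (Lnorm sigma p (f \o expi) < +oo)%E.

Definition unit_tangent (zeta : C) : C := 'i * zeta.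

End ArcLength.

Section Nontangential.
Context {R : realType}.
Local Notation C := (Cplx R).
Implicit Types (zeta z v : C) (F G : C -> C) (Gamma : C -> set C).

(* v is the unit vector of the axis and theta the half-aperture;
   Re (a * conj b) is the Euclidean inner product of a and b. *)
Definition truncated_cone zeta v (theta h : R) : set C :=
  [set z | modulus (z - zeta) < h /\
           cos theta * modulus (z - zeta) < complex.Re ((z - zeta) * conjc v)].

(* phi is the tilt of the axis from the inner normal - zeta. The half-aperture,
   the tilt and the size h may vary with the vertex, within uniform bounds:
   every cone contains the cone of half-aperture t0 about the inner normal and
   lies in the one of half-aperture t1 < pi / 2. Without the inner bound the
   regions near a boundary point may all lean away from it and miss the growth
   of a function there. The parameters are Borel functions of the angle, as
   otherwise the nontangential maximal function of even a polynomial may fail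
   to be measurable. *)
Definition approach_regions Gamma : Prop :=
  exists theta phi h : R -> R,
    [/\ [/\ measurable_fun setT theta, measurable_fun setT phi
          & measurable_fun setT h],
        (exists t0 t1, [/\ 0 < t0, t1 < pi / 2
           & forall t, t0 + `|phi t| <= theta t /\ theta t + `|phi t| <= t1]),
        (exists h0 h1, 0 < h0 /\ forall t, h0 <= h t <= h1)
      & forall t,
          Gamma (expi t) =
            truncated_cone (expi t) (- expi t * expi (phi t)) (theta t) (h t)
          /\ Gamma (expi t) `<=` unit_disc].

Variable Gamma : C -> set C.

Definition nt_max F zeta : \bar R :=
  ereal_sup [set (modulus (F z))%:E | z in Gamma zeta].

Definition nt_filter zeta : set_system C := within (Gamma zeta) (nbhs zeta).

Definition nt_converges F zeta : Prop := cvg (F @ nt_filter zeta).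

Definition nt_lim F zeta : C := lim (F @ nt_filter zeta).

Definition hardy (p : \bar R) : set (C -> C) :=
  [set F | holomorphic F /\ circle_Lp p (nt_max F)].

Definition hardy1 (p : \bar R) : set (C -> C) :=
  [set G | holomorphic G /\ hardy p (cderiv G)].

Definition hardy1_at (p : \bar R) (alpha : C) : set (C -> C) :=
  [set G | hardy1 p G /\ G alpha = 0].

Definition has_normal_derivative G zeta v : Prop :=
  nt_converges (cderiv G) zeta /\
  v = - 'i * unit_tangent zeta * nt_lim (cderiv G) zeta.

(* Boundary data are functions defined up to sigma-null sets. *)
Definition neumann_data (p : \bar R) : set (C -> C) :=
  [set g | exists2 G, hardy1 p G &
           circle_ae (fun zeta => has_normal_derivative G zeta (g zeta))].

Definition neumann_solution (p : \bar R) (g G : C -> C) : Prop :=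
  [/\ holomorphic G,
      circle_ae (fun zeta => has_normal_derivative G zeta (g zeta))
    & circle_Lp p (nt_max (cderiv G))].

Definition inner_product F G : C :=
  circle_integral (fun zeta =>
    nt_lim (cderiv F) zeta * conjc (nt_lim (cderiv G) zeta)).

(* K z is the function usually written K^z. *)
Definition reproducing_kernel (alpha : C) (K : C -> C -> C) : Prop :=
  forall z, unit_disc z ->
    hardy1_at 2%:E alpha (K z) /\
    forall F, hardy1_at 2%:E alpha F -> F z = inner_product F (K z).

End Nontangential.

(* Main.v *)
(* If G' has an integrable nontangential maximal function, the increments of G
   along the circles of radius r < 1 are bounded by the integral of that
   function. Hence the radial limit b of Re (c G) is absolutely continuous in
   the angle, and differentiable almost everywhere. Poisson's formula for b,
   differentiated in the angle, shows by a Fatou argument that z G'(z) has a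
   nontangential limit at every point where the functions b for c = 1 and
   c = - i are differentiable.

   For r < 1, integration by parts and Cauchy's formula give
     r int zeta G'(r zeta) Log (1 / (1 - z conj zeta)) = 2 pi (G (r z) - G 0),
   and dominated convergence as r -> 1 gives the second statement. The expansion
   of the logarithm shows that the conjugate of the boundary derivative of the
   series K^z is
     zeta (Log (1 / (1 - z conj zeta)) - Log (1 / (1 - alpha conj zeta))) / (2 pi),
   so the same formula, taken at z and at alpha, is the reproducing property of
   K^z. Two reproducing kernels K, L agree because
   K^z(w) = <K^z, L^w> = conj <L^w, K^z> = conj (L^w(z)) for all K, in particular
   for K = L. *)
Require Import Defs.
From HB Require Import structures.
From mathcomp Require Import all_boot all_order all_algebra.
From mathcomp Require Import complex.
From mathcomp Require Import all_classical all_reals all_analysis.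
From mathcomp Require Import measurable_realfun ess_sup_inf.
From mathcomp Require Import ring lra.
Import Order.TTheory GRing.Theory Num.Theory.
Import numFieldNormedType.Exports.
Local Open Scope classical_set_scope.
Local Open Scope ring_scope.
Set Implicit Arguments.
Unset Strict Implicit.
Unset Printing Implicit Defensive.

Local Notation Re := complex.Re.
Local Notation Im := complex.Im.

(** * The complex plane *)

Section Basics.
Context {R : realType}.
Local Notation C := (Cplx R).
Implicit Types (z w : C) (F : C -> C).

(** [nt_lim] is a [lim], so it carries information only where the limit exists. Boundary data bring
    this existence with them through [has_normal_derivative]; for the reproducing property it must
    be proved for every [F] of the space, and Fatou's theorem serves this purpose. The primitive [G]
    is used because nothing is known at first about [G'] on the circle: a Poisson representation of
    [G'] would presuppose its boundary function. By contrast [G] turns out to have radial limits at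
    every angle, and Poisson's formula for [G] passes to the boundary by bounded convergence.
    Cauchy's formula comes from a homotopy and asks for a continuous complex derivative on a disc of
    radius above 1. [hardy1] makes both [G] and [G'] holomorphic, and the dilations [G (r w)] supply
    the larger disc. Boundary data are arbitrary functions, perhaps not measurable, so integrals are
    compared off null sets. Membership of the kernel in the space, however, requires a measurable
    maximal function, which is where the Borel parameters of the regions enter. *)

Definition rC (x : R) : C := x%:C%C.
Definition iC : C := 'i%C.
Definition cj (z : C) : C := conjc z.

Lemma modulusE z : modulus z = Num.sqrt (Re z ^+ 2 + Im z ^+ 2).
Proof. by rewrite /modulus normc_def. Qed.

Lemma normE z : `|z| = (modulus z)%:C%C.
Proof. by rewrite modulusE normc_def. Qed.

Lemma modulus_ge0 z : 0 <= modulus z.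
Proof. by rewrite modulusE sqrtr_ge0. Qed.

Lemma modulus_sq z : modulus z ^+ 2 = Re z ^+ 2 + Im z ^+ 2.
Proof. by rewrite modulusE sqr_sqrtr// addr_ge0// sqr_ge0. Qed.

Lemma modulusM z w : modulus (z * w) = modulus z * modulus w.
Proof. by apply/complexI; rewrite -normE normrM !normE rmorphM. Qed.

Lemma modulusV z : modulus z^-1 = (modulus z)^-1.
Proof. by apply/complexI; rewrite -normE normfV normE fmorphV. Qed.

Lemma modulusD z w : modulus (z + w) <= modulus z + modulus w.
Proof. by rewrite -lecR rmorphD /= -!normE; exact: ler_normD. Qed.

Lemma modulusN z : modulus (- z) = modulus z.
Proof. by apply/complexI; rewrite -!normE normrN. Qed.

Lemma modulus_distC z w : modulus (z - w) = modulus (w - z).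
Proof. by rewrite -opprB modulusN. Qed.

Lemma modulusB z w : modulus (z - w) <= modulus z + modulus w.
Proof. by rewrite (le_trans (modulusD _ _))// modulusN. Qed.

Lemma modulus0 : modulus (0 : C) = 0.
Proof. by apply/complexI; rewrite -normE normr0. Qed.

Lemma modulus1 : modulus (1 : C) = 1.
Proof. by apply/complexI; rewrite -normE normr1. Qed.

Lemma modulus_eq0 z : (modulus z == 0) = (z == 0).
Proof. by rewrite -(inj_eq (@complexI R)) -normE normr_eq0. Qed.

Lemma modulus_gt0 z : (0 < modulus z) = (z != 0).
Proof. by rewrite lt_def modulus_ge0 andbT modulus_eq0. Qed.

Lemma modulusX z n : modulus (z ^+ n) = modulus z ^+ n.
Proof. by elim: n => [|n IH]; rewrite ?expr0 ?modulus1// !exprS modulusM IH. Qed.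

Lemma modulusJ z : modulus (cj z) = modulus z.
Proof. by rewrite !modulusE; case: z => a b /=; rewrite sqrrN. Qed.

Lemma modulusR (x : R) : modulus (rC x) = `|x|.
Proof. by rewrite modulusE /= expr0n addr0 sqrtr_sqr. Qed.

Lemma ler_Re_modulus z : `|Re z| <= modulus z.
Proof.
by rewrite -[leLHS]sqrtr_sqr modulusE ler_wsqrtr// lerDl sqr_ge0.
Qed.

Lemma Re_gt0_modulus z : 0 < Re z -> 0 < modulus z.
Proof. by move=> z0; apply: lt_le_trans (ler_Re_modulus z); rewrite ger0_norm ?ltW. Qed.

Lemma ler_Im_modulus z : `|Im z| <= modulus z.
Proof.
by rewrite -[leLHS]sqrtr_sqr modulusE ler_wsqrtr// lerDr sqr_ge0.
Qed.

Lemma modulus_le_ReIm z : modulus z <= `|Re z| + `|Im z|.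
Proof.
rewrite -(@ler_pXn2r _ 2) ?nnegrE ?modulus_ge0 ?addr_ge0//.
rewrite modulus_sq sqrrD !real_normK ?num_real//.
by rewrite lerD2r lerDl mulrn_wge0// mulr_ge0.
Qed.

Lemma modulus_sum (I : Type) (r : seq I) (P : pred I) (f : I -> C) :
  modulus (\sum_(i <- r | P i) f i) <= \sum_(i <- r | P i) modulus (f i).
Proof.
elim/big_ind2 : _ => [|x1 x2 y1 y2 h1 h2|//]; first by rewrite modulus0.
by rewrite (le_trans (modulusD _ _))// lerD.
Qed.

Lemma rCD (x y : R) : rC (x + y) = rC x + rC y.
Proof. exact: rmorphD. Qed.
Lemma rCN (x : R) : rC (- x) = - rC x.
Proof. exact: rmorphN. Qed.
Lemma rCB (x y : R) : rC (x - y) = rC x - rC y.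
Proof. exact: rmorphB. Qed.
Lemma rCM (x y : R) : rC (x * y) = rC x * rC y.
Proof. exact: rmorphM. Qed.
Lemma rCV (x : R) : rC x^-1 = (rC x)^-1.
Proof. exact: fmorphV. Qed.
Lemma rC_nat n : rC n%:R = n%:R.
Proof. exact: rmorph_nat. Qed.
Lemma rC0 : rC 0 = 0. Proof. by []. Qed.
Lemma rC1 : rC 1 = 1. Proof. by []. Qed.
Lemma rCI : injective rC.
Proof. by move=> x y []. Qed.
Lemma rC_eq0 (x : R) : (rC x == 0) = (x == 0).
Proof. by rewrite -rC0 (inj_eq rCI). Qed.
Lemma cjN z : cj (- z) = - cj z.
Proof. exact: rmorphN. Qed.
Lemma cjB z w : cj (z - w) = cj z - cj w.
Proof. exact: rmorphB. Qed.
Lemma cjM z w : cj (z * w) = cj z * cj w.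
Proof. exact: rmorphM. Qed.
Lemma cjV z : cj z^-1 = (cj z)^-1.
Proof. exact: fmorphV. Qed.
Lemma cjX z n : cj (z ^+ n) = cj z ^+ n.
Proof. exact: rmorphXn. Qed.
Lemma cjK z : cj (cj z) = z.
Proof. exact: conjcK. Qed.
Lemma cj_rC x : cj (rC x) = rC x.
Proof. by rewrite /cj /rC conjc_real. Qed.
Lemma cj0 : cj 0 = 0. Proof. by rewrite -rC0 cj_rC. Qed.
Lemma cj1 : cj 1 = 1. Proof. by rewrite -rC1 cj_rC. Qed.
Lemma modulus_iC : modulus iC = 1.
Proof. by rewrite modulusE /= expr0n expr1n add0r sqrtr1. Qed.
Lemma modulus_cj_mul z : z * cj z = rC (modulus z ^+ 2).
Proof.
by rewrite modulus_sq; case: z => a b; apply/eqP; rewrite eq_complex /=; apply/andP; split; apply/eqP; ring.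
Qed.
Lemma complexE' z : z = rC (Re z) + iC * rC (Im z).
Proof.
by case: z => a b; apply/eqP; rewrite eq_complex /= !(mulr0, mul0r, mul1r, sub0r, addr0, add0r,subr0) !eqxx.
Qed.

Lemma ReD z w : Re (z + w) = Re z + Re w. Proof. by case: z; case: w. Qed.
Lemma ImD z w : Im (z + w) = Im z + Im w. Proof. by case: z; case: w. Qed.
Lemma ReN z : Re (- z) = - Re z. Proof. by case: z. Qed.
Lemma ImN z : Im (- z) = - Im z. Proof. by case: z. Qed.
Lemma ReB z w : Re (z - w) = Re z - Re w. Proof. by rewrite ReD ReN. Qed.
Lemma ImB z w : Im (z - w) = Im z - Im w. Proof. by rewrite ImD ImN. Qed.
Lemma ReM z w : Re (z * w) = Re z * Re w - Im z * Im w.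
Proof. by case: z; case: w. Qed.
Lemma ImM z w : Im (z * w) = Re z * Im w + Im z * Re w.
Proof. by case: z => a b; case: w. Qed.

Lemma ReZ (x : R) z : Re (rC x * z) = x * Re z.
Proof. by rewrite ReM /= mul0r subr0. Qed.
Lemma ImZ (x : R) z : Im (rC x * z) = x * Im z.
Proof. by rewrite ImM /= mul0r addr0. Qed.
Lemma Re_cj z : Re (cj z) = Re z. Proof. by case: z. Qed.
Lemma Im_cj z : Im (cj z) = - Im z. Proof. by case: z. Qed.
Lemma Re_iC z : Re (iC * z) = - Im z.
Proof. by rewrite ReM /= mul0r mul1r sub0r. Qed.
Lemma Im_iC z : Im (iC * z) = Re z.
Proof. by rewrite ImM /= mul0r mul1r add0r. Qed.

Lemma complex_eqP z w : Re z = Re w -> Im z = Im w -> z = w.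
Proof. by case: z => a b; case: w => c d /= -> ->. Qed.

Lemma gt0_complexP (e : R[i]) : 0 < e -> exists2 r : R, 0 < r & e = r%:C%C.
Proof.
case: e => a b; rewrite ltcE /= => /andP[/eqP -> a0]; exists a => //.
Qed.

(** Radii of balls in the plane are elements of [R[i]]; a positive one is real, so real radii
    describe all neighbourhoods. *)
Lemma nbhs_modulusP (z : C) (A : set C) :
  nbhs z A <-> exists2 e : R, 0 < e & forall w, modulus (w - z) < e -> A w.
Proof.
split.
- move=> /nbhs_ballP[e /= /gt0_complexP[r r0 ->] eA]; exists r => // w wr.
  by apply: eA; rewrite -ball_normE /= normE ltcR modulus_distC.
- case=> e e0 eA; apply/nbhs_ballP; exists (e%:C%C); first by rewrite /= ltcR.
  by move=> w; rewrite -ball_normE /= normE ltcR modulus_distC; exact: eA.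
Qed.

Lemma cvg_modulusP {T : Type} (X : set_system T) (f : T -> C) (l : C) :
  Filter X ->
  (f @ X --> l) <-> (forall e : R, 0 < e -> \forall x \near X, modulus (f x - l) < e).
Proof.
move=> FX; split => [fl e e0|h].
  have := fl [set w | modulus (w - l) < e]; apply.
  by apply/nbhs_modulusP; exists e.
by move=> A /nbhs_modulusP[e e0 eA]; apply: filterS (h e e0) => x; exact: eA.
Unshelve. all: by end_near. Qed.

Lemma cvg_ReImP {T : Type} (X : set_system T) (f : T -> C) (l : C) :
  Filter X ->
  (f @ X --> l) <->
  ((fun x => Re (f x)) @ X --> (Re l : R) /\ (fun x => Im (f x)) @ X --> (Im l : R)).
Proof.
move=> FX; split.
- move/cvg_modulusP => h; split; apply/cvgrPdist_lt => e e0.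
  + near=> x; rewrite distrC -ReB (le_lt_trans (ler_Re_modulus _))//.
    by near: x; exact: h.
  + near=> x; rewrite distrC -ImB (le_lt_trans (ler_Im_modulus _))//.
    by near: x; exact: h.
- case=> /cvgrPdist_lt h1 /cvgrPdist_lt h2; apply/cvg_modulusP => e e0.
  have e2 : 0 < e / 2 by rewrite divr_gt0.
  near=> x; rewrite (le_lt_trans (modulus_le_ReIm _))// [ltRHS]splitr.
  rewrite ltrD// ?ReB ?ImB distrC; near: x; [exact: h1|exact: h2].
Unshelve. all: by end_near. Qed.

Lemma cvgC_cj {T : Type} (X : set_system T) {FX : Filter X} (f : T -> C) (l : C) :
  f @ X --> l -> (fun x => cj (f x)) @ X --> cj l.
Proof.
move=> /cvg_ReImP[h1 h2]; apply/cvg_ReImP; split.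
  have -> : (fun x => Re (cj (f x))) = (fun x => Re (f x)).
    by apply/funext => x; case: (f x).
  by have -> : Re (cj l) = Re l by case: (l).
have -> : (fun x => Im (cj (f x))) = (fun x => - Im (f x)).
  by apply/funext => x; case: (f x).
by have -> : Im (cj l) = - Im l by [case: (l)]; exact: cvgN.
Qed.

Lemma ler_dist_modulus z w : `|modulus z - modulus w| <= modulus (z - w).
Proof.
have h (x y : C) : modulus x - modulus y <= modulus (x - y).
  by rewrite lerBlDr -{1}[x](subrK y) modulusD.
by rewrite ler_norml h andbT lerNl opprB modulus_distC h.
Qed.

Lemma cvg_modulus {T : Type} (X : set_system T) {FX : Filter X} (f : T -> C) (l : C) :
  f @ X --> l -> (fun x => modulus (f x)) @ X --> modulus l.
Proof.
move=> /cvg_modulusP h; apply/cvgrPdist_lt => e /h; apply: filterS => x.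
by apply: le_lt_trans; rewrite distrC ler_dist_modulus.
Qed.

Lemma cvgCD {T : Type} (X : set_system T) {FX : Filter X} (f g : T -> C) (a b : C) :
  f @ X --> a -> g @ X --> b -> (fun x => f x + g x) @ X --> (a + b : C).
Proof. by move=> fa gb; exact: (@cvgD _ C _ X FX f g a b fa gb). Qed.

Lemma cvgCN {T : Type} (X : set_system T) {FX : Filter X} (f : T -> C) (a : C) :
  f @ X --> a -> (fun x => - f x) @ X --> (- a : C).
Proof. by move=> fa; exact: (@cvgN _ C _ X FX f a fa). Qed.

Lemma cvgCB {T : Type} (X : set_system T) {FX : Filter X} (f g : T -> C) (a b : C) :
  f @ X --> a -> g @ X --> b -> (fun x => f x - g x) @ X --> (a - b : C).
Proof. by move=> fa gb; exact: (cvgCD fa (cvgCN gb)). Qed.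

Lemma cvgCM {T : Type} (X : set_system T) {FX : Filter X} (f g : T -> C) (a b : C) :
  f @ X --> a -> g @ X --> b -> (fun x => f x * g x) @ X --> (a * b : C).
Proof. by move=> fa gb; exact: (@cvgM _ _ X FX f g a b fa gb). Qed.

Lemma cvgCV {T : Type} (X : set_system T) {FX : Filter X} (f : T -> C) (a : C) :
  a != 0 -> f @ X --> a -> (fun x => (f x)^-1) @ X --> (a^-1 : C).
Proof. by move=> a0 fa; exact: (@cvgV _ _ X FX f a a0 fa). Qed.

Lemma cvgC_cst {T : Type} (X : set_system T) {FX : Filter X} (a : C) :
  (fun=> a) @ X --> a.
Proof. exact: cvg_cst. Qed.

End Basics.
Arguments cvgC_cst {R T X FX} a.

(** * Derivatives of curves and the slope form of complex derivatives *)

Section Curves.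
Context {R : realType}.
Local Notation C := (Cplx R).
Implicit Types (z w : C) (F : C -> C).

(* Derivative of a curve. The quotient is multiplied by the complex number
   [rC h^-1], so that the plane needs no normed structure over [R]. *)
Definition is_cder (g : R -> C) (t : R) (D : C) : Prop :=
  (fun h : R => rC h^-1 * (g (h + t) - g t)) @ 0^' --> D.

Lemma is_deriveP (f : R -> R) (t d : R) :
  (fun h : R => h^-1 * (f (h + t) - f t)) @ 0^' --> d <-> is_derive t 1 f d.
Proof.
have E : (fun h : R => h^-1 * (f (h + t) - f t)) =
         (fun h : R => h^-1 *: (f (h *: 1 + t) - f t)).
  by apply/funext => h; rewrite scaler1.
rewrite E; split => [h|[h <-]]; last exact: h.
apply: DeriveDef; first by apply/cvg_ex; exists d.
exact/cvg_lim.
Qed.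

Lemma is_cderP (g : R -> C) (t : R) (D : C) :
  is_cder g t D <->
  is_derive t 1 (fun s => Re (g s)) (Re D) /\ is_derive t 1 (fun s => Im (g s)) (Im D).
Proof.
rewrite -!is_deriveP /is_cder.
have -> : (fun h : R => h^-1 * (Re (g (h + t)) - Re (g t))) =
          (fun h : R => Re (rC h^-1 * (g (h + t) - g t) : C)).
  by apply/funext => h; rewrite ReZ ReB.
have -> : (fun h : R => h^-1 * (Im (g (h + t)) - Im (g t))) =
          (fun h : R => Im (rC h^-1 * (g (h + t) - g t) : C)).
  by apply/funext => h; rewrite ImZ ImB.
exact: cvg_ReImP.
Qed.

Lemma continuous_ReImP (g : R -> C) (t : R) :
  {for t, continuous g} <->
  {for t, continuous (fun s => Re (g s))} /\ {for t, continuous (fun s => Im (g s))}.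
Proof. exact: cvg_ReImP. Qed.

Lemma is_cder_continuous (g : R -> C) (t : R) (D : C) :
  is_cder g t D -> {for t, continuous g}.
Proof.
have cd (f : R -> R) d : is_derive t 1 f d -> {for t, continuous f}.
  by case=> h _; exact/differentiable_continuous/derivable1_diffP.
by case/is_cderP => /cd h1 /cd h2; exact/continuous_ReImP.
Qed.

Lemma is_cder_shift (g : R -> C) (t : R) : {for t, continuous g} ->
  (fun h : R => g (h + t)) @ 0^' --> g t.
Proof.
move=> h.
have : (h0 + t) @[h0 --> (0:R)^'] --> 0 + t.
  by apply: cvgD; [exact: cvg_within|exact: cvg_cst].
by rewrite add0r => k; exact: (cvg_comp _ _ k h).
Qed.

Lemma is_cderM (f g : R -> C) (t : R) (a b : C) :
  is_cder f t a -> is_cder g t b ->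
  is_cder (fun s => f s * g s) t (a * g t + f t * b).
Proof.
move=> hf hg; rewrite /is_cder.
have -> : (fun h : R => rC h^-1 * (f (h + t) * g (h + t) - f t * g t) : C) =
  (fun h : R => (rC h^-1 * (f (h + t) - f t)) * g (h + t)
     + f t * (rC h^-1 * (g (h + t) - g t)) : C).
  by apply/funext => h; ring.
apply: cvgCD; apply: cvgCM; [exact: hf| |exact: cvgC_cst|exact: hg].
exact/is_cder_shift/is_cder_continuous/hg.
Qed.

Lemma is_cderD (f g : R -> C) (t : R) (a b : C) :
  is_cder f t a -> is_cder g t b -> is_cder (fun s => f s + g s) t (a + b).
Proof.
move=> hf hg; rewrite /is_cder.
have -> : (fun h : R => rC h^-1 * (f (h + t) + g (h + t) - (f t + g t)) : C) =
  (fun h : R => (rC h^-1 * (f (h + t) - f t))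
     + (rC h^-1 * (g (h + t) - g t)) : C).
  by apply/funext => h; ring.
exact: (cvgCD hf hg).
Qed.

Lemma is_cder_cst (c : C) (t : R) : is_cder (fun=> c) t 0.
Proof.
rewrite /is_cder; under eq_fun do rewrite subrr mulr0; exact: cvgC_cst.
Qed.

Lemma is_cder_real (f : R -> R) (t d : R) : is_derive t 1 f d ->
  is_cder (fun s => rC (f s)) t (rC d).
Proof. by move=> h; apply/is_cderP; split => //=; exact: is_derive_cst. Qed.

Lemma is_cderZ (c : C) (g : R -> C) (t : R) (b : C) :
  is_cder g t b -> is_cder (fun s => c * g s) t (c * b).
Proof.
by move=> h; rewrite -[c * b]add0r -(mul0r (g t)); exact/is_cderM/h/is_cder_cst.
Qed.

Lemma is_cder_expi (t : R) : is_cder (@expi R) t (iC * expi t).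
Proof.
apply/is_cderP; split => /=.
  by rewrite mul0r mul1r sub0r; exact: is_derive_cos.
by rewrite mul0r mul1r add0r; exact: is_derive_sin.
Qed.

(** Carathéodory's form of the derivative: the difference quotient, completed by [D] at [z]. The
    factorization holds for all [w] without division, so the chain rule follows even where the inner
    curve returns to its starting value. *)
Lemma hol_slope F z (D : C) : is_derive z 1 F D ->
  exists Q : C -> C, [/\ Q z = D, {for z, continuous Q} &
    forall w, F w - F z = Q w * (w - z)].
Proof.
case=> dF DE.
have hF : (fun h : C => h^-1 * (F (h + z) - F z)) @ 0^' --> D.
  have -> : (fun h : C => h^-1 * (F (h + z) - F z)) =
            (fun h : C => h^-1 *: (F (h *: 1 + z) - F z)).
    by apply/funext => h; rewrite [h *: 1](mulr1 h).
  by rewrite -DE; exact: dF.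
pose Q w : C := if w == z then D else (F w - F z) / (w - z).
have QD : Q z = D by rewrite /Q eqxx.
exists Q; split; first exact: QD.
  apply/(@cvg_modulusP R C (nbhs z)) => e e0; rewrite QD.
  move/cvg_modulusP : hF => /(_ e e0).
  rewrite near_withinE => /nbhs_modulusP[d d0 h].
  apply/nbhs_modulusP; exists d => // w wd; rewrite /Q.
  case: eqVneq => [_|wz]; first by rewrite subrr modulus0.
  have wz0 : w - z != 0 by rewrite subr_eq0.
  have := h (w - z); rewrite subr0 => /(_ wd wz0).
  by rewrite subrK mulrC.
move=> w; rewrite /Q; case: eqVneq => [->|wz]; first by rewrite !subrr mulr0.
by rewrite divfK// subr_eq0.
Qed.

Lemma is_cder_comp F (g : R -> C) (t : R) (a b : C) :
  is_derive (g t) 1 F a -> is_cder g t b -> is_cder (F \o g) t (a * b).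
Proof.
move=> /hol_slope[Q [Qz cQ QE]] hg; rewrite /is_cder.
have -> : (fun h : R => rC h^-1 * ((F \o g) (h + t) - (F \o g) t) : C) =
  (fun h : R => Q (g (h + t)) * (rC h^-1 * (g (h + t) - g t)) : C).
  by apply/funext => h /=; rewrite QE; ring.
apply: cvgCM; [rewrite -Qz|exact: hg].
exact: (cvg_comp _ _ (is_cder_shift (is_cder_continuous hg)) cQ).
Qed.

Lemma hol_is_derive F z : holomorphic F -> unit_disc z -> is_derive z 1 F (cderiv F z).
Proof. by move=> hF zD; apply: DeriveDef => //; exact: hF. Qed.

Lemma is_derive_hol_continuous F z (D : C) :
  is_derive z 1 F D -> {for z, continuous F}.
Proof.
move=> /hol_slope[Q [Qz cQ QE]].
have -> : F = (fun w => Q w * (w - z) + F z).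
  by apply/funext => w; rewrite -QE subrK.
have h1 : (w - z) @[w --> z] --> z - z.
  have idz : (fun w : C => w) @ z --> z by move=> A.
  exact: (cvgCB idz (cvgC_cst z)).
exact: (cvgCD (cvgCM cQ h1) (cvgC_cst (F z))).
Qed.

End Curves.
Arguments is_cder_expi {R} t.
Arguments is_cder_cst {R} c t.
Arguments is_cderZ {R} c {g t b}.

(** * Integrals over an interval and their dependence on a parameter *)

Section RealIntegral.
Context {R : realType}.
Local Notation C := (Cplx R).
Local Notation mu := (@lebesgue_measure R).
Implicit Types (f F : R -> R) (g : R -> C) (a b : R).

Lemma continuous_itv_integrable f a b : continuous f ->
  mu.-integrable `[a, b] (EFin \o f).
Proof.
move=> cf; apply: continuous_compact_integrable; first exact: segment_compact.
exact: continuous_subspaceT.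
Qed.

Lemma is_derive_cts f (t d : R) : is_derive t 1 f d -> {for t, continuous f}.
Proof. by case=> h _; exact/differentiable_continuous/derivable1_diffP. Qed.

Lemma Rintegral_FTC f F a b : a <= b ->
  (forall t : R, is_derive t 1 F (f t)) -> continuous f ->
  \int[mu]_(t in `[a, b]) f t = F b - F a.
Proof.
rewrite le_eqVlt => /predU1P[->|ab] dF cf.
  by rewrite set_itv1 Rintegral_set1 subrr.
have cF : continuous F by move=> t; exact: is_derive_cts (dF t).
rewrite /Rintegral (@continuous_FTC2 _ f F)//.
- exact: continuous_subspaceT.
- split; first by move=> t _; case: (dF t).
    by apply: cvg_at_right_filter; exact: cF.
  by apply: cvg_at_left_filter; exact: cF.
- by move=> t _; rewrite derive1E; case: (dF t).
Qed.

Lemma bounded_cvg_Rintegral (fn : nat -> R -> R) f (M : R) a b :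
  (forall n, continuous (fn n)) ->
  (forall t, t \in `[a, b] -> fn n t @[n --> \oo] --> f t) ->
  (forall n t, t \in `[a, b] -> `|fn n t| <= M) ->
  \int[mu]_(t in `[a, b]) fn n t @[n --> \oo] --> \int[mu]_(t in `[a, b]) f t
  /\ mu.-integrable `[a, b] (EFin \o f).
Proof.
move=> cfn fnf fnM.
have mfn n : measurable_fun `[a, b] (EFin \o fn n).
  apply/measurable_EFinP/measurable_funTS.
  exact: continuous_measurable_fun.
have iM : mu.-integrable `[a, b] (EFin \o cst M).
  by apply: continuous_itv_integrable => x; exact: cvg_cst.
have fnf' t : `[a, b]%classic t -> (EFin \o fn n) t @[n --> \oo] --> (EFin \o f) t.
  by move=> tab; apply/cvg_EFin; [exact: nearW|apply: fnf; exact: tab].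
have mf : measurable_fun `[a, b] (EFin \o f).
  apply: emeasurable_fun_cvg fnf' => n; exact: mfn.
have [||h1 h2 h3] := @dominated_convergence _ _ _ mu `[a, b]%classic (measurable_itv _)
  (fun n => EFin \o fn n) (EFin \o f) (EFin \o cst M) mfn mf _ iM.
- by apply: aeW => t; exact: fnf'.
- by apply: aeW => t n tab; rewrite lee_fin; exact: fnM.
split => //; apply: fine_cvg; rewrite fineK; first exact: h3.
exact: integrable_fin_num.
Qed.

Lemma is_derive_Rintegral (f df : R -> R -> R) (M a b u v x0 : R) :
  u < x0 -> x0 < v ->
  (forall x, u < x -> x < v -> continuous (f x)) ->
  (forall x t, u < x -> x < v -> is_derive x 1 (f ^~ t) (df x t)) ->
  (forall x t, u < x -> x < v -> t \in `[a, b] -> `|df x t| <= M) ->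
  is_derive x0 1 (fun x => \int[mu]_(t in `[a, b]) f x t)
    (\int[mu]_(t in `[a, b]) df x0 t).
Proof.
move=> ux xv cf dff dfM.
(* On an empty interval nothing forces [0 <= M], which the dominating constant must satisfy. *)
have [ba|ab] := ltP b a.
  have -> : `[a, b]%classic = set0 by apply: set_itv_ge; rewrite bnd_simp -ltNge.
  rewrite Rintegral_set0.
  have -> : (fun x => \int[mu]_(t in set0) f x t) = cst 0.
    by apply/funext => x; rewrite Rintegral_set0.
  exact: is_derive_cst.
have M0 : 0 <= M by rewrite (le_trans _ (dfM x0 a ux xv _))// in_itv/= lexx.
have I0 : `]u, v[%classic x0 by rewrite /= in_itv /= ux xv.
have P1 x t : u < x -> x < v -> partial1of2 f x t = df x t.
  by move=> h1 h2; rewrite partial1of2E; case: (dff x t h1 h2).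
have h1 x : `]u, v[%classic x -> mu.-integrable `[a, b] (EFin \o f x).
  by rewrite /= in_itv /= => /andP[? ?]; apply: continuous_itv_integrable; exact: cf.
have h2 x t : `]u, v[%classic x -> `[a, b]%classic t -> derivable (f ^~ t) x 1.
  by rewrite /= in_itv /= => /andP[k1 k2] _; case: (dff x t k1 k2).
have h3 : mu.-integrable `[a, b] (EFin \o cst M).
  by apply: continuous_itv_integrable => x; exact: cvg_cst.
have h4 x t : `]u, v[%classic x -> `[a, b]%classic t ->
    `|partial1of2 f x t| <= (cst M : R -> R) t.
  by rewrite /= in_itv /= => /andP[? ?] ?; rewrite P1//; exact: dfM.
apply: DeriveDef.
  exact: (@derivable_under_integral R _ _ mu f _ (measurable_itv _) _ _ _ I0 h1 h2 _ (fun=> M0) h3 h4).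
rewrite -derive1E.
rewrite (@differentiation_under_integral R _ _ mu f _ (measurable_itv _) _ _ _ I0 h1 h2 _ (fun=> M0) h3 h4).
by apply: eq_Rintegral => t _; rewrite P1.
Qed.

End RealIntegral.

(** * Integrals around the circle in the angle variable *)

Section ComplexIntegral.
Context {R : realType}.
Local Notation C := (Cplx R).
Local Notation mu := (@lebesgue_measure R).
Implicit Types (f g : R -> C) (z w : C).

(** The closed interval suits the fundamental theorem of calculus; [sigma] lives on the half-open
    one, and [sigma_Rintegral] passes between them. *)
Definition cint g : C :=
  (\int[mu]_(t in `[0, 2 * pi]) Re (g t) +i* \int[mu]_(t in `[0, 2 * pi]) Im (g t))%C.

Lemma pi2_ge0 : 0 <= 2 * pi :> R.
Proof. by rewrite mulr_ge0// pi_ge0. Qed.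

Lemma continuous_Re g : continuous g -> continuous (fun t => Re (g t)).
Proof. by move=> cg t; case/continuous_ReImP: (cg t). Qed.

Lemma continuous_Im g : continuous g -> continuous (fun t => Im (g t)).
Proof. by move=> cg t; case/continuous_ReImP: (cg t). Qed.

Lemma eq_cint g h : g =1 h -> cint g = cint h.
Proof. by move=> /funext ->. Qed.

Lemma cint_FTC (f F : R -> C) : (forall t, is_cder F t (f t)) -> continuous f ->
  cint f = F (2 * pi) - F 0.
Proof.
move=> dF cf; apply: complex_eqP; rewrite (ReB, ImB) /=.
  apply: (@Rintegral_FTC _ _ (fun t => Re (F t)) _ _ pi2_ge0).
    by move=> t; case/is_cderP: (dF t).
  exact: continuous_Re.
apply: (@Rintegral_FTC _ _ (fun t => Im (F t)) _ _ pi2_ge0).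
  by move=> t; case/is_cderP: (dF t).
exact: continuous_Im.
Qed.

Lemma cintD (f g : R -> C) : continuous f -> continuous g ->
  cint (fun t => f t + g t) = cint f + cint g.
Proof.
move=> cf cg; apply: complex_eqP; rewrite (ReD, ImD) /= -RintegralD//.
- by apply: eq_Rintegral => t _; rewrite ReD.
- exact/continuous_itv_integrable/continuous_Re.
- exact/continuous_itv_integrable/continuous_Re.
- by apply: eq_Rintegral => t _; rewrite ImD.
- exact/continuous_itv_integrable/continuous_Im.
- exact/continuous_itv_integrable/continuous_Im.
Qed.

Lemma continuousCZ (c : C) g : continuous g -> continuous (fun t => c * g t).
Proof. by move=> cg t; exact: (cvgCM (cvgC_cst c) (cg t)). Qed.

Lemma continuousCM f g : continuous f -> continuous g -> continuous (fun t => f t * g t).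
Proof. by move=> cf cg t; exact: (cvgCM (cf t) (cg t)). Qed.

Lemma continuousCB f g : continuous f -> continuous g -> continuous (fun t => f t - g t).
Proof. by move=> cf cg t; exact: (cvgCB (cf t) (cg t)). Qed.

Lemma cintZ (c : C) g : continuous g -> cint (fun t => c * g t) = c * cint g.
Proof.
move=> cg.
have iR := continuous_itv_integrable 0 (2 * pi) (continuous_Re cg).
have iI := continuous_itv_integrable 0 (2 * pi) (continuous_Im cg).
have iZ (f : R -> R) (r : R) : mu.-integrable `[0, 2 * pi] (EFin \o f) ->
    mu.-integrable `[0, 2 * pi] (EFin \o (fun t => r * f t)).
  move=> fi; under [X in _.-integrable _ X]eq_fun do rewrite /= EFinM.
  exact: integrableZl.
apply: complex_eqP.
  rewrite ReM /= -!RintegralZl// -RintegralB//; [|exact: iZ|exact: iZ].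
  by apply: eq_Rintegral => t _; rewrite ReM.
rewrite ImM /= -!RintegralZl// -RintegralD//; [|exact: iZ|exact: iZ].
by apply: eq_Rintegral => t _; rewrite ImM.
Qed.

Lemma cintN g : continuous g -> cint (fun t => - g t) = - cint g.
Proof.
move=> cg; rewrite -mulN1r -cintZ//; apply: eq_cint => t; by rewrite mulN1r.
Qed.

Lemma cintB (f g : R -> C) : continuous f -> continuous g ->
  cint (fun t => f t - g t) = cint f - cint g.
Proof.
move=> cf cg; rewrite -cintN; last exact: cg.
rewrite -cintD; [by []|exact: cf|move=> t; exact: (cvgCN (cg t))].
Qed.

Lemma cint_cst (c : C) : cint (fun=> c) = rC (2 * pi) * c.
Proof.
have E (r : R) : \int[mu]_(t in `[0, 2 * pi]) r = 2 * pi * r.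
  rewrite Rintegral_cst// mulrC /= lebesgue_measure_itv /= lte_fin mulr_gt0 ?pi_gt0//.
  by rewrite /= subr0.
by apply: complex_eqP; rewrite (ReZ, ImZ) /= E.
Qed.

Lemma cint_cj g : continuous g -> cint (fun t => cj (g t)) = cj (cint g).
Proof.
move=> cg; apply: complex_eqP; rewrite (Re_cj, Im_cj) /=.
  by apply: eq_Rintegral => t _; rewrite Re_cj.
rewrite -mulN1r -RintegralZl//; last exact/continuous_itv_integrable/continuous_Im.
by apply: eq_Rintegral => t _; rewrite Im_cj mulN1r.
Qed.

Lemma is_cder_cint (f df : R -> R -> C) (M u v x0 : R) :
  u < x0 -> x0 < v ->
  (forall x, u < x -> x < v -> continuous (f x)) ->
  (forall x t, u < x -> x < v -> is_cder (f ^~ t) x (df x t)) ->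
  (forall x t, u < x -> x < v -> modulus (df x t) <= M) ->
  is_cder (fun x => cint (f x)) x0 (cint (df x0)).
Proof.
move=> ux xv cf dff dfM; apply/is_cderP; split => /=.
  apply: (@is_derive_Rintegral _ (fun x t => Re (f x t)) (fun x t => Re (df x t)) M _ _ u v x0) => //.
  - by move=> x h1 h2; exact/continuous_Re/cf.
  - by move=> x t h1 h2; case/is_cderP : (dff x t h1 h2).
  - by move=> x t h1 h2 _; rewrite (le_trans (ler_Re_modulus _))// dfM.
apply: (@is_derive_Rintegral _ (fun x t => Im (f x t)) (fun x t => Im (df x t)) M _ _ u v x0) => //.
- by move=> x h1 h2; exact/continuous_Im/cf.
- by move=> x t h1 h2; case/is_cderP : (dff x t h1 h2).
- by move=> x t h1 h2 _; rewrite (le_trans (ler_Im_modulus _))// dfM.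
Qed.

Lemma modulus_expi (t : R) : modulus (expi t) = 1.
Proof. by rewrite modulusE /= cos2Dsin2 sqrtr1. Qed.

Lemma expi_neq0 (t : R) : (expi t : C) != 0.
Proof. by rewrite -modulus_gt0 modulus_expi. Qed.

Lemma expi_cj (t : R) : expi t * cj (expi t) = 1.
Proof. by rewrite modulus_cj_mul modulus_expi expr1n. Qed.

Lemma cj_expi (t : R) : cj (expi t) = expi (- t).
Proof. by rewrite /expi cosN sinN. Qed.

Lemma expiD (s t : R) : expi (s + t) = expi s * expi t.
Proof. by apply: complex_eqP; rewrite (ReM, ImM) /= ?cosD ?sinD// addrC. Qed.

Lemma expi0 : expi (0 : R) = 1 :> C.
Proof. by rewrite /expi cos0 sin0. Qed.

Lemma expi2pi : expi (2 * pi : R) = 1 :> C.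
Proof. by rewrite /expi mulrC mulr_natr cos2pi sin2pi. Qed.

Lemma continuous_expi : continuous (@expi R).
Proof. by move=> t; exact: (is_cder_continuous (is_cder_expi t)). Qed.

Lemma compact_disc (r : R) : compact [set w : C | modulus w <= r].
Proof.
pose f (p : R * R) : C := rC p.1 + iC * rC p.2.
have cf : continuous f.
  move=> p; apply/(@cvg_ReImP R _ (nbhs p)); split.
    have -> : (fun x => Re (f x)) = fst.
      by apply/funext => x; rewrite ReD Re_iC /= oppr0 addr0.
    by rewrite ReD Re_iC /= oppr0 addr0; exact: cvg_fst.
  have -> : (fun x => Im (f x)) = snd.
    by apply/funext => x; rewrite ImD Im_iC /= add0r.
  by rewrite ImD Im_iC /= add0r; exact: cvg_snd.
apply: (@subclosed_compact _ _ (f @` (`[- r, r]%classic `*` `[- r, r]%classic))).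
- have -> : [set w : C | modulus w <= r] = (@modulus R) @^-1` [set x | x <= r] by [].
  apply: closed_comp; last exact: closed_le.
  by move=> w _; apply: (cvg_modulus (X := nbhs w)).
- apply: continuous_compact; first exact: continuous_subspaceT.
  by apply: compact_setX; exact: segment_compact.
- move=> w /= wr; exists (Re w, Im w); last by rewrite [RHS]complexE'.
  split; rewrite /= in_itv /= -ler_norml (le_trans _ wr)//.
    exact: ler_Re_modulus.
  exact: ler_Im_modulus.
Qed.

Lemma disc_bounded (q : C -> C) (r : R) :
  (forall w, modulus w <= r -> {for w, continuous q}) ->
  exists M, forall w, modulus w <= r -> modulus (q w) <= M.
Proof.
move=> cq; pose K := [set w : C | modulus w <= r].
have : compact ((fun w => modulus (q w)) @` K).
  apply: continuous_compact; last exact: compact_disc.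
  apply: continuous_in_subspaceT => w; rewrite inE => /cq h.
  exact: (cvg_modulus (X := nbhs w)).
move=> /compact_bounded[M [_ hM]]; exists (M + 1) => w wr.
rewrite -[leLHS]ger0_norm ?modulus_ge0//; apply: (hM (M + 1)).
  by rewrite ltrDl.
by exists w.
Qed.

End ComplexIntegral.

(** * Cauchy and Poisson formulas on the circle *)

Section Cauchy.
Context {R : realType}.
Local Notation C := (Cplx R).
Implicit Types (f g : R -> C) (z w : C).

Lemma continuousC_comp_at (Q : C -> C) g t :
  {for t, continuous g} -> {for g t, continuous Q} -> {for t, continuous (fun s => Q (g s))}.
Proof. by move=> cg cQ; exact: (cvg_comp _ _ cg cQ). Qed.

Lemma cder0_eq (f df : R -> C) (u v : R) : u < 0 -> 1 < v ->
  (forall x, u < x -> x < v -> is_cder f x (df x)) ->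
  (forall x, 0 < x -> x < 1 -> df x = 0) -> f 1 = f 0.
Proof.
move=> u0 v1 dff df0.
have key (g dg : R -> R) : (forall x : R, u < x -> x < v -> is_derive x 1 g (dg x)) ->
    (forall x, 0 < x -> x < 1 -> dg x = 0) -> g 1 = g 0.
  move=> dgg dg0.
  have d01 (x : R) : x \in `]0, 1[ -> is_derive x 1 g (dg x).
    by rewrite in_itv /= => /andP[x0 x1]; apply: dgg; lra.
  have cg : {within `[0, 1], continuous g}.
    apply: continuous_in_subspaceT => x; rewrite inE /= in_itv /= => /andP[x0 x1].
    by apply: is_derive_cts; apply: dgg; lra.
  have [c] := @MVT _ g dg 0 1 ltr01 d01 cg.
  rewrite in_itv /= => /andP[c0 c1]; rewrite dg0// mul0r => /eqP.
  by rewrite subr_eq0 => /eqP.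
apply: complex_eqP.
  apply: (key (fun x => Re (f x)) (fun x => Re (df x))).
    by move=> x h1 h2; case/is_cderP : (dff x h1 h2).
  by move=> x h1 h2; rewrite df0.
apply: (key (fun x => Im (f x)) (fun x => Im (df x))).
  by move=> x h1 h2; case/is_cderP : (dff x h1 h2).
by move=> x h1 h2; rewrite df0.
Qed.

Lemma is_cder_affine (a b : C) (x : R) : is_cder (fun y => a + rC y * b) x b.
Proof.
have -> : b = 0 + (rC 1 * b + rC x * 0) by rewrite rC1; ring.
apply: is_cderD; first exact: is_cder_cst.
have h : is_cder (fun y => rC y) x (rC 1) by apply: is_cder_real; exact: is_derive_id.
have h2 := is_cderM h (is_cder_cst b x).
by congr (is_cder _ _ _): h2; apply/funext => y; congr (_ * _); rewrite rC1; ring.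
Qed.

(** On the unit circle this is [zeta / (zeta - z)], so [ckernel z t dt] is the Cauchy form
    [d zeta / (i (zeta - z))]. *)
Definition ckernel z (t : R) : C := (1 - z * cj (expi t))^-1.

Lemma modulus_lt_neq0 w : modulus w < 1 -> 1 - w != 0.
Proof.
by apply: contraTN; rewrite subr_eq0 => /eqP <-; rewrite modulus1 ltxx.
Qed.

Lemma modulus_mul_cj_expi z (t : R) : modulus (z * cj (expi t)) = modulus z.
Proof. by rewrite modulusM modulusJ modulus_expi mulr1. Qed.

Lemma ckernel_den_neq0 z (t : R) : modulus z < 1 -> 1 - z * cj (expi t) != 0.
Proof. by move=> z1; apply: modulus_lt_neq0; rewrite modulus_mul_cj_expi. Qed.

Lemma continuous_cj_expi : continuous (fun t : R => cj (expi t)).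
Proof. by move=> t; exact: (cvgC_cj (continuous_expi (x:=t))). Qed.

Lemma continuous_ckernel z : modulus z < 1 -> continuous (ckernel z).
Proof.
move=> z1 t; apply: (@cvgCV _ _ (nbhs t)); first exact: ckernel_den_neq0.
exact: (cvgCB (cvgC_cst 1) (cvgCM (cvgC_cst z) (continuous_cj_expi (x:=t)))).
Qed.

Lemma mul_ckernel z (t : R) : modulus z < 1 ->
  (expi t - z) * ckernel z t = expi t.
Proof.
move=> z1; have k0 := ckernel_den_neq0 t z1.
have -> : expi t - z = (1 - z * cj (expi t)) * expi t.
  by rewrite mulrBl mul1r -mulrA (mulrC (cj _)) expi_cj mulr1.
by rewrite /ckernel mulrAC divff// mul1r.
Qed.

Section Homotopy.
Variables (Q q : C -> C) (r0 : R).
Hypothesis r0_gt1 : 1 < r0.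
Hypothesis dQ : forall w, modulus w < r0 -> is_derive w 1 Q (q w).
Hypothesis cq : forall w, modulus w < r0 -> {for w, continuous q}.

(* The integral of [Q (z + x (expi t - z)) * ckernel z t] does not depend on
   [x]: its derivative in [x] is, up to the factor [i x], the integral of the
   derivative in [t] of the periodic function [Q (z + x (expi t - z))]. *)
Lemma cauchy_homotopy z : modulus z < 1 ->
  cint (fun t => Q (expi t) * ckernel z t) = Q z * cint (ckernel z).
Proof.
move=> z1; move: r0_gt1 => r01.
(* The parameter runs over a neighbourhood []- e, 1 + e[] of the unit interval, where
   [|1 - x| + |x| < 1 + 2 e]; the points [y x t] then stay in the disc of radius [r0]. *)
have [e e0 er0] : exists2 e : R, 0 < e & 1 + 2 * e < r0.
  by exists ((r0 - 1) / 4); lra.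
pose y (x t : R) : C := z + rC x * (expi t - z).
have yE (x t : R) : y x t = rC (1 - x) * z + rC x * expi t.
  by rewrite /y rCB rC1; ring.
have ymod (x t : R) : - e < x -> x < 1 + e -> modulus (y x t) <= 1 + 2 * e.
  move=> h1 h2; rewrite yE (le_trans (modulusD _ _))// !modulusM !modulusR modulus_expi mulr1.
  have : `|1 - x| * modulus z <= `|1 - x| by rewrite ler_piMr// ltW.
  by case: (ger0P (1 - x)); case: (ger0P x); lra.
have ylt (x t : R) : - e < x -> x < 1 + e -> modulus (y x t) < r0.
  by move=> h1 h2; rewrite (le_lt_trans (ymod _ _ h1 h2)).
have [M hM] : exists M, forall w, modulus w <= 1 + 2 * e -> modulus (q w) <= M.
  by apply: disc_bounded => w wr; apply: cq; exact: le_lt_trans wr er0.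
have cy (x : R) : continuous (y x).
  move=> t.
  exact: (cvgCD (cvgC_cst z) (cvgCM (cvgC_cst (rC x))
    (cvgCB (continuous_expi (x:=t)) (cvgC_cst z)))).
have cQ w : modulus w < r0 -> {for w, continuous Q}.
  by move=> wr; exact: is_derive_hol_continuous (dQ wr).
have ck := continuous_ckernel z1.
have cqy (x : R) : - e < x -> x < 1 + e -> continuous (fun t => q (y x t) * expi t).
  move=> h1 h2 t.
  exact: (cvgCM (continuousC_comp_at (cy x t) (cq (ylt x t h1 h2))) (continuous_expi (x:=t))).
pose f (x : R) := cint (fun t => Q (y x t) * ckernel z t).
pose df (x : R) := cint (fun t => q (y x t) * expi t).
have dff (x : R) : - e < x -> x < 1 + e -> is_cder f x (df x).
  move=> h1 h2.
  refine (@is_cder_cint _ (fun x t => Q (y x t) * ckernel z t) (fun x t => q (y x t) * expi t)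
    M (- e) (1 + e) x h1 h2 _ _ _).
  - move=> x' k1 k2 t.
    exact: (cvgCM (continuousC_comp_at (cy x' t) (cQ _ (ylt x' t k1 k2))) (ck t)).
  - move=> x' t k1 k2.
    have hy : is_cder (y^~ t) x' (expi t - z) by exact: is_cder_affine.
    have := is_cderM (is_cder_comp (g := y^~ t) (dQ (ylt x' t k1 k2)) hy) (is_cder_cst (ckernel z t) x').
    by rewrite mulr0 addr0 -mulrA mul_ckernel.
  - by move=> x' t k1 k2; rewrite modulusM modulus_expi mulr1 hM// ymod.
have df0 (x : R) : 0 < x -> x < 1 -> df x = 0.
  move=> x0 x1.
  have h1 : - e < x by lra.
  have h2 : x < 1 + e by lra.
  have H : (rC x * iC) * df x = 0.
    rewrite -cintZ; last exact: cqy.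
    have -> : cint (fun t => rC x * iC * (q (y x t) * expi t)) =
        Q (y x (2 * pi)) - Q (y x 0).
      apply: (@cint_FTC _ _ (fun t => Q (y x t))); last exact: continuousCZ (cqy _ h1 h2).
      move=> t.
      have hy : is_cder (y x) t (rC x * (iC * expi t)).
        have := is_cderD (is_cder_cst z t) (is_cderZ (rC x)
          (is_cderD (is_cder_expi t) (is_cder_cst (- z) t))).
        by rewrite add0r addr0.
      have := is_cder_comp (dQ (ylt x t h1 h2)) hy.
      by congr (is_cder _ _ _); ring.
    by rewrite /y expi0 expi2pi subrr.
  move/eqP : H; rewrite !mulf_eq0 rC_eq0 (gt_eqF x0) /= => /orP[|/eqP//].
  by rewrite -modulus_eq0 modulus_iC oner_eq0.
have := @cder0_eq f df (- e) (1 + e).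
rewrite ltrDl oppr_lt0 => /(_ e0 e0 dff df0).
have -> : f 1 = cint (fun t => Q (expi t) * ckernel z t).
  by apply: eq_cint => t; rewrite yE subrr rC0 mul0r add0r rC1 mul1r.
move=> ->.
rewrite -cintZ; last exact: ck.
by apply: eq_cint => t; rewrite /y rC0 mul0r addr0.
Qed.

Lemma mean_value : cint (fun t => Q (expi t)) = rC (2 * pi) * Q 0.
Proof.
have z1 : modulus (0 : C) < 1 by rewrite modulus0.
have k1 (t : R) : ckernel 0 t = 1 by rewrite /ckernel mul0r subr0 invr1.
have := cauchy_homotopy z1.
have -> : cint (ckernel 0) = rC (2 * pi).
  by rewrite (eq_cint k1) cint_cst mulr1.
rewrite mulrC => <-; apply: eq_cint => t; by rewrite k1 mulr1.
Qed.

End Homotopy.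
End Cauchy.

(** * Rules for complex derivatives *)

Section HolCalc.
Context {R : realType}.
Local Notation C := (Cplx R).
Implicit Types (F G : C -> C) (z w : C).

Lemma hderM F G z (a b : C) : is_derive z (1:C) F a -> is_derive z (1:C) G b ->
  is_derive z (1:C) (fun w => F w * G w) (a * G z + F z * b).
Proof.
move=> hF hG.
have h := @is_deriveM R[i] C F G z 1 a b hF hG.
apply: is_derive_eq h _; rewrite addrC; congr (_ + _); by rewrite mulrC.
Qed.

Lemma hderD F G z (a b : C) : is_derive z (1:C) F a -> is_derive z (1:C) G b ->
  is_derive z (1:C) (fun w => F w + G w) (a + b).
Proof. move=> hF hG; exact: (@is_deriveD R[i] C C F G z 1 a b hF hG). Qed.

Lemma hder_cst (c : C) z : is_derive z (1:C) (fun=> c) (0 : C).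
Proof. exact: (@is_derive_cst R[i] C C c z 1). Qed.

Lemma hder_id z : is_derive z (1:C) (fun w => w) (1 : C).
Proof. exact: (@is_derive_id R[i] C z 1). Qed.

(** Converse of [hol_slope]. The factorization is asked only near [z], since the slope of an inverse
    makes sense only where the function does not vanish. *)
Lemma slope_hder F (Q : C -> C) z : {for z, continuous Q} ->
  (\forall w \near z, F w - F z = Q w * (w - z)) -> is_derive z (1:C) F (Q z).
Proof.
move=> cQ /nbhs_modulusP[d d0 FQ].
have h : (fun h : C => h^-1 *: (F (h *: (1:C) + z) - F z)) @ 0^' --> Q z.
  apply/cvg_modulusP => e e0.
  have : \forall w \near z, modulus (Q w - Q z) < e by move/cvg_modulusP : cQ; apply.
  move=> /nbhs_modulusP[d' d'0 hQ].
  rewrite near_withinE; apply/nbhs_modulusP; exists (Num.min d d').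
    by rewrite lt_min d0 d'0.
  move=> h; rewrite subr0 lt_min => /andP[hd hd'] h0.
  have -> : h *: (1:C) + z = h + z by rewrite [h *: _](mulr1 h).
  have E : h + z - z = h by rewrite addrK.
  have := FQ (h + z); rewrite E => /(_ hd) ->.
  have -> : h^-1 *: (Q (h + z) * h) = Q (h + z).
    rewrite [_ *: _](_ : _ = h^-1 * (Q (h + z) * h))//.
    by rewrite mulrCA mulVf// mulr1.
  by apply: hQ; rewrite E.
apply: DeriveDef; first by apply/cvg_ex; exists (Q z).
exact/cvg_lim.
Qed.

Lemma hderV F z (a : C) : F z != 0 -> is_derive z (1:C) F a ->
  is_derive z (1:C) (fun w => (F w)^-1) (- (F z)^-2 * a).
Proof.
move=> F0 hF; have cF := is_derive_hol_continuous hF.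
have [Q [Qz cQ QE]] := hol_slope hF.
pose Q' w : C := - ((F w)^-1 * (F z)^-1) * Q w.
have cV : (fun w => (F w)^-1) @ z --> (F z)^-1 by exact: (cvgCV F0 cF).
have -> : - (F z)^-2 * a = Q' z by rewrite /Q' Qz -invfM -expr2.
apply: slope_hder.
  exact: (cvgCM (cvgCN (cvgCM cV (cvgC_cst (F z)^-1))) cQ).
have : \forall w \near z, modulus (F w - F z) < modulus (F z).
  by move/(@cvg_modulusP R C (nbhs z)) : cF; apply; rewrite modulus_gt0.
apply: filterS => w hw.
have Fw0 : F w != 0.
  by apply: contraTneq hw => ->; rewrite sub0r modulusN ltxx.
rewrite /Q' -mulrA -QE; by field; rewrite F0 Fw0.
Qed.

End HolCalc.

(** * Poisson's formula *)

Section Poisson.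
Context {R : realType}.
Local Notation C := (Cplx R).
Implicit Types (z w : C).

Definition akernel (a : C) w : C := (1 - a * w)^-1.

Lemma hder_akernel (a w : C) : 1 - a * w != 0 ->
  is_derive w (1:C) (akernel a) (a * akernel a w ^+ 2).
Proof.
move=> h0.
have h : is_derive w (1:C) (fun v : C => 1 + - a * v) (0 + (0 * w + - a * 1)).
  exact: (hderD (hder_cst 1 w) (hderM (hder_cst (- a) w) (hder_id w))).
have h0' : 1 + - a * w != 0 by rewrite mulNr.
have := hderV (F := fun v : C => 1 + - a * v) h0' h.
congr (is_derive _ _ _ _); first by apply/funext => v; rewrite /akernel mulNr.
rewrite /akernel mul0r mulr1 !add0r !mulNr mulrN opprK exprVn mulrC //.
Qed.

Lemma ckernel_akernel z (t : R) : ckernel z t = cj (akernel (cj z) (expi t)).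
Proof. by rewrite /ckernel /akernel cjV cjB cj1 cjM cjK. Qed.

Lemma radius_exists (a : C) (r0 : R) : modulus a < 1 -> 1 < r0 ->
  exists r : R, [/\ 1 < r, r <= r0 & forall w, modulus w < r -> 1 - a * w != 0].
Proof.
move=> a1 r1; have a0 := modulus_ge0 a.
(* The pole of [akernel a] has modulus [1 / |a|]; for [|a| < 1] the number [2 / (1 + |a|)] lies
   strictly between 1 and it, and it also makes sense for [a = 0]. *)
pose s := 2 / (1 + modulus a).
have hp : 0 < 1 + modulus a by rewrite ltr_pwDl.
have s1 : 1 < s by rewrite /s ltr_pdivlMr//; lra.
exists (Num.min r0 s); split.
- by rewrite lt_min r1 s1.
- by rewrite ge_min lexx.
move=> w; rewrite lt_min => /andP[_ ws]; apply: modulus_lt_neq0; rewrite modulusM.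
have : modulus a * modulus w <= modulus a * s by rewrite ler_wpM2l// ltW.
move/le_lt_trans; apply.
rewrite /s mulrA ltr_pdivrMr//; lra.
Qed.

Lemma hder_akernel_cont (a w : C) : 1 - a * w != 0 ->
  {for w, continuous (akernel a)}.
Proof. by move=> h; exact: is_derive_hol_continuous (hder_akernel h). Qed.

(** On the circle the conjugate of [ckernel z] is the trace of the holomorphic function
    [akernel (cj z)], so the mean value property applies after conjugation, with value 1 at the
    centre. *)
Lemma cint_ckernel z : modulus z < 1 -> cint (ckernel z) = rC (2 * pi).
Proof.
move=> z1; have z1' : modulus (cj z) < 1 by rewrite modulusJ.
have [r [r1 _ hr]] := radius_exists z1' (ltr1n R 2).
have cE : continuous (fun t : R => akernel (cj z) (expi t)).
  move=> t; apply: continuousC_comp_at; first exact: continuous_expi.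
  by apply: hder_akernel_cont; apply: hr; rewrite modulus_expi.
rewrite (eq_cint (ckernel_akernel z)) cint_cj//.
have hd w : modulus w < r -> is_derive w (1:C) (akernel (cj z)) (cj z * akernel (cj z) w ^+ 2).
  by move=> wr; apply: hder_akernel; exact: hr.
have hc w : modulus w < r -> {for w, continuous (fun w : C => cj z * akernel (cj z) w ^+ 2)}.
  move=> wr; have c := hder_akernel_cont (hr w wr).
  exact: (cvgCM (cvgC_cst (cj z)) (cvgCM c c)).
by rewrite (mean_value r1 hd hc) /akernel mulr0 subr0 invr1 mulr1 cj_rC.
Qed.

Section Formula.
Variables (Q q : C -> C) (r0 : R).
Hypothesis r0_gt1 : 1 < r0.
Hypothesis dQ : forall w, modulus w < r0 -> is_derive w (1:C) Q (q w).
Hypothesis cq : forall w, modulus w < r0 -> {for w, continuous q}.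

Lemma cauchy_formula z : modulus z < 1 ->
  cint (fun t => Q (expi t) * ckernel z t) = rC (2 * pi) * Q z.
Proof.
by move=> z1; rewrite (cauchy_homotopy r0_gt1 dQ cq z1) cint_ckernel// mulrC.
Qed.

Let cQ w : modulus w < r0 -> {for w, continuous Q}.
Proof. by move=> wr; exact: is_derive_hol_continuous (dQ wr). Qed.

Lemma continuous_Q_expi : continuous (fun t : R => Q (expi t)).
Proof.
move=> t; apply: continuousC_comp_at; first exact: continuous_expi.
by apply: cQ; rewrite modulus_expi.
Qed.

(** With [a = cj z] the factor of [Q] extends to [a w / (1 - a w)], which vanishes at 0, so the mean
    value is 0. On the circle this factor is the conjugate of [ckernel z] minus 1: added to the
    Cauchy kernel it gives the Poisson kernel. *)
Lemma conj_cauchy_formula z : modulus z < 1 ->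
  cint (fun t => Q (expi t) * (cj z * expi t * akernel (cj z) (expi t))) = 0.
Proof.
move=> z1; have z1' : modulus (cj z) < 1 by rewrite modulusJ.
have [r [r1 rr0 hr]] := radius_exists z1' r0_gt1.
pose a := cj z.
have := @mean_value _ (fun w => Q w * (a * w * akernel a w))
  (fun w => q w * (a * w * akernel a w) +
     Q w * ((0 * w + a * 1) * akernel a w + a * w * (a * akernel a w ^+ 2))) r r1.
rewrite mulr0 mul0r !mulr0; apply.
  move=> w wr; have wr0 := lt_le_trans wr rr0.
  exact: (hderM (dQ wr0) (hderM (hderM (hder_cst a w) (hder_id w)) (hder_akernel (hr w wr)))).
move=> w wr; have wr0 := lt_le_trans wr rr0.
have c := hder_akernel_cont (hr w wr).
have idw : (fun v : C => v) @ w --> w by move=> A.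
have ca : (fun v : C => a * v) @ w --> a * w by exact: (cvgCM (cvgC_cst a) idw).
apply: (cvgCD (cvgCM (cq wr0) (cvgCM ca c))).
apply: (cvgCM (cQ wr0)); apply: cvgCD.
  exact: (cvgCM (cvgCD (cvgCM (cvgC_cst 0) idw) (cvgC_cst (a * 1))) c).
exact: (cvgCM ca (cvgCM (cvgC_cst a) (cvgCM c c))).
Qed.

(** The denominator is [|1 - rho expi x|^2]. There is no factor [1 / (2 pi)]: the integral over a
    period is [2 pi]. *)
Definition poisson (rho x : R) : R := (1 - rho ^+ 2) / (1 - 2 * rho * cos x + rho ^+ 2).

Lemma poisson_den_gt0 (rho x : R) : 0 <= rho -> rho < 1 -> 0 < 1 - 2 * rho * cos x + rho ^+ 2.
Proof.
move=> rho0 rho1; have c1 : cos x <= 1 := cos_le1 x.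
have : 0 <= rho * (1 - cos x) by rewrite mulr_ge0// subr_ge0.
have : 0 < (1 - rho) ^+ 2 by rewrite exprn_gt0// subr_gt0.
by rewrite !expr2; lra.
Qed.

Lemma poisson_ckernel (rho tau t : R) : 0 <= rho -> rho < 1 ->
  let z := rC rho * expi tau in
  ckernel z t + cj z * expi t * akernel (cj z) (expi t) = rC (poisson rho (t - tau)).
Proof.
move=> rho0 rho1 z.
have zm : modulus z = rho by rewrite modulusM modulusR modulus_expi mulr1 ger0_norm.
have z1 : modulus z < 1 by rewrite zm.
pose u := z * cj (expi t).
have u1 : 1 - u != 0 by exact: ckernel_den_neq0.
have cu : cj u = cj z * expi t by rewrite cjM cjK.
have cu1 : 1 - cj u != 0 by apply: modulus_lt_neq0; rewrite modulusJ modulus_mul_cj_expi.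
rewrite /akernel /ckernel -cu -/u.
have uu : u * cj u = rC (rho ^+ 2).
  by rewrite modulus_cj_mul modulus_mul_cj_expi zm.
have -> : (1 - u)^-1 + cj u * (1 - cj u)^-1 = (1 - u * cj u) / ((1 - u) * (1 - cj u)).
  by field; rewrite u1 cu1.
have uE : u = rC rho * expi (tau - t) by rewrite /u /z -mulrA cj_expi -expiD.
have -> : (1 - u) * (1 - cj u) = rC (1 - 2 * rho * cos (t - tau) + rho ^+ 2).
  have -> : (1 - u) * (1 - cj u) = 1 - (u + cj u) + u * cj u by ring.
  rewrite uu rCD rCB rC1; congr (_ - _ + _).
  apply: complex_eqP; rewrite (ReD, ImD) (Re_cj, Im_cj) uE (ReZ, ImZ) /=.
    by rewrite -(cosN (tau - t)) opprB; ring.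
  by rewrite subrr.
by rewrite uu -rC1 -rCB /poisson rCM rCV.
Qed.

Lemma continuous_akernel_expi (a : C) : modulus a < 1 ->
  continuous (fun t : R => akernel a (expi t)).
Proof.
move=> a1 t; apply: continuousC_comp_at; first exact: continuous_expi.
apply: hder_akernel_cont; apply: modulus_lt_neq0.
by rewrite modulusM modulus_expi mulr1.
Qed.

Lemma poisson_formula (rho tau : R) : 0 <= rho -> rho < 1 ->
  cint (fun t => rC (poisson rho (t - tau)) * Q (expi t)) =
    rC (2 * pi) * Q (rC rho * expi tau).
Proof.
move=> rho0 rho1; pose z := rC rho * expi tau.
have z1 : modulus z < 1 by rewrite modulusM modulusR modulus_expi mulr1 ger0_norm.
have z1' : modulus (cj z) < 1 by rewrite modulusJ.
rewrite -(cauchy_formula z1) -[RHS]addr0 -(conj_cauchy_formula z1).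
rewrite -cintD.
- apply: eq_cint => t; rewrite -mulrDr mulrC; congr (_ * _).
  by rewrite -(poisson_ckernel tau t rho0 rho1).
- exact: (continuousCM continuous_Q_expi (continuous_ckernel z1)).
- apply: (continuousCM continuous_Q_expi).
  apply: (continuousCM (continuousCZ (c := cj z) continuous_expi)).
  exact: continuous_akernel_expi.
Qed.

End Formula.
End Poisson.

Section PoissonDerivative.
Context {R : realType}.
Local Notation C := (Cplx R).
Implicit Types (z w : C).

Definition dpoisson (rho x : R) : R :=
  - ((1 - rho ^+ 2) * (2 * rho * sin x) / (1 - 2 * rho * cos x + rho ^+ 2) ^+ 2).

Lemma is_derive_poisson (rho x : R) : 0 <= rho -> rho < 1 ->
  is_derive x 1 (poisson rho) (dpoisson rho x).
Proof.
move=> rho0 rho1; have d0 := poisson_den_gt0 x rho0 rho1.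
have h : is_derive x 1 (fun y : R => 1 - 2 * rho * cos y + rho ^+ 2) (2 * rho * sin x).
  have -> : 2 * rho * sin x = 0 - (2 * rho) *: (- sin x) + 0.
    by rewrite scalerN opprK add0r addr0.
  exact: is_deriveD.
have h2 := @is_deriveV _ (fun y : R => 1 - 2 * rho * cos y + rho ^+ 2) x _ 1 (lt0r_neq0 d0) h.
have -> : dpoisson rho x = (1 - rho ^+ 2) *: (- (1 - 2 * rho * cos x + rho ^+ 2) ^- 2 *: (2 * rho * sin x)).
  rewrite /dpoisson /GRing.scale /=; field; exact: lt0r_neq0.
exact: is_deriveZ.
Qed.

Lemma poisson_gt0 (rho x : R) : 0 <= rho -> rho < 1 -> 0 < poisson rho x.
Proof.
move=> rho0 rho1; rewrite /poisson divr_gt0 ?poisson_den_gt0//.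
by rewrite subr_gt0 expr_lt1.
Qed.

Lemma continuous_poisson (rho : R) : 0 <= rho -> rho < 1 -> continuous (poisson rho).
Proof. by move=> h1 h2 x; exact: is_derive_cts (is_derive_poisson x h1 h2). Qed.

Lemma continuous_dpoisson (rho : R) : 0 <= rho -> rho < 1 -> continuous (dpoisson rho).
Proof.
move=> rho0 rho1 x; have d0 := poisson_den_gt0 x rho0 rho1.
have cc : cos y @[y --> x] --> cos x by exact: continuous_cos.
have cs : sin y @[y --> x] --> sin x by exact: continuous_sin.
apply: cvgN; apply: cvgM.
  by apply: cvgM; [exact: cvg_cst|apply: cvgM; [exact: cvg_cst|exact: cs]].
apply: cvgV; first by rewrite expf_neq0// lt0r_neq0.
have cd : (1 - 2 * rho * cos y + rho ^+ 2) @[y --> x] --> 1 - 2 * rho * cos x + rho ^+ 2.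
  apply: cvgD; last exact: cvg_cst.
  by apply: cvgB; [exact: cvg_cst|apply: cvgM; [exact: cvg_cst|exact: cc]].
exact: (cvgM cd cd).
Qed.

Lemma dpoisson_bound (rho x d : R) : 0 <= rho -> rho < 1 -> 0 < d ->
  d <= 1 - 2 * rho * cos x + rho ^+ 2 ->
  `|dpoisson rho x| <= 2 * (1 - rho ^+ 2) / d ^+ 2.
Proof.
move=> rho0 rho1 d0 dd; have p0 := poisson_den_gt0 x rho0 rho1.
rewrite /dpoisson normrN normrM normrM.
have h1 : 0 <= 1 - rho ^+ 2 by rewrite subr_ge0 expr_le1// ltW.
have -> : 2 * (1 - rho ^+ 2) / d ^+ 2 = (1 - rho ^+ 2) * (2 * d ^- 2) by ring.
rewrite (ger0_norm h1) -mulrA; apply: ler_wpM2l => //.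
apply: ler_pM => //.
  rewrite !normrM normr_nat (ger0_norm rho0) -mulrA ler_piMr//.
  by apply: mulr_ile1 => //; [exact: ltW|rewrite ler_norml sin_geN1 sin_le1].
rewrite normfV ger0_norm ?sqr_ge0// lef_pV2 ?posrE ?exprn_gt0//.
by rewrite ler_pXn2r// nnegrE ltW.
Qed.

Lemma poisson_den_ge (rho x : R) : 0 <= rho -> rho < 1 ->
  (1 - rho) ^+ 2 <= 1 - 2 * rho * cos x + rho ^+ 2.
Proof.
move=> rho0 rho1.
have : 0 <= rho * (1 - cos x) by rewrite mulr_ge0// subr_ge0 cos_le1.
by rewrite !expr2; lra.
Qed.

Lemma continuous_shift (f : R -> R) (s : R) : continuous f ->
  continuous (fun t => f (t - s)).
Proof.
move=> cf t; apply: (@continuous_comp _ _ _ (fun t : R => t - s) f t); last exact: cf.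
by apply: cvgB; [exact: cvg_id|exact: cvg_cst].
Qed.

Lemma continuous_rC (f : R -> R) : continuous f -> continuous (fun t => rC (f t)).
Proof.
move=> cf t; apply/(@cvg_ReImP R R (nbhs t)); split => //=; first exact: cf.
exact: cvg_cst.
Qed.

(** Both sides of Poisson's formula are differentiated in [tau]. The kernel depends on [t - tau],
    whence the sign, and [rho expi tau] moves with velocity [i z]. *)
Lemma poisson_derivative_formula (Q q : C -> C) (r0 rho tau : R) :
  1 < r0 ->
  (forall w, modulus w < r0 -> is_derive w (1:C) Q (q w)) ->
  (forall w, modulus w < r0 -> {for w, continuous q}) ->
  0 <= rho -> rho < 1 -> let z := rC rho * expi tau in
  cint (fun t => rC (dpoisson rho (t - tau)) * Q (expi t)) =
    - (rC (2 * pi) * (iC * z * q z)).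
Proof.
move=> r1 dQ cq rho0 rho1 z.
have cQ : continuous (fun t : R => Q (expi t)) by exact: (continuous_Q_expi r1 dQ).
pose B := 2 * (1 - rho ^+ 2) / ((1 - rho) ^+ 2) ^+ 2.
have [M hM] : exists M, forall w, modulus w <= 1 -> modulus (Q w) <= M.
  apply: disc_bounded => w w1; apply: is_derive_hol_continuous (dQ w _).
  exact: le_lt_trans w1 r1.
have cp s : continuous (fun t => rC (dpoisson rho (t - s))).
  exact/continuous_rC/continuous_shift/continuous_dpoisson.
have h : is_cder (fun s => cint (fun t => rC (poisson rho (t - s)) * Q (expi t))) tau
   (cint (fun t => - (rC (dpoisson rho (t - tau)) * Q (expi t)))).
  refine (@is_cder_cint _ (fun s t => rC (poisson rho (t - s)) * Q (expi t))
    (fun s t => - (rC (dpoisson rho (t - s)) * Q (expi t))) (B * M) (tau - 1) (tau + 1) tau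
      _ _ _ _ _); [lra|lra| | |].
  - move=> s _ _; apply: continuousCM; last exact: cQ.
    exact/continuous_rC/continuous_shift/continuous_poisson.
  - move=> s t _ _.
    have hd : is_derive s 1 (fun s => poisson rho (t - s)) (- dpoisson rho (t - s)).
      have hs : is_derive s 1 (fun s : R => t - s) (- 1).
        by have := @is_deriveB R R R (fun=> t) id s 1 _ _ (is_derive_cst t s 1) (is_derive_id s 1); rewrite sub0r.
      have := @is_derive1_comp _ (poisson rho) (fun s : R => t - s) s _ _ (is_derive_poisson (t - s) rho0 rho1) hs.
      by rewrite mulrN1.
    have := is_cderM (is_cder_real hd) (is_cder_cst (Q (expi t)) s).
    by rewrite mulr0 addr0 rCN mulNr.
  - move=> s t _ _; rewrite modulusN modulusM modulusR.
    apply: ler_pM => //; first exact: modulus_ge0.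
      apply: dpoisson_bound => //; last exact: poisson_den_ge.
      by rewrite exprn_gt0// subr_gt0.
    by apply: hM; rewrite modulus_expi.
have h2 : is_cder (fun s => rC (2 * pi) * Q (rC rho * expi s)) tau
    (rC (2 * pi) * (q z * (rC rho * (iC * expi tau)))).
  apply: is_cderZ.
  have hz : is_cder (fun s => rC rho * expi s) tau (rC rho * (iC * expi tau)).
    exact: is_cderZ (is_cder_expi tau).
  apply: (is_cder_comp (g := fun s => rC rho * expi s) _ hz).
  apply: dQ; rewrite modulusM modulusR modulus_expi mulr1 ger0_norm//; lra.
have E : (fun s => cint (fun t => rC (poisson rho (t - s)) * Q (expi t))) =
         (fun s => rC (2 * pi) * Q (rC rho * expi s)).
  by apply/funext => s; exact: (poisson_formula r1 dQ cq s rho0 rho1).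
rewrite E in h.
have U : cint (fun t => - (rC (dpoisson rho (t - tau)) * Q (expi t))) =
    rC (2 * pi) * (q z * (rC rho * (iC * expi tau))).
  exact: (cvg_unique _ h h2).
rewrite cintN in U; last exact: continuousCM (cp tau) cQ.
apply: oppr_inj; rewrite U opprK; congr (_ * _); rewrite /z; ring.
Qed.

End PoissonDerivative.

(** * Derivatives of absolutely continuous functions *)

Section Density.
Context {R : realType}.
Local Notation mu := (@lebesgue_measure R).
Variables (h : R -> R) (h0 : forall x, 0 <= h x).
Hypothesis ih : mu.-integrable setT (EFin \o h).

Definition density (A : set (measurableTypeR R)) : \bar R :=
  (\int[mu]_(x in A) (h x)%:E)%E.

Let mh : measurable_fun setT (EFin \o h).
Proof. exact: measurable_int ih. Qed.

Let density0 : density set0 = 0%E.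
Proof. by rewrite /density integral_set0. Qed.

Let density_ge0 A : (0 <= density A)%E.
Proof. by apply: integral_ge0 => x _; rewrite lee_fin. Qed.

Let density_sigma_additive : semi_sigma_additive density.
Proof.
move=> F mF tF mUF.
rewrite /density ge0_integral_bigcup//; last 2 first.
  by apply: measurable_funTS; exact: mh.
  by move=> x _; rewrite lee_fin.
apply: is_cvg_ereal_nneg_natsum_cond => n _ _.
by apply: integral_ge0 => x _; rewrite lee_fin.
Qed.

HB.instance Definition _ := isMeasure.Build _ _ _ density density0 density_ge0
  density_sigma_additive.

Definition density_measure : {measure set (measurableTypeR R) -> \bar R} := density.

End Density.

Section AbsolutelyContinuous.
Context {R : realType}.
Local Notation mu := (@lebesgue_measure R).

(* [U + V] is a primitive of [h], so the Stieltjes measure of [U] is dominated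
   by [h mu]. Its Radon-Nikodym density has [U] as a primitive, and Lebesgue
   differentiation applies. *)
Lemma nondecreasing_ac_derivable_ae (U V h : R -> R) :
  (forall x, 0 <= h x) -> mu.-integrable setT (EFin \o h) ->
  {homo U : x y / x <= y} -> {homo V : x y / x <= y} ->
  right_continuous U -> right_continuous V ->
  (forall a b, a <= b -> U b - U a + (V b - V a) = \int[mu]_(t in `]a, b]) h t) ->
  {ae mu, forall x : R, derivable U x 1}.
Proof.
move=> h0 ih ndU ndV rU rV UV.
pose uM := isCumulative.Build R _ R U ndU rU.
pose cU : cumulative R R := HB.pack U uM.
pose vM := isCumulative.Build R _ R V ndV rV.
pose cV : cumulative R R := HB.pack V vM.
have ndS : {homo (fun x => U x + V x) : x y / x <= y}.
  by move=> x y xy; rewrite lerD// ?ndU ?ndV.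
have rS : right_continuous (fun x => U x + V x).
  by move=> x; apply: cvgD; [exact: rU|exact: rV].
pose sM := isCumulative.Build R _ R (fun x => U x + V x) ndS rS.
pose cS : cumulative R R := HB.pack (fun x => U x + V x) sM.
pose kappa := density_measure h0 ih.
pose nU := lebesgue_stieltjes_measure cU.
pose nV := lebesgue_stieltjes_measure cV.
have itvE (f : cumulative R R) (a b : R) : a <= b ->
    lebesgue_stieltjes_measure f `]a, b] = (f b - f a)%:E.
  move=> ab; rewrite /lebesgue_stieltjes_measure /measure_extension measurable_mu_extE/=; last exact: is_ocitv.
  by rewrite wlength_itv_bnd.
have iS (A : set R) : measurable A -> mu.-integrable A (EFin \o h).
  by move=> mA; exact: (integrableS (mu := mu) measurableT mA (@subsetT _ A) ih).
have kE A : measurable A -> lebesgue_stieltjes_measure cS A = kappa A.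
  apply: lebesgue_stieltjes_measure_unique => X [[a b] _ <-] /=.
  have [ab|ab] := leP a b; last first.
    by rewrite set_itv_ge ?bnd_simp -?leNgt ?ltW// !measure0.
  rewrite itvE//= /kappa /density_measure /density.
  rewrite -[RHS]fineK; last exact/integrable_fin_num/iS.
  by congr EFin; rewrite -/(Rintegral _ _ _) -UV// opprD addrACA.
have sE A : measurable A -> lebesgue_stieltjes_measure cS A = (nU A + nV A)%E.
  move=> mA; rewrite (_ : (nU A + nV A)%E = measure_add nU nV A); last exact/esym/measure_addE.
  apply: lebesgue_stieltjes_measure_unique => // X [[a b] _ <-].
  transitivity (nU `]a, b]%classic + nV `]a, b]%classic)%E; last exact/esym/measure_addE.
  have [ab|ab] := leP a b; last first.
    by rewrite set_itv_ge ?bnd_simp -?leNgt ?ltW// /nU /nV !measure0 adde0.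
  by rewrite /nU /nV !itvE//= opprD addrACA EFinD.
have nUk A : measurable A -> (nU A <= kappa A)%E.
  by move=> mA; rewrite -kE// sE// leeDl// measure_ge0.
have kfin : (kappa setT < +oo)%E.
  rewrite /kappa /density_measure /density ltey_eq; apply/orP; left.
  exact: (integrable_fin_num measurableT ih).
have fU : fin_num_fun nU.
  move=> A mA; rewrite ge0_fin_numE ?measure_ge0//.
  rewrite (le_lt_trans (nUk A mA))// (le_lt_trans _ kfin)//.
  by rewrite le_measure// inE.
pose fM := Measure_isFinite.Build _ _ _ nU fU.
pose nUf : {finite_measure set (measurableTypeR R) -> \bar R} := HB.pack nU fM.
have dom : nUf `<< mu.
  apply/null_content_dominatesP => A mA A0.
  apply/eqP; rewrite -measure_le0 (le_trans (nUk A mA))//.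
  have -> : kappa A = (\int[mu]_(x in A) (EFin \o h) x)%E by [].
  by rewrite null_set_integral//; exact: (measurable_funTS (measurable_int _ ih)).
have [f [f0 ffin fint fE]] := radon_nikodym_sigma_finite dom.
pose g := fine \o f.
have gE : EFin \o g = f by apply/funext => x /=; rewrite fineK.
have ig : mu.-integrable setT (EFin \o g) by rewrite gE.
have Uab a b : a <= b -> U b - U a = \int[mu]_(t in `]a, b]) g t.
  move=> ab; have := fE `]a, b]%classic (measurable_itv _).
  rewrite /nUf /= /nU itvE//= -gE => e.
  by rewrite /Rintegral -e.
have igs (A : set R) : measurable A -> mu.-integrable A (EFin \o g).
  by move=> mA; exact: (integrableS (mu := mu) measurableT mA (@subsetT _ A) ig).
have locg : locally_integrable setT g.
  have := integrable_locally measurableT ig.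
  by rewrite patch_setT.
(* Lebesgue differentiation is applied to the primitive starting at minus infinity, which exists as
   [g] is integrable on the line; [U] differs from it by a constant. *)
pose F (x : R) := \int[mu]_(t in `]-oo, x]) g t.
have FE a b : a <= b -> F b - F a = \int[mu]_(t in `]a, b]) g t.
  by move=> ab; rewrite /F Rintegral_itvB//; exact: igs.
have UE : U = (fun y => F y + (U 0 - F 0)).
  apply/funext => y; have [y0|y0] := leP y 0.
    have := Uab _ _ y0; rewrite -FE// => e; lra.
  have := Uab _ _ (ltW y0); rewrite -FE ?ltW// => e; lra.
have [N [mN N0 sub]] := FTC1Ny (fun y => igs _ (measurable_itv _)) locg.
exists N; split => // x nd; apply: sub => /= -[dF _]; apply: nd => /=.
by rewrite UE; apply: derivableD; [exact: dF|exact: derivable_cst].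
Qed.

(* [Phi] is half the difference of the nondecreasing functions [W + Phi] and
   [W - Phi], where [W] is a primitive of [h]. *)
Lemma ac_derivable_ae (Phi h : R -> R) :
  (forall x, 0 <= h x) -> mu.-integrable setT (EFin \o h) ->
  (forall a b, a <= b -> `|Phi b - Phi a| <= \int[mu]_(t in `[a, b]) h t) ->
  {ae mu, forall x : R, derivable Phi x 1}.
Proof.
move=> h0 ih Ph.
have iS (A : set R) : measurable A -> mu.-integrable A (EFin \o h).
  by move=> mA; exact: (integrableS (mu := mu) measurableT mA (@subsetT _ A) ih).
pose W (x : R) := \int[mu]_(t in `]-oo, x]) h t.
have WE a b : a <= b -> W b - W a = \int[mu]_(t in `]a, b]) h t.
  by move=> ab; rewrite /W Rintegral_itvB//; exact: iS.
have oc (a b : R) : \int[mu]_(t in `]a, b]) h t = \int[mu]_(t in `[a, b]) h t.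
  by rewrite Rintegral_itv_obnd_cbnd//; exact: iS.
have Pab a b : a <= b -> - (W b - W a) <= Phi b - Phi a <= W b - W a.
  by move=> ab; rewrite -ler_norml WE// oc Ph.
(* The increments of [s Phi] are bounded by those of [W], and these tend to 0 from the right. Both
   signs [s = 1] and [s = -1] are needed. *)
have rc (s : R) (S : R -> R) : `|s| <= 1 -> S = (fun x => W x + s * Phi x) -> right_continuous S.
  move=> s1 SE x; apply/cvgrPdist_lt => e e0.
  have := @parameterized_integral_near_left _ x (x + 1) (e / 2) h.
  rewrite ltrDl => /(_ ltr01); rewrite divr_gt0// => /(_ isT (iS _ (measurable_itv _))).
  move=> H; near=> y.
  have xy : x < y by near: y; exact: nbhs_right_gt.
  have : `|\int[mu]_(t in `[x, y]) h t| < e / 2.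
    near: y; rewrite near_withinE; apply: filterS H => y hy xy; exact/hy/ltW.
  rewrite -oc -WE ?ltW// => Wl; have := Pab _ _ (ltW xy) => /andP[P1 P2].
  have W0 : 0 <= W y - W x by have := le_trans P1 P2; clear; lra.
  rewrite (ger0_norm W0) in Wl.
  have sP : `|s * (Phi y - Phi x)| <= W y - W x.
    rewrite normrM (le_trans (ler_piMl _ s1))// ler_norml P1 P2 //.
  rewrite SE distrC; have -> : W y + s * Phi y - (W x + s * Phi x) =
    (W y - W x) + s * (Phi y - Phi x) by ring.
  rewrite (le_lt_trans (ler_normD _ _))// (ger0_norm W0) [ltRHS]splitr.
  by rewrite ltrD// (le_lt_trans sP).
pose U x := W x + 1 * Phi x; pose V x := W x + (-1) * Phi x.
have ndU : {homo U : x y / x <= y}.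
  by move=> x y xy; have /andP[? ?] := Pab _ _ xy; rewrite /U; lra.
have ndV : {homo V : x y / x <= y}.
  by move=> x y xy; have /andP[? ?] := Pab _ _ xy; rewrite /V; lra.
have rU : right_continuous U by apply: (rc 1) => //; rewrite normr1.
have rV : right_continuous V by apply: (rc (-1)) => //; rewrite normrN normr1.
(* [U + V = 2 W], so the density to be used is [2 h]; exchanging [U] and [V] gives the derivability
   of the second function. *)
have h20 x : 0 <= 2 * h x by rewrite mulr_ge0.
have ih2 : mu.-integrable setT (EFin \o (fun x => 2 * h x)).
  by under [X in _.-integrable _ X]eq_fun do rewrite /= EFinM; exact: integrableZl.
have [|N1 [mN1 N10 s1]] := nondecreasing_ac_derivable_ae h20 ih2 ndU ndV rU rV.
  by move=> a b ab; rewrite RintegralZl// -?WE//; [rewrite /U /V; ring|exact: iS].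
have VU a b : a <= b -> V b - V a + (U b - U a) = \int[mu]_(t in `]a, b]) (2 * h t).
  by move=> ab; rewrite RintegralZl// -?WE//; [rewrite /U /V; ring|exact: iS].
have [N2 [mN2 N20 s2]] := nondecreasing_ac_derivable_ae h20 ih2 ndV ndU rV rU VU.
exists (N1 `|` N2); split; first exact: measurableU.
  by rewrite measureU0.
move=> x nd; apply: contrapT => /not_orP[n1 n2]; apply: nd => /=.
have dU : derivable U x 1 by apply: contrapT => k; apply: n1; exact: s1.
have dV : derivable V x 1 by apply: contrapT => k; apply: n2; exact: s2.
have -> : Phi = (fun x => 2^-1 *: (U x - V x)).
  by apply/funext => y; rewrite /U /V /GRing.scale /=; field.
exact: (@derivableZ R R R (fun x => U x - V x) 2^-1 x 1 (@derivableB R R R U V x 1 dU dV)).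
Unshelve. all: by end_near. Qed.

End AbsolutelyContinuous.

(** * Fatou's theorem for Poisson integrals *)

Section FatouKernel.
Context {R : realType}.
Local Notation mu := (@lebesgue_measure R).
Local Notation C := (Cplx R).

(** Mean value theorem for [sin x - x cos x], whose derivative [x sin x] is nonnegative up to
    [pi]. *)
Lemma ler_mul_cos_sin (y : R) : 0 <= y -> y <= pi -> y * cos y <= sin y.
Proof.
rewrite le_eqVlt => /predU1P[<- _|y0 ypi]; first by rewrite mul0r sin0.
pose f (x : R) := sin x - x * cos x.
have df (x : R) : is_derive x 1 f (x * sin x).
  have h : is_derive x 1 (fun x : R => x * cos x) (x *: (- sin x) + cos x *: 1).
    exact: (@is_deriveM R R id cos x 1 _ _ (is_derive_id x 1) (is_derive_cos x)).
  have -> : x * sin x = cos x - (x *: (- sin x) + cos x *: 1).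
    by rewrite /GRing.scale /=; ring.
  exact: (@is_deriveB R R R sin (fun x : R => x * cos x) x 1 _ _ (is_derive_sin x) h).
have cf : {within `[0, y], continuous f}.
  by apply: continuous_subspaceT => x; exact: is_derive_cts (df x).
have [c] := MVT y0 (fun x _ => df x) cf.
rewrite in_itv /= => /andP[c0 cy].
have f0 : f 0 = 0 by rewrite /f sin0 mul0r subrr.
rewrite f0 subr0 subr0 => fy; rewrite -subr_ge0 -/(f y) fy.
rewrite mulr_ge0 ?(ltW y0)// mulr_ge0 ?(ltW c0)// sin_ge0_pi//.
by rewrite (ltW c0) (ltW (lt_le_trans cy ypi)).
Qed.

(** Half-angle formulas reduce this to [y cos y <= sin y] with [y = x / 2]. It lets the denominator
    [(1 - rho)^2 + 2 rho (1 - cos x)] of the Poisson kernel absorb the factor [x] in front of its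
    derivative. *)
Lemma ler_norm_mul_sin (x : R) : `|x| <= pi -> `|x| * `|sin x| <= 2 * (1 - cos x).
Proof.
move=> xpi; wlog x0 : x xpi / 0 <= x.
  move=> H; have [x0|x0] := leP 0 x; first exact: H.
  by have := H (- x); rewrite normrN sinN normrN cosN; apply; rewrite // oppr_ge0 ltW.
rewrite (ger0_norm x0) in xpi *.
pose y := x / 2; have xE : x = y *+ 2 by rewrite /y mulr2n; field.
have y0 : 0 <= y by rewrite divr_ge0.
have ypi : y <= pi by rewrite /y; have := pi_ge0 R; lra.
have s0 : 0 <= sin x by rewrite sin_ge0_pi// x0.
have sy0 : 0 <= sin y by rewrite sin_ge0_pi// y0.
rewrite (ger0_norm s0).
have c2 : 1 - cos x = 2 * sin y ^+ 2.
  rewrite xE cos_mulr2n sin2cos2 mulr2n; ring.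
have s2 : sin x = 2 * (sin y * cos y) by rewrite xE sin_mulr2n mulr2n; ring.
rewrite c2 s2.
have := ler_wpM2r sy0 (ler_mul_cos_sin y0 ypi).
have -> : x = 2 * y by rewrite /y; field.
rewrite expr2; lra.
Qed.

(* In an approach region [|tau - t0| <= A (1 - rho)], hence
   [|t - t0| <= |t - tau| + A (1 - rho)]: this bounds the integral of a
   remainder [o(t - t0)] against [dpoisson rho (t - tau)]. *)
Lemma dpoisson_le_poisson (rho x A : R) : 0 <= rho -> rho < 1 -> 0 <= A -> `|x| <= pi ->
  (`|x| + A * (1 - rho)) * `|dpoisson rho x| <= (2 + A) * poisson rho x.
Proof.
move=> rho0 rho1 A0 xpi.
have d0 := poisson_den_gt0 x rho0 rho1.
have h1 : 0 <= 1 - rho ^+ 2 by rewrite subr_ge0 expr_le1// ltW.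
set d := 1 - 2 * rho * cos x + rho ^+ 2 in d0 *.
have -> : `|dpoisson rho x| = (1 - rho ^+ 2) / d * ((2 * rho * `|sin x|) / d).
  rewrite /dpoisson -/d normrN !normrM normfV normr_nat (ger0_norm rho0) (ger0_norm h1).
  rewrite (ger0_norm (sqr_ge0 d)); field; exact: lt0r_neq0.
rewrite /poisson -/d mulrCA [leRHS]mulrC; apply: ler_wpM2l; first by rewrite divr_ge0// ltW.
rewrite mulrA ler_pdivrMr//.
have hs := ler_norm_mul_sin xpi.
have c1 := cos_le1 x.
have hq1 : `|x| * `|sin x| * rho <= 2 * (1 - cos x) * rho by rewrite ler_wpM2r.
have q0 : 0 <= (1 - rho) ^+ 2 by exact: sqr_ge0.
(* This square bounds [2 (1 - rho) rho |sin x|] by [(1 - rho)^2 + rho^2 |sin x|^2], and with [q2] by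
   [d]; that is [k2], the part of the estimate that carries [A]. *)
have q1 : 0 <= ((1 - rho) - rho * `|sin x|) ^+ 2 by exact: sqr_ge0.
have s2 : `|sin x| ^+ 2 <= 2 * (1 - cos x).
  rewrite real_normK ?num_real// sin2cos2.
  have : 0 <= (1 - cos x) ^+ 2 by exact: sqr_ge0.
  rewrite !expr2; lra.
have q2 : rho ^+ 2 * `|sin x| ^+ 2 <= rho * (2 * (1 - cos x)).
  apply: (le_trans (ler_wpM2l (sqr_ge0 rho) s2)).
  apply: ler_wpM2r; first by rewrite mulr_ge0// subr_ge0.
  by rewrite expr2 ler_piMr// ltW.
have dE : d = (1 - rho) ^+ 2 + 2 * rho * (1 - cos x) by rewrite /d; ring.
have k1 : `|x| * (2 * rho * `|sin x|) <= 2 * d by rewrite dE !expr2 in q0 *; lra.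
have k2 : (1 - rho) * (2 * rho * `|sin x|) <= d by rewrite dE !expr2 in q0 q1 q2 *; lra.
have k3 := ler_wpM2l A0 k2.
by have := lerD k1 k3; lra.
Qed.

Lemma cos_far (e x : R) : 0 <= e -> e <= `|x| -> `|x| <= 2 * pi - e -> cos x <= cos e.
Proof.
move=> e0 ex xe.
have key (y : R) : e <= y -> y <= pi -> cos y <= cos e.
  rewrite le_eqVlt => /predU1P[->//|ey] ypi; apply: ltW.
  by rewrite ltr_cos// in_itv /= ?e0 ?(le_trans (ltW ey))// (le_trans e0)// ltW.
have -> : cos x = cos `|x| by case: (ger0P x) => // _; rewrite cosN.
have [xpi|xpi] := leP `|x| pi; first exact: key.
have -> : cos `|x| = cos (2 * pi - `|x|).
  by rewrite mulrC mulr_natr cosB cos2pi sin2pi mul1r mul0r addr0.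
apply: key; lra.
Qed.

Lemma itv_bounded (f : R -> R) (a b : R) : continuous f ->
  exists M, forall t, t \in `[a, b] -> `|f t| <= M.
Proof.
move=> cf.
have : compact (f @` `[a, b]).
  by apply: continuous_compact; [exact: continuous_subspaceT|exact: segment_compact].
move=> /compact_bounded[M [_ hM]]; exists (M + 1) => t tab.
by apply: (hM (M + 1)); [rewrite ltrDl|exists t].
Qed.

Lemma is_derive_shift (f : R -> R) (df s t : R) : is_derive (t - s) 1 f df ->
  is_derive t 1 (fun y : R => f (y - s)) df.
Proof.
move=> h.
have hs : is_derive t 1 (fun y : R => y - s) (1 : R).
  by have := @is_deriveB R R R id (fun=> s) t 1 _ _ (is_derive_id t 1) (is_derive_cst s t 1); rewrite subr0.
have := @is_derive1_comp _ f (fun y : R => y - s) t _ _ h hs.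
by rewrite mulr1.
Qed.

Lemma Rintegral_poisson (rho tau : R) : 0 <= rho -> rho < 1 ->
  \int[mu]_(t in `[0, 2 * pi]) poisson rho (t - tau) = 2 * pi.
Proof.
move=> rho0 rho1.
have hd (w : C) : modulus w < 2 -> is_derive w (1:C) (fun=> (1:C)) (0:C).
  by move=> _; exact: hder_cst.
have hc (w : C) : modulus w < 2 -> {for w, continuous (fun=> (0:C))}.
  by move=> _; exact: (cvgC_cst (X := nbhs w)).
have := poisson_formula (ltr1n R 2) hd hc tau rho0 rho1.
rewrite mulr1 => /(congr1 (@complex.Re R)) /= h; rewrite -[RHS]h.
by apply: eq_Rintegral => t _; rewrite mulr1 mulr0 subr0.
Qed.

Lemma poisson_period (rho x : R) : poisson rho (2 * pi + x) = poisson rho x.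
Proof.
have e : cos (2 * pi + x) = cos x by rewrite addrC mulrC mulr_natr cosD2pi.
by rewrite /poisson e.
Qed.

Lemma Rintegral_dpoisson (rho tau : R) : 0 <= rho -> rho < 1 ->
  \int[mu]_(t in `[0, 2 * pi]) dpoisson rho (t - tau) = 0.
Proof.
move=> rho0 rho1.
have dF (t : R) : is_derive t 1 (fun t => poisson rho (t - tau)) (dpoisson rho (t - tau)).
  by apply: is_derive_shift; exact: is_derive_poisson.
have cf : continuous (fun t => dpoisson rho (t - tau)).
  exact/continuous_shift/continuous_dpoisson.
by rewrite (Rintegral_FTC (pi2_ge0 (R := R)) dF cf) poisson_period sub0r subrr.
Qed.

(** The factor [t - t0] is not periodic, so integration by parts leaves the boundary term
    [2 pi poisson rho tau]. It tends to 0 as [rho] tends to 1 with [tau] away from the multiples of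
    [2 pi]. *)
Lemma Rintegral_id_dpoisson (rho tau t0 : R) : 0 <= rho -> rho < 1 ->
  \int[mu]_(t in `[0, 2 * pi]) ((t - t0) * dpoisson rho (t - tau)) =
  2 * pi * poisson rho tau - 2 * pi.
Proof.
move=> rho0 rho1.
have cid : continuous (fun t : R => t - t0).
  by move=> t; apply: cvgB; [exact: cvg_id|exact: cvg_cst].
have cp : continuous (fun t : R => poisson rho (t - tau)) by exact/continuous_shift/continuous_poisson.
have cd : continuous (fun t : R => dpoisson rho (t - tau)) by exact/continuous_shift/continuous_dpoisson.
have cm : continuous (fun t : R => (t - t0) * dpoisson rho (t - tau)).
  by move=> t; apply: cvgM; [exact: cid|exact: cd].
have : \int[mu]_(t in `[0, 2 * pi]) ((t - t0) * dpoisson rho (t - tau) + poisson rho (t - tau)) =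
    2 * pi * poisson rho tau.
  have dF (t : R) : is_derive t 1 (fun t => (t - t0) * poisson rho (t - tau))
      ((t - t0) * dpoisson rho (t - tau) + poisson rho (t - tau)).
    have h1 : is_derive t 1 (fun y : R => y - t0) (1 : R).
      by apply: (@is_derive_shift id); exact: is_derive_id.
    have h2 : is_derive t 1 (fun y : R => poisson rho (y - tau)) (dpoisson rho (t - tau)).
      by apply: is_derive_shift; exact: is_derive_poisson.
    have := @is_deriveM R R (fun y : R => y - t0) (fun y : R => poisson rho (y - tau)) t 1 _ _ h1 h2.
    by rewrite /GRing.scale /= mulr1.
  have cf : continuous (fun t => (t - t0) * dpoisson rho (t - tau) + poisson rho (t - tau)).
    by move=> t; apply: cvgD; [exact: cm|exact: cp].
  rewrite (Rintegral_FTC (pi2_ge0 (R := R)) dF cf) poisson_period !sub0r.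
  have -> : poisson rho (- tau) = poisson rho tau by rewrite /poisson cosN.
  ring.
rewrite RintegralD//; [|exact: continuous_itv_integrable..].
by rewrite Rintegral_poisson// => <-; rewrite addrK.
Qed.

End FatouKernel.

Section FatouLimit.
Context {R : realType}.
Local Notation mu := (@lebesgue_measure R).

Lemma is_derive_remainder (g : R -> R) (t0 D e : R) : is_derive t0 1 g D -> 0 < e ->
  exists2 d : R, 0 < d & forall t, `|t - t0| < d -> `|g t - g t0 - D * (t - t0)| <= e * `|t - t0|.
Proof.
move=> /is_deriveP /cvgrPdist_lt /(_ e) H e0; have {H} := H e0.
rewrite near_withinE => /nbhs_ballP[d /= d0 hd]; exists d => // t td.
have [->|tt0] := eqVneq t t0; first by rewrite !subrr mulr0 normr0 mulr0 subrr normr0.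
have h0 : t - t0 != 0 by rewrite subr_eq0.
have := hd (t - t0); rewrite /ball /= sub0r normrN => /(_ td h0).
rewrite subrK => /ltW h.
have -> : g t - g t0 - D * (t - t0) = - ((D - (t - t0)^-1 * (g t - g t0)) * (t - t0)).
  by field.
by rewrite normrN normrM ler_wpM2r.
Qed.

(** Write [g] as its affine part at [t0] plus a remainder [er]. The constant integrates to 0 and the
    linear part to [- 2 pi D] up to a vanishing boundary term. Near [t0] the remainder is at most
    [e1 |t - t0|] and [dpoisson_le_poisson] applies; far from [t0] it is bounded while [dpoisson] is
    of order [1 - rho]. *)
Lemma fatou_kernel (g : R -> R) (t0 D A e : R) : 0 < t0 -> t0 < 2 * pi ->
  continuous g -> is_derive t0 1 g D -> 0 <= A -> 0 < e ->
  exists2 d : R, 0 < d & forall rho tau, 0 <= rho -> rho < 1 -> 1 - rho < d ->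
    `|tau - t0| <= A * (1 - rho) ->
    `|\int[mu]_(t in `[0, 2 * pi]) (g t * dpoisson rho (t - tau)) + 2 * pi * D| < e.
Proof.
move=> t00 t02 cg dg A0 e0.
have pi2 : 2 <= pi :> R by exact: pi_ge2.
pose p2 : R := 2 * pi.
have p20 : 0 < p2 by rewrite mulr_gt0 ?pi_gt0.
(* The near part is at most [e1 (2 + A)] times the integral [2 pi] of the Poisson kernel; this
   choice makes it [e / 2]. *)
pose e1 := e / (2 * ((2 + A) * p2)).
have AA : 0 < 2 + A by lra.
have e10 : 0 < e1 by rewrite divr_gt0// mulr_gt0// mulr_gt0.
have [n0 [n00 n01 hn0]] : exists n0 : R, [/\ 0 < n0, n0 <= 1 & forall t, `|t - t0| < n0 ->
    `|g t - g t0 - D * (t - t0)| <= e1 * `|t - t0|].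
  have [n n0 hn] := is_derive_remainder dg e10.
  exists (Num.min n 1); rewrite lt_min n0 ltr01 ge_min lexx orbT; split => // t.
  by rewrite lt_min => /andP[tn _]; exact: hn.
pose er t := g t - g t0 - D * (t - t0).
have cer : continuous er.
  move=> t; apply: cvgB; first by apply: cvgB; [exact: cg|exact: cvg_cst].
  by apply: cvgM; [exact: cvg_cst|apply: cvgB; [exact: cvg_id|exact: cvg_cst]].
have [B hB] := itv_bounded 0 p2 cer.
have B0 : 0 <= B.
  by rewrite (le_trans (normr_ge0 (er 0)))// hB// in_itv /= lexx ltW.
(* Margins for [|tau - t0| <= m]. If [|t - t0| >= n0], then [|t - tau| >= m]; [|tau|] lies between
   [m] and [2 pi - m], and [|t - tau| <= 2 pi - m] on the interval; if [|t - t0| < n0], then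
   [|t - tau| <= n0 + m <= pi]. *)
have [m [m0 m1 mn mt0 mt1]] : exists m : R, [/\ 0 < m, m <= 2^-1, 2 * m <= n0,
    2 * m <= t0 & 2 * m <= 2 * pi - t0].
  exists (Num.min (2^-1) (Num.min (n0 / 2) (Num.min (t0 / 2) ((2 * pi - t0) / 2)))).
  set x1 := (n0 / 2); set x2 := (t0 / 2); set x3 := ((2 * pi - t0) / 2).
  have h1 : Num.min 2^-1 (Num.min x1 (Num.min x2 x3)) <= 2^-1 by rewrite ge_min lexx.
  have h2 : Num.min 2^-1 (Num.min x1 (Num.min x2 x3)) <= x1 by rewrite !ge_min lexx ?orbT.
  have h3 : Num.min 2^-1 (Num.min x1 (Num.min x2 x3)) <= x2 by rewrite !ge_min lexx ?orbT.
  have h4 : Num.min 2^-1 (Num.min x1 (Num.min x2 x3)) <= x3 by rewrite !ge_min lexx ?orbT.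
  have h5 : 0 < Num.min 2^-1 (Num.min x1 (Num.min x2 x3)).
    by rewrite !lt_min /x1 /x2 /x3 invr_gt0 ltr0n !divr_gt0// subr_gt0.
  by move: h1 h2 h3 h4 h5; clear; rewrite /x1 /x2 /x3; split; lra.
pose k := 1 - cos m.
have k0 : 0 < k.
  rewrite subr_gt0 -cos0 ltr_cos ?in_itv /= ?lexx ?pi_ge0 ?(ltW m0)//; lra.
(* Total coefficient of [1 - rho]: the far part of the remainder, then the boundary term of the
   linear part. *)
pose K := p2 * (B * (4 / k ^+ 2)) + `|D| * (p2 * (2 / k)).
have K0 : 0 <= K.
  apply: addr_ge0; first by rewrite mulr_ge0 ?(ltW p20)// mulr_ge0// divr_ge0// exprn_ge0 ?ltW.
  by rewrite mulr_ge0// mulr_ge0 ?(ltW p20)// divr_ge0// ltW.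
(* The three bounds give [rho > 1 / 2], so that the Poisson denominator is at least [k] away from
   the peak; [|tau - t0| <= m]; and [K (1 - rho) < e / 2]. *)
pose d := Num.min (2^-1) (Num.min (m / (A + 1)) (e / (2 * (K + 1)))).
have A1 : 0 < A + 1 by lra.
have K1 : 0 < K + 1 by lra.
exists d; first by rewrite /d !lt_min invr_gt0 ltr0n !divr_gt0// mulr_gt0.
move=> rho tau rho0 rho1; rewrite /d !lt_min => /and3P[q1 q2 q3] tauA.
pose q := 1 - rho; have q0 : 0 < q by rewrite /q subr_gt0.
have taum : `|tau - t0| <= m.
  apply: (le_trans tauA); rewrite ltr_pdivlMr// in q2.
  by apply: (le_trans _ (ltW q2)); rewrite mulrC ler_wpM2l ?(ltW q0)//; lra.
have dk (x : R) : m <= `|x| -> `|x| <= 2 * pi - m -> k <= (1 - 2 * rho * cos x + rho ^+ 2).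
  move=> h1 h2; have c := cos_far (ltW m0) h1 h2.
  have h3 : rho * cos x <= rho * cos m by rewrite ler_wpM2l.
  have c3 : (1 - rho) * (1 - cos m) <= rho * (1 - cos m).
    by apply: ler_wpM2r; [exact: ltW|move: q1; clear; lra].
  have c4 : 0 <= (1 - rho) ^+ 2 by exact: sqr_ge0.
  by move: h3 c3 c4; rewrite /k !expr2; clear; lra.
have rq : 1 - rho ^+ 2 <= 2 * q.
  rewrite /q expr2.
  have : rho * rho <= 1 * 1 by rewrite ler_pM// ltW.
  have : 0 <= (1 - rho) * (1 - rho) by rewrite mulr_ge0 ?ltW.
  clear; lra.
have rq0 : 0 <= 1 - rho ^+ 2 by rewrite subr_ge0 expr_le1// ltW.
have ptau : poisson rho tau <= 2 / k * q.
  rewrite /poisson [leRHS]mulrAC; apply: ler_pM => //.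
    by rewrite invr_ge0 ltW// poisson_den_gt0.
  rewrite lef_pV2 ?posrE ?poisson_den_gt0//; apply: dk.
    by apply: (le_trans _ (ler_norm _)); move: taum mt0; rewrite ler_norml; clear => /andP[]; lra.
  by rewrite ler_norml; move: taum m0 mt0 mt1; rewrite ler_norml; clear => /andP[]; lra.
have farb t : t \in `[0, 2 * pi] -> ~~ (`|t - t0| < n0) -> `|dpoisson rho (t - tau)| <= 4 / k ^+ 2 * q.
  rewrite in_itv /= => /andP[tt0 tt2]; rewrite -leNgt => tn.
  have tE : t - t0 = (t - tau) + (tau - t0) by ring.
  have h1 : m <= `|t - tau|.
    have : n0 <= `|t - tau| + `|tau - t0| by rewrite (le_trans tn)// tE ler_normD.
    by move: taum mn; clear; lra.
  have h2 : `|t - tau| <= 2 * pi - m.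
    by rewrite ler_norml; move: taum mt0 mt1 tt0 tt2; rewrite ler_norml; clear => /andP[]; lra.
  apply: (le_trans (dpoisson_bound rho0 rho1 k0 (dk _ h1 h2))).
  have -> : 4 / k ^+ 2 * q = 2 * (2 * q) / k ^+ 2 by ring.
  rewrite ler_wpM2r ?invr_ge0 ?exprn_ge0 ?(ltW k0)//; exact: ler_wpM2l.
have cd : continuous (fun t : R => dpoisson rho (t - tau)) by exact/continuous_shift/continuous_dpoisson.
have cp : continuous (fun t : R => poisson rho (t - tau)) by exact/continuous_shift/continuous_poisson.
have cst_c (c : R) : continuous (fun _ : R => c) by move=> t; exact: cvg_cst.
have cMf (f1 f2 : R -> R) : continuous f1 -> continuous f2 -> continuous (fun t => f1 t * f2 t).
  by move=> c1 c2 t; apply: cvgM; [exact: c1|exact: c2].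
have cDf (f1 f2 : R -> R) : continuous f1 -> continuous f2 -> continuous (fun t => f1 t + f2 t).
  by move=> c1 c2 t; apply: cvgD; [exact: c1|exact: c2].
have cit (f : R -> R) : continuous f -> mu.-integrable `[0, 2 * pi] (EFin \o f).
  exact: continuous_itv_integrable.
pose I := \int[mu]_(t in `[0, 2 * pi]) (er t * dpoisson rho (t - tau)).
have cid : continuous (fun t : R => t - t0) by apply: cDf; [move=> t; exact: cvg_id|exact: cst_c].
have gE : \int[mu]_(t in `[0, 2 * pi]) (g t * dpoisson rho (t - tau)) =
    I + (g t0 * 0 + D * (2 * pi * poisson rho tau - 2 * pi)).
  have c1 : continuous (fun t => er t * dpoisson rho (t - tau)) by exact: cMf.
  have c3 : continuous (fun t => (t - t0) * dpoisson rho (t - tau)) by exact: cMf.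
  have c4 : continuous (fun t => g t0 * dpoisson rho (t - tau)) by apply: cMf => //; exact: cst_c.
  have c5 : continuous (fun t => D * ((t - t0) * dpoisson rho (t - tau))).
    by apply: cMf => //; exact: cst_c.
  have c6 : continuous (fun t => g t0 * dpoisson rho (t - tau) +
      D * ((t - t0) * dpoisson rho (t - tau))) by exact: cDf.
  transitivity (I + (g t0 * \int[mu]_(t in `[0, 2 * pi]) dpoisson rho (t - tau) +
      D * \int[mu]_(t in `[0, 2 * pi]) ((t - t0) * dpoisson rho (t - tau)))); last first.
    by rewrite (Rintegral_dpoisson tau rho0 rho1) (Rintegral_id_dpoisson tau t0 rho0 rho1).
  rewrite /I.
  rewrite -(RintegralZl (mu := mu) _ (measurable_itv _) (cit _ cd)).
  rewrite -(RintegralZl (mu := mu) _ (measurable_itv _) (cit _ c3)).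
  rewrite -(RintegralD (mu := mu) (measurable_itv _) (cit _ c4) (cit _ c5)).
  rewrite -(RintegralD (mu := mu) (measurable_itv _) (cit _ c1) (cit _ c6)).
  by apply: eq_Rintegral => t _; rewrite /er; ring.
pose cc := B * (4 / k ^+ 2) * q.
have Ib : `|I| <= e1 * (2 + A) * p2 + cc * p2.
  apply: (le_trans (le_normr_Rintegral _ _)) => //; first by apply: cit; exact: cMf.
  have -> : e1 * (2 + A) * p2 + cc * p2 =
      \int[mu]_(t in `[0, 2 * pi]) (e1 * (2 + A) * poisson rho (t - tau) + cc).
    rewrite RintegralD//; [|by apply: cit; apply: cMf; [exact: cst_c|exact: cp]|exact/cit/cst_c].
    rewrite RintegralZl//; last exact: cit.
    rewrite Rintegral_poisson// Rintegral_cst//; congr (_ + _ * _).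
    by rewrite /= lebesgue_measure_itv /= lte_fin p20 /= subr0.
  apply: le_Rintegral => //.
  - apply: cit => t; apply: cvg_norm; apply: cvgM; [exact: cer|exact: cd].
  - by apply: cit; apply: cDf; [apply: cMf; [exact: cst_c|exact: cp]|exact: cst_c].
  move=> t tI; rewrite normrM.
  have pp : 0 < poisson rho (t - tau) by exact: poisson_gt0.
  have c0 : 0 <= cc by rewrite /cc mulr_ge0 ?(ltW q0)// mulr_ge0// divr_ge0// exprn_ge0// ltW.
  have [tn|tf] := boolP (`|t - t0| < n0); last first.
    apply: (@le_trans _ _ cc); last first.
      rewrite lerDr; apply: mulr_ge0; last exact: ltW.
      by apply: mulr_ge0; exact: ltW.
    by rewrite /cc -mulrA; apply: ler_pM => //; [exact: hB|exact: farb].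
  apply: (@le_trans _ _ (e1 * (2 + A) * poisson rho (t - tau))); last by rewrite lerDl.
  have h1 : `|er t| <= e1 * (`|t - tau| + A * q).
    apply: (le_trans (hn0 t tn)); rewrite ler_wpM2l ?(ltW e10)//.
    have -> : t - t0 = (t - tau) + (tau - t0) by ring.
    by rewrite (le_trans (ler_normD _ _))// lerD2l.
  have htpi : `|t - tau| <= pi.
    have -> : t - tau = (t - t0) + (t0 - tau) by ring.
    rewrite (le_trans (ler_normD _ _))//; rewrite distrC in taum.
    by move: n01 m1 tn taum pi2; clear; lra.
  apply: (le_trans (ler_wpM2r (normr_ge0 _) h1)).
  rewrite -[leLHS]mulrA -[leRHS]mulrA.
  exact: (ler_wpM2l (ltW e10) (dpoisson_le_poisson rho0 rho1 A0 htpi)).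
rewrite gE mulr0 add0r.
have -> : I + D * (2 * pi * poisson rho tau - 2 * pi) + 2 * pi * D =
    I + D * (p2 * poisson rho tau) by rewrite /p2; ring.
rewrite (le_lt_trans (ler_normD _ _))//.
have hD : `|D * (p2 * poisson rho tau)| <= `|D| * (p2 * (2 / k)) * q.
  have pP : 0 <= p2 * poisson rho tau.
    by apply: mulr_ge0; apply: ltW => //; exact: poisson_gt0.
  rewrite normrM (ger0_norm pP).
  have -> : `|D| * (p2 * (2 / k)) * q = `|D| * (p2 * (2 / k * q)) by ring.
  exact: (ler_wpM2l (normr_ge0 D) (ler_wpM2l (ltW p20) ptau)).
have e1E : e1 * (2 + A) * p2 = e / 2.
  by rewrite /e1; field; rewrite (lt0r_neq0 AA) (lt0r_neq0 p20).
have Kq : K * q < e / 2.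
  have : q * (2 * (K + 1)) < e by rewrite -ltr_pdivlMr// mulr_gt0.
  have : 0 <= q by exact: ltW.
  by clear; lra.
have KE : K * q = cc * p2 + `|D| * (p2 * (2 / k)) * q by rewrite /K /cc; ring.
have H := lerD Ib hD; rewrite -addrA -KE e1E in H.
by apply: le_lt_trans H _; rewrite [ltRHS]splitr ltrD2l.
Qed.

End FatouLimit.

(** * Boundary values of functions with an integrable maximal function *)

Section RadialBound.
Context {R : realType}.
Local Notation C := (Cplx R).
Local Notation mu := (@lebesgue_measure R).

Lemma ac_continuous (Phi h : R -> R) :
  mu.-integrable setT (EFin \o h) ->
  (forall a b, a <= b -> `|Phi b - Phi a| <= \int[mu]_(t in `[a, b]) h t) ->
  continuous Phi.
Proof.
move=> ih Ph x.
have iS (A : set R) : measurable A -> mu.-integrable A (EFin \o h).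
  by move=> mA; exact: (integrableS (mu := mu) measurableT mA (@subsetT _ A) ih).
pose W y := \int[mu]_(t in `[x - 1, y]) h t.
have cW : {for x, continuous W}.
  have := @parameterized_integral_continuous R (x - 1) (x + 1) h.
  have xx : x - 1 <= x + 1 by lra.
  move=> /(_ xx (iS _ (measurable_itv _))).
  have xx' : x - 1 < x + 1 by lra.
  move/(continuous_within_itvP _ xx') => [+ _ _] => /(_ x); apply.
  by rewrite in_itv /=; apply/andP; split; lra.
have WE a b : x - 1 <= a -> a <= b -> W b - W a = \int[mu]_(t in `[a, b]) h t.
  move=> xa ab; rewrite /W Rintegral_itvB//; last exact: iS.
  by rewrite Rintegral_itv_obnd_cbnd//; exact: iS.
apply/cvgrPdist_lt => e e0; move/cvgrPdist_lt : cW => /(_ e e0) HW.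
near=> y.
have Wy : `|W x - W y| < e by near: y.
have xy1 : `|y - x| < 1.
  by near: y; apply/nbhs_ballP; exists 1 => //= z; rewrite /ball /= distrC.
move: xy1; rewrite ltr_norml => /andP[y1 y2].
apply: le_lt_trans Wy; have [xy|xy] := leP x y.
  rewrite distrC [leRHS]distrC (le_trans (Ph _ _ xy))// -WE ?ler_norm//; lra.
by rewrite (le_trans (Ph _ _ (ltW xy)))// -WE ?ler_norm ?ltW//; lra.
Unshelve. all: by end_near. Qed.

Lemma le_Rintegral_ae (f g : R -> R) (A N : set R) : measurable A ->
  mu.-integrable A (EFin \o f) -> mu.-integrable A (EFin \o g) ->
  measurable N -> mu N = 0%E ->
  (forall t, A t -> ~ N t -> f t <= g t) ->
  \int[mu]_(t in A) f t <= \int[mu]_(t in A) g t.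
Proof.
move=> mA fi gi mN N0 fg.
rewrite /Rintegral (negligible_integral (mu := mu) mN mA fi N0) (negligible_integral (mu := mu) mN mA gi N0).
have mD : measurable (A `\` N) by exact: measurableD.
have iS (k : R -> R) : mu.-integrable A (EFin \o k) -> mu.-integrable (A `\` N) (EFin \o k).
  by move=> ki; apply: (integrableS (mu := mu) mA mD _ ki); exact: subDsetl.
apply: le_Rintegral => //; [exact: iS|exact: iS|].
by move=> t [At Nt]; exact: fg.
Qed.

Lemma continuousCC_comp_at (Q g : C -> C) w :
  {for w, continuous g} -> {for g w, continuous Q} -> {for w, continuous (fun v => Q (g v))}.
Proof. by move=> cg cQ; exact: (cvg_comp _ _ cg cQ). Qed.

Lemma Rintegral_subset (h : R -> R) (A B : set R) : (forall t, 0 <= h t) ->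
  measurable A -> measurable B -> mu.-integrable B (EFin \o h) -> A `<=` B ->
  \int[mu]_(t in A) h t <= \int[mu]_(t in B) h t.
Proof.
move=> h0 mA mB iB AB.
have iA := integrableS (mu := mu) mB mA AB iB.
apply: fine_le; [exact: (integrable_fin_num (mu := mu) mA iA)|exact: (integrable_fin_num (mu := mu) mB iB)|].
apply: ge0_subset_integral => //; first exact: (measurable_int mu iB).
by move=> t _; rewrite lee_fin.
Qed.

Lemma exists_notin_null (N : set R) (a b : R) : measurable N -> mu N = 0%E -> a < b ->
  exists s : R, [/\ a < s, s < b & ~ N s].
Proof.
move=> mN N0 ab; apply: contrapT => H.
have sub : `]a, b[%classic `<=` N.
  move=> s /=; rewrite in_itv /= => /andP[sa sb]; apply: contrapT => Ns.
  by apply: H; exists s.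
have : (mu `]a, b[%classic <= mu N)%E by apply: le_measure; rewrite ?inE.
rewrite N0 lebesgue_measure_itv /= lte_fin ab -EFinD lee_fin.
by rewrite subr_le0 leNgt ab.
Qed.

Section Dilation.
Variables (G : C -> C).
Hypothesis hG : holomorphic G.
Hypothesis hF : holomorphic (cderiv G).
Local Notation F := (cderiv G).

Lemma modulus_scaled (r : R) (w : C) : 0 < r -> modulus w < r^-1 -> modulus (rC r * w) < 1.
Proof.
move=> r0 wr; rewrite modulusM modulusR (ger0_norm (ltW r0)).
by rewrite -(divff (lt0r_neq0 r0)) ltr_pM2l.
Qed.

(** For [r < 1] the radius [1 / r] exceeds 1, as the Cauchy and Poisson formulas on the unit circle
    require. *)
Lemma dilate_hder (r : R) (w : C) : 0 < r -> modulus w < r^-1 ->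
  is_derive w (1:C) (fun v : C => G (rC r * v)) (rC r * F (rC r * w)).
Proof.
move=> r0 wr.
have zd : unit_disc (rC r * w) by exact: modulus_scaled.
have [Q [Qz cQ QE]] := hol_slope (hol_is_derive hG zd).
have cs : {for w, continuous (fun v : C => rC r * v)}.
  have idw : (fun v : C => v) @ w --> w by move=> A.
  exact: (cvgCM (cvgC_cst (rC r)) idw).
rewrite -Qz.
apply: (slope_hder (Q := fun v : C => rC r * Q (rC r * v))).
  exact: (cvgCM (cvgC_cst (rC r)) (continuousCC_comp_at cs cQ)).
apply/nbhs_modulusP; exists 1; [exact: ltr01|move=> v _; rewrite QE; ring].
Qed.

Lemma hol_continuous (H : C -> C) (z : C) : holomorphic H -> unit_disc z -> {for z, continuous H}.
Proof. by move=> hH zd; exact: (is_derive_hol_continuous (hol_is_derive hH zd)). Qed.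

Lemma dilate_cont (r : R) (w : C) : 0 < r -> modulus w < r^-1 ->
  {for w, continuous (fun v : C => rC r * F (rC r * v))}.
Proof.
move=> r0 wr.
have zd : unit_disc (rC r * w) by exact: modulus_scaled.
have cs : {for w, continuous (fun v : C => rC r * v)}.
  have idw : (fun v : C => v) @ w --> w by move=> A.
  exact: (cvgCM (cvgC_cst (rC r)) idw).
exact: (cvgCM (cvgC_cst (rC r)) (continuousCC_comp_at cs (hol_continuous hF zd))).
Qed.

Variables (h : R -> R) (N : set R) (r0 : R).
Hypothesis h_ge0 : forall t, 0 <= h t.
Hypothesis ih : mu.-integrable setT (EFin \o h).
Hypothesis mN : measurable N.
Hypothesis N0 : mu N = 0%E.
Hypothesis r0_ge0 : 0 <= r0.
Hypothesis r0_lt1 : r0 < 1.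
Hypothesis Fh : forall t r : R, 0 <= t -> t <= 2 * pi -> ~ N t -> r0 < r -> r < 1 ->
  modulus (F (rC r * expi t)) <= h t.

Let iS (A : set R) : measurable A -> mu.-integrable A (EFin \o h).
Proof. by move=> mA; exact: (integrableS (mu := mu) measurableT mA (@subsetT _ A) ih). Qed.

Lemma is_cder_dilate (r t : R) : 0 < r -> r < 1 ->
  is_cder (fun s => G (rC r * expi s)) t (rC r * F (rC r * expi t) * (iC * expi t)).
Proof.
move=> rp r1; have w1 : modulus (expi t) < r^-1 by rewrite modulus_expi invf_gt1.
exact: (is_cder_comp (g := expi) (dilate_hder rp w1) (is_cder_expi t)).
Qed.

(** The angular derivative [c r F (r expi t) i expi t] has modulus at most [h t] off [N], uniformly
    in [r]. The factor [c] treats real parts ([c = 1]) and imaginary parts ([c = - i]) at once. *)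
Lemma dilate_ac (c : C) (r a b : R) : modulus c <= 1 -> r0 < r -> r < 1 ->
  0 <= a -> a <= b -> b <= 2 * pi ->
  `|Re (c * G (rC r * expi b)) - Re (c * G (rC r * expi a))| <= \int[mu]_(t in `[a, b]) h t.
Proof.
move=> c1 rr r1 a0 ab b2; have rp : 0 < r by exact: le_lt_trans r0_ge0 rr.
pose f t := Re (c * (rC r * F (rC r * expi t) * (iC * expi t))).
have df (t : R) : is_derive t 1 (fun s => Re (c * G (rC r * expi s))) (f t).
  by have /is_cderP[] := is_cderZ c (is_cder_dilate (t := t) rp r1).
have cf : continuous f.
  apply: continuous_Re => t.
  have w1 : modulus (expi t) < r^-1 by rewrite modulus_expi invf_gt1.
  have k1 := continuousC_comp_at (continuous_expi (x := t)) (dilate_cont rp w1).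
  exact: (cvgCM (cvgC_cst c) (cvgCM k1 (cvgCM (cvgC_cst iC) (continuous_expi (x := t))))).
rewrite -(Rintegral_FTC ab df cf).
have fi := continuous_itv_integrable a b cf.
apply: (le_trans (le_normr_Rintegral _ fi)) => //.
apply: (le_Rintegral_ae _ _ _ mN N0) => //.
- by apply: continuous_itv_integrable => t; apply: cvg_norm; exact: cf.
- exact: iS.
move=> t /=; rewrite in_itv /= => /andP[ta tb] Nt.
apply: (@le_trans _ _ (modulus (F (rC r * expi t)))).
  rewrite /f (le_trans (ler_Re_modulus _))// !modulusM modulus_iC modulus_expi !mulr1 modulusR.
  rewrite mulrA ler_piMl ?modulus_ge0// mulr_ile1 ?modulus_ge0//.
  by rewrite ger0_norm ltW.
by apply: Fh => //; [exact: le_trans ta|exact: le_trans b2].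
Qed.

Lemma dilate_radial (c : C) (r s t : R) : modulus c <= 1 -> r0 < r -> r <= s -> s < 1 ->
  0 <= t -> t <= 2 * pi -> ~ N t ->
  `|Re (c * G (rC s * expi t)) - Re (c * G (rC r * expi t))| <= h t * (s - r).
Proof.
move=> c1 rr; rewrite le_eqVlt => /predU1P[<-|rs] s1 t0 t2 Nt.
  by rewrite !subrr normr0 mulr0.
pose f x := Re (c * (F (rC x * expi t) * expi t)).
have rp : 0 < r by exact: le_lt_trans r0_ge0 rr.
have zd (x : R) : r <= x -> x <= s -> unit_disc (rC x * expi t).
  move=> rx xs; rewrite /unit_disc /= modulusM modulusR modulus_expi mulr1 ger0_norm.
    exact: le_lt_trans s1.
  by rewrite (le_trans _ rx)// ltW.
have df (x : R) : r <= x -> x <= s -> is_derive x 1 (fun s => Re (c * G (rC s * expi t))) (f x).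
  move=> rx xs.
  have hz : is_cder (fun y => rC y * expi t) x (expi t).
    have := @is_cder_affine R 0 (expi t) x.
    by congr (is_cder _ _ _); apply/funext => y; rewrite add0r.
  have hx := hol_is_derive hG (zd x rx xs).
  by have /is_cderP[] := is_cderZ c (is_cder_comp (g := fun y => rC y * expi t) hx hz).
have cG : {within `[r, s], continuous (fun s => Re (c * G (rC s * expi t)))}.
  apply: continuous_in_subspaceT => x; rewrite inE /= in_itv /= => /andP[rx xs].
  exact: (is_derive_cts (df x rx xs)).
have df' (x : R) : x \in `]r, s[ -> is_derive x 1 (fun s => Re (c * G (rC s * expi t))) (f x).
  by rewrite in_itv /= => /andP[rx xs]; apply: df; exact: ltW.
have [x] := MVT rs df' cG.
rewrite in_itv /= => /andP[rx xs] ->.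
have sr0 : 0 <= s - r by rewrite subr_ge0 ltW.
rewrite normrM (ger0_norm sr0); apply: ler_wpM2r => //.
apply: (@le_trans _ _ (modulus (F (rC x * expi t)))).
  rewrite /f (le_trans (ler_Re_modulus _))// !modulusM modulus_expi !mulr1.
  by rewrite ler_piMl ?modulus_ge0.
by apply: Fh => //; [exact: lt_trans rx|exact: lt_trans s1].
Qed.

(** Starting at the denominator 2 puts already the first radius strictly above [r0]. *)
Definition rseq (n : nat) : R := 1 - (1 - r0) * (n.+2%:R)^-1.

Lemma rseq_gt n : r0 < rseq n.
Proof.
have p : 0 < 1 - r0 by rewrite subr_gt0 r0_lt1.
have : (1 - r0) * (n.+2%:R)^-1 < (1 - r0) * 1.
  by rewrite ltr_pM2l// invf_lt1// ltr1n.
by rewrite mulr1 /rseq; move: (_ * _) => x; lra.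
Qed.

Lemma rseq_lt1 n : rseq n < 1.
Proof. by rewrite /rseq ltrBlDr ltrDl mulr_gt0// subr_gt0 r0_lt1. Qed.

Lemma rseq_gt0 n : 0 < rseq n.
Proof. exact: le_lt_trans r0_ge0 (rseq_gt n). Qed.

Lemma rseq_mono n m : (n <= m)%N -> rseq n <= rseq m.
Proof.
move=> nm; rewrite /rseq lerD2l lerN2 ler_wpM2l ?subr_ge0 ?(ltW r0_lt1)//.
by rewrite lef_pV2 ?posrE// ler_nat !ltnS.
Qed.

Lemma rseq_cvg : rseq n @[n --> \oo] --> (1 : R).
Proof.
have h1 : (n.+2%:R^-1 : R) @[n --> \oo] --> (0 : R).
  have := @cvg_harmonic R; rewrite -(cvg_shiftS (harmonic (R := R))); exact.
have -> : (1 : R) = 1 - (1 - r0) * 0 by rewrite mulr0 subr0.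
by apply: cvgB; [exact: cvg_cst|apply: cvgM; [exact: cvg_cst|exact: h1]].
Qed.

Definition bseq (c : C) (t : R) (n : nat) : R := Re (c * G (rC (rseq n) * expi t)).

(** The limit exists at every angle, also on [N]. Choose [s] near [t] outside [N]: [dilate_ac] makes
    the values along the two rays uniformly close, and along the ray of [s] the variation is at most
    [h s (1 - r)]. Hence the sequence is Cauchy. *)
Lemma bseq_cvg (c : C) (t : R) : modulus c <= 1 -> 0 <= t -> t <= 2 * pi ->
  cvgn (bseq c t).
Proof.
(* The auxiliary angle is taken to the right of [t]; the right end is reduced to the angle 0 by
   periodicity. *)
move=> c1; wlog t2 : t / t < 2 * pi.
  move=> H t0; rewrite le_eqVlt => /predU1P[->|t2]; last by apply: H => //; exact: ltW.
  have -> : bseq c (2 * pi) = bseq c 0 by apply/funext => n; rewrite /bseq expi0 expi2pi.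
  by apply: H; rewrite ?mulr_gt0 ?pi_gt0// mulr_ge0// pi_ge0.
move=> t0 _; apply/cauchy_cvgP; apply: cauchy_exP => e e0.
have e4 : 0 < e / 4 by rewrite divr_gt0.
have [d d0 hd] : exists2 d : R, 0 < d & forall s, t <= s -> s < t + d ->
    `|\int[mu]_(x in `[t, s]) h x| < e / 4.
  have := parameterized_integral_near_left t2 e4 (iS (measurable_itv `[t, 2 * pi])).
  move=> /nbhs_ballP[d /= d0 hd]; exists d => // s ts sd; apply: hd => //.
  by rewrite /ball /= distrC ger0_norm ?subr_ge0//; lra.
have [s [ts sd Ns]] : exists s : R, [/\ t < s, s < Num.min (t + d) (2 * pi) & ~ N s].
  by apply: exists_notin_null => //; rewrite lt_min ltrDl d0 t2.
move: sd; rewrite lt_min => /andP[sd s2].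
have s0 : 0 <= s by exact: le_trans t0 (ltW ts).
have [M hM] : exists M, h s * (1 - rseq M) < e / 4.
  have h1 : (h s * (1 - rseq n)) @[n --> \oo] --> h s * (1 - 1).
    by apply: cvgM; [exact: cvg_cst|apply: cvgB; [exact: cvg_cst|exact: rseq_cvg]].
  rewrite subrr mulr0 in h1.
  move/cvgrPdist_lt : h1 => /(_ _ e4) [M _ HM]; exists M.
  by have := HM M (leqnn _); rewrite /= sub0r normrN => /(le_lt_trans (ler_norm _)).
exists (bseq c t M); exists M => // n /= Mn; rewrite /ball /=.
have rd k : `|bseq c s k - bseq c t k| < e / 4.
  have := dilate_ac c1 (rseq_gt k) (rseq_lt1 k) t0 (ltW ts) (ltW s2).
  by move=> /le_lt_trans; apply; rewrite (le_lt_trans (ler_norm _))// hd// ltW.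
have rr : `|bseq c s n - bseq c s M| < e / 4.
  have := dilate_radial c1 (rseq_gt M) (rseq_mono Mn) (rseq_lt1 n) s0 (ltW s2) Ns.
  move=> /le_lt_trans; apply; apply: le_lt_trans hM.
  by rewrite ler_wpM2l// lerD2r ltW// rseq_lt1.
have k1 := rd n; have k2 := rd M.
move: k1 k2 rr; rewrite !ltr_norml => /andP[? ?] /andP[? ?] /andP[? ?].
by apply/andP; split; lra.
Qed.

Definition clamp (t : R) : R := Num.min (Num.max 0 t) (2 * pi).

Lemma clamp_itv t : 0 <= clamp t /\ clamp t <= 2 * pi.
Proof.
have p := pi2_ge0 (R := R).
by rewrite /clamp le_min le_max lexx p ge_min lexx orbT.
Qed.

Lemma clamp_id t : 0 <= t -> t <= 2 * pi -> clamp t = t.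
Proof. by move=> t0 t2; rewrite /clamp max_r// min_l. Qed.

Lemma clampP a b : a <= b ->
  clamp a = clamp b \/ [/\ a <= clamp a, clamp a <= clamp b & clamp b <= b].
Proof.
move=> ab; have p := pi2_ge0 (R := R).
have [a2|a2] := leP a (2 * pi); last first.
  left; have b2 := lt_le_trans a2 ab.
  have cl x : 2 * pi < x -> clamp x = 2 * pi.
    by move=> x2; rewrite /clamp min_r// le_max (ltW x2) orbT.
  by rewrite !cl.
have [b0|b0] := leP 0 b; last first.
  left; have a0 := le_lt_trans ab b0.
  have cl x : x < 0 -> clamp x = 0 by move=> x0; rewrite /clamp max_l ?ltW// min_l.
  by rewrite !cl.
right; split.
- by rewrite /clamp le_min le_max lexx orbT.
- rewrite /clamp le_min ge_min [X in _ && X]ge_min lexx orbT andbT.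
  by rewrite ge_max !le_max lexx ab orbT.
- by rewrite /clamp ge_min ge_max b0 lexx.
Qed.

(* The radial limit of [Re (c G)], extended to the line by constants. *)
Definition bfun (c : C) (t : R) : R := limn (bseq c (clamp t)).

Lemma bseq_bfun (c : C) (t : R) : modulus c <= 1 -> 0 <= t -> t <= 2 * pi ->
  bseq c t n @[n --> \oo] --> bfun c t.
Proof. by move=> c1 t0 t2; rewrite /bfun clamp_id//; exact: bseq_cvg. Qed.

Lemma bfun_ac (c : C) (a b : R) : modulus c <= 1 -> a <= b ->
  `|bfun c b - bfun c a| <= \int[mu]_(t in `[a, b]) h t.
Proof.
move=> c1 ab; have [E|[ac cc cb]] := clampP ab.
  by rewrite /bfun E subrr normr0 Rintegral_ge0.
have [ca0 ca2] := clamp_itv a; have [cb0 cb2] := clamp_itv b.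
have ha := bseq_cvg c1 ca0 ca2; have hb := bseq_cvg c1 cb0 cb2.
have H : `|bseq c (clamp b) n - bseq c (clamp a) n| @[n --> \oo] --> `|bfun c b - bfun c a|.
  by apply: cvg_norm; apply: cvgB; [exact: hb|exact: ha].
rewrite -(cvg_lim _ H)//; apply: limr_le; first exact: cvgP H.
apply: nearW => n.
apply: (le_trans (dilate_ac c1 (rseq_gt n) (rseq_lt1 n) ca0 cc cb2)).
apply: Rintegral_subset => //; first exact: iS.
by move=> t /=; rewrite !in_itv /= => /andP[ta tb]; rewrite (le_trans ac)// (le_trans tb).
Qed.

Lemma bfun_continuous (c : C) : modulus c <= 1 -> continuous (bfun c).
Proof. by move=> c1; apply: (ac_continuous ih) => a b; exact: bfun_ac. Qed.

Lemma bfun_derivable_ae (c : C) : modulus c <= 1 ->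
  {ae mu, forall t : R, derivable (bfun c) t 1}.
Proof. by move=> c1; apply: (ac_derivable_ae h_ge0 ih) => a b; exact: bfun_ac. Qed.

(** [poisson_derivative_formula] holds for each dilation. The boundary values are bounded uniformly
    in [n] and the angle, by those at the angle 0 plus the integral of [h], so the integrals
    converge. *)
Lemma bfun_poisson (c : C) (rho tau : R) : modulus c <= 1 -> 0 <= rho -> rho < 1 ->
  let z := rC rho * expi tau in
  \int[mu]_(t in `[0, 2 * pi]) (bfun c t * dpoisson rho (t - tau)) =
    - (2 * pi * Re (c * (iC * z * F z))).
Proof.
move=> c1 rho0 rho1 z.
have zm : modulus z = rho by rewrite modulusM modulusR modulus_expi mulr1 ger0_norm.
have cd : continuous (fun t : R => dpoisson rho (t - tau)) by exact/continuous_shift/continuous_dpoisson.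
have [Md hMd] := itv_bounded 0 (2 * pi) cd.
have p2 := pi2_ge0 (R := R).
have [M0 hM0] : exists M0, forall n, `|bseq c 0 n| <= M0.
  have := cvg_seq_bounded (bseq_cvg c1 (lexx 0) p2).
  move=> [M [_ hM]]; exists (M + 1) => n; apply: (hM (M + 1)) => //.
  by rewrite ltrDl.
pose fn n t := bseq c t n * dpoisson rho (t - tau).
have cG n : continuous (fun t => G (rC (rseq n) * expi t)).
  by move=> t; exact: (is_cder_continuous (is_cder_dilate (t := t) (rseq_gt0 n) (rseq_lt1 n))).
have cfn n : continuous (fn n).
  move=> t; apply: cvgM; last exact: cd.
  exact: (continuous_Re (continuousCZ (c := c) (cG n))).
have I0 : 0 <= \int[mu]_(x in `[0, 2 * pi]) h x by rewrite Rintegral_ge0.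
have bb n t : t \in `[0, 2 * pi] -> `|fn n t| <= (M0 + \int[mu]_(x in `[0, 2 * pi]) h x) * Md.
  move=> tI; rewrite /fn normrM; apply: ler_pM => //; last exact: hMd.
  move: tI; rewrite in_itv /= => /andP[t0 t2].
  have := dilate_ac c1 (rseq_gt n) (rseq_lt1 n) (lexx 0) t0 t2.
  have := Rintegral_subset h_ge0 (measurable_itv `[0, t]) (measurable_itv `[0, 2 * pi]) (iS (measurable_itv _)).
  have sub : `[0, t]%classic `<=` `[0, 2 * pi]%classic.
    by move=> x /=; rewrite !in_itv /= => /andP[-> xt]; exact: le_trans xt t2.
  move=> /(_ sub) k1 k2; have k3 := hM0 n.
  have -> : bseq c t n = (bseq c t n - bseq c 0 n) + bseq c 0 n by rewrite subrK.
  rewrite (le_trans (ler_normD _ _))// addrC lerD//; exact: le_trans k2 k1.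
have lim1 t : t \in `[0, 2 * pi] -> fn n t @[n --> \oo] --> bfun c t * dpoisson rho (t - tau).
  rewrite in_itv /= => /andP[t0 t2].
  by apply: cvgM; [exact: bseq_bfun|exact: cvg_cst].
have [L1 _] := bounded_cvg_Rintegral cfn lim1 bb.
have E n : \int[mu]_(t in `[0, 2 * pi]) fn n t =
    - (2 * pi * Re (c * (iC * z * (rC (rseq n) * F (rC (rseq n) * z))))).
  have r1 : 1 < (rseq n)^-1 by rewrite invf_gt1 ?rseq_gt0 ?rseq_lt1.
  have dQ w : modulus w < (rseq n)^-1 -> _ := @dilate_hder (rseq n) w (rseq_gt0 n).
  have cq w : modulus w < (rseq n)^-1 -> _ := @dilate_cont (rseq n) w (rseq_gt0 n).
  have := poisson_derivative_formula tau r1 dQ cq rho0 rho1.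
  move=> /(congr1 (fun x => Re (c * x))).
  rewrite -cintZ; last first.
    by apply: continuousCM; [exact: continuous_rC|exact: cG].
  rewrite mulrN ReN mulrCA ReZ => <- /=.
  by apply: eq_Rintegral => t _; rewrite /fn /bseq mulrCA ReZ mulrC.
have L2 : \int[mu]_(t in `[0, 2 * pi]) fn n t @[n --> \oo] -->
    - (2 * pi * Re (c * (iC * z * F z))).
  rewrite (_ : (fun n => _) = (fun n => - (2 * pi * Re (c * (iC * z * (rC (rseq n) * F (rC (rseq n) * z)))))));
    last by apply/funext.
  have rz : rC (rseq n) @[n --> \oo] --> (1 : C).
    by apply/(@cvg_ReImP R nat \oo); split => /=; [exact: rseq_cvg|exact: cvg_cst].
  have rz2 : rC (rseq n) * z @[n --> \oo] --> z.
    have k := cvgCM rz (cvgC_cst (X := \oo) z); rewrite mul1r in k; exact: k.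
  have zd : unit_disc z by rewrite /unit_disc /= zm.
  have FF : F (rC (rseq n) * z) @[n --> \oo] --> F z.
    exact: (cvg_comp _ _ rz2 (hol_continuous hF zd)).
  have K : c * (iC * z * (rC (rseq n) * F (rC (rseq n) * z))) @[n --> \oo] -->
      c * (iC * z * (1 * F z)).
    exact: (cvgCM (cvgC_cst c) (cvgCM (cvgC_cst (iC * z)) (cvgCM rz FF))).
  rewrite mul1r in K; have [H _] := (@cvg_ReImP R nat \oo _ _ _).1 K.
  by apply: cvgN; apply: cvgM; [exact: cvg_cst|exact: H].
exact: (cvg_unique _ L1 L2).
Qed.

End Dilation.
End RadialBound.

(** * Geometry of the approach regions *)

Section Cones.
Context {R : realType}.
Local Notation C := (Cplx R).

Lemma ler_norm_atan (x : R) : `|atan x| <= `|x|.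
Proof.
wlog x0 : x / 0 <= x.
  move=> H; have [x0|x0] := leP 0 x; first exact: H.
  by have := H (- x); rewrite atanN !normrN; apply; rewrite oppr_ge0 ltW.
move: x0; rewrite le_eqVlt => /predU1P[<-|x0]; first by rewrite atan0.
have ca : {within `[0, x], continuous (@atan R)}.
  by apply: continuous_subspaceT => y; exact: continuous_atan.
have [c cI] := MVT x0 (fun y _ => is_derive1_atan y) ca.
rewrite atan0 !subr0 => ->; rewrite normrM ler_piMl//.
have c1 : 1 <= 1 + c ^+ 2 by rewrite lerDl sqr_ge0.
have c0 : 0 < 1 + c ^+ 2 by rewrite (lt_le_trans ltr01).
by rewrite ger0_norm ?invr_ge0 ?(ltW c0)// invf_le1.
Qed.

Lemma polar_pos (u : C) : 0 < Re u ->
  u = rC (modulus u) * expi (atan (Im u / Re u)).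
Proof.
move=> u0; set v := Im u / Re u.
have m0 := Re_gt0_modulus u0.
have cv : cos (atan v) = Re u / modulus u.
  rewrite cos_atan; apply: (mulIf (lt0r_neq0 m0)); rewrite divfK ?lt0r_neq0//.
  have -> : modulus u = Re u * Num.sqrt (1 + v ^+ 2).
    apply/eqP; rewrite -(@eqrXn2 _ 2) ?modulus_ge0 ?mulr_ge0 ?sqrtr_ge0 ?(ltW u0)//.
    rewrite modulus_sq exprMn sqr_sqrtr ?addr_ge0 ?sqr_ge0// /v; apply/eqP; field.
    exact: lt0r_neq0.
  rewrite mulrCA mulVf ?mulr1// lt0r_neq0// sqrtr_gt0.
  by rewrite (lt_le_trans ltr01)// lerDl sqr_ge0.
have sv : sin (atan v) = Im u / modulus u.
  have c0 : cos (atan v) != 0 by rewrite cv mulf_neq0 ?invr_neq0 ?lt0r_neq0.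
  have : tan (atan v) = v by exact: atanK.
  rewrite /tan => /(canRL (divfK c0)) ->; rewrite cv /v; field.
  by rewrite !lt0r_neq0.
apply: complex_eqP; rewrite (ReZ, ImZ) /= ?cv ?sv mulrCA divff ?mulr1//; exact: lt0r_neq0.
Qed.

(* Rotating by the tilt [phi], the cone condition confines the argument of
   [a + i b] to [theta + |phi|]. *)
Lemma cone_axis (a b m theta phi t1 : R) : m ^+ 2 = a ^+ 2 + b ^+ 2 -> 0 <= m ->
  0 <= theta -> theta + `|phi| <= t1 -> t1 < pi / 2 ->
  cos theta * m < a * cos phi + b * sin phi -> cos t1 * m <= a.
Proof.
move=> mE m0 th0 tt1 t1p H.
have ph0 : 0 <= `|phi| := normr_ge0 phi.
have pp := pi_gt0 R.
(* Coordinates along and across the tilted axis. From [p >= m cos theta] and [|q| <= m sin theta] it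
   follows that [a >= m cos (theta + |phi|)]. *)
pose p := a * cos phi + b * sin phi; pose q := a * sin phi - b * cos phi.
have cs2 := cos2Dsin2 phi.
have aE : a = p * cos phi + q * sin phi.
  rewrite /p /q -[LHS]mulr1 -cs2; ring.
have pq : p ^+ 2 + q ^+ 2 = m ^+ 2.
  rewrite mE -[RHS]mulr1 -cs2 /p /q; ring.
have cth : 0 <= cos theta by rewrite cos_ge0_pihalf//; apply/andP; split; lra.
have sth : 0 <= sin theta by rewrite sin_ge0_pi//; apply/andP; split; lra.
have cph : 0 <= cos phi.
  rewrite cos_ge0_pihalf//; have : `|phi| <= pi / 2 by lra.
  by rewrite ler_norml.
have H' : cos theta * m < p by [].
have q2 : `|q| <= m * sin theta.
  rewrite -(@ler_pXn2r _ 2) ?nnegrE ?mulr_ge0// real_normK ?num_real//.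
  have -> : q ^+ 2 = m ^+ 2 - p ^+ 2 by rewrite -pq; ring.
  rewrite exprMn sin2cos2.
  have : (cos theta * m) ^+ 2 <= p ^+ 2.
    by rewrite ler_pXn2r ?nnegrE ?(ltW H')// ?mulr_ge0// (le_trans _ (ltW H'))// mulr_ge0.
  rewrite exprMn; lra.
have qs : - (m * sin theta * `|sin phi|) <= q * sin phi.
  have : `|q * sin phi| <= m * sin theta * `|sin phi| by rewrite normrM ler_wpM2r.
  by rewrite ler_norml => /andP[].
have pc : cos theta * m * cos phi <= p * cos phi by rewrite ler_wpM2r// ltW.
have ct1 : cos t1 <= cos theta * cos phi - sin theta * `|sin phi|.
  have -> : cos phi = cos `|phi| by case: (ger0P phi) => // _; rewrite cosN.
  have -> : `|sin phi| = sin `|phi|.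
    case: (ger0P phi) => k; rewrite ?sinN.
      by rewrite ger0_norm// sin_ge0_pi//; move: ph0 tt1; rewrite ger0_norm// => *; apply/andP; split; lra.
    rewrite -[LHS]normrN ger0_norm// -sinN sin_ge0_pi//.
    by move: ph0 tt1; rewrite ltr0_norm// => *; apply/andP; split; lra.
  rewrite -cosD.
  have := tt1; rewrite le_eqVlt => /predU1P[->//|lt]; apply/ltW.
  by rewrite ltr_cos// in_itv /=; apply/andP; split; lra.
have k := ler_wpM2r m0 ct1; lra.
Qed.

(** Rotate the vertex to 1, with [u = z cj (expi t0)] and [m = |1 - u|]. The cone gives
    [1 - Re u >= m cos t1], so [|u|^2 = 1 - 2 (1 - Re u) + m^2 <= 1 - m cos t1] as [m <= cos t1],
    and then [m cos t1 <= 2 (1 - rho)]. As [m <= 1 / 2], [Re u >= 1 / 2] and the angle of [u] is at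
    most [2 m]; together they give the constant [4 / cos t1]. *)
Lemma cone_polar (z : C) (t0 theta phi h t1 : R) :
  0 <= theta -> theta + `|phi| <= t1 -> t1 < pi / 2 ->
  truncated_cone (expi t0) (- expi t0 * expi phi) theta h z ->
  modulus (z - expi t0) <= cos t1 -> modulus (z - expi t0) <= 2^-1 ->
  exists rho tau : R, [/\ z = rC rho * expi tau, 0 <= rho, rho < 1,
    1 - rho <= modulus (z - expi t0) & `|tau - t0| <= 4 / cos t1 * (1 - rho)].
Proof.
move=> th0 tt1 t1p [_ H] mk m2; pose m := modulus (z - expi t0).
have ph0 : 0 <= `|phi| := normr_ge0 phi.
have pp := pi_gt0 R.
have k0 : 0 < cos t1 by rewrite cos_gt0_pihalf//; apply/andP; split; lra.
pose u := z * cj (expi t0).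
have zE : z = u * expi t0 by rewrite /u -mulrA (mulrC (cj _)) expi_cj mulr1.
have mE : m = modulus (1 - u).
  rewrite /m zE -{2}[expi t0]mul1r -mulrBl modulusM modulus_expi mulr1.
  by rewrite -modulusN opprB.
pose a := 1 - Re u; pose b := - Im u.
have Ha : cos t1 * m <= a.
  apply: (@cone_axis a b m theta phi t1) => //.
  - by rewrite mE modulus_sq ReB ImB /= sub0r.
  - exact: modulus_ge0.
  move: H; rewrite -/m; congr (_ < _).
  have -> : (z - expi t0) * conjc (- expi t0 * expi phi) = (1 - u) * cj (expi phi).
    rewrite -/(cj (- expi t0 * expi phi)) cjM cjN zE.
    transitivity ((1 - u) * cj (expi phi) * (expi t0 * cj (expi t0))); first by ring.
    by rewrite expi_cj mulr1.
  by rewrite cj_expi ReM ReB ImB /= cosN sinN /a /b; ring.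
have m0 : 0 < m.
  rewrite lt_def modulus_ge0 andbT; apply/eqP => m0.
  move: H; rewrite -/m m0 mulr0.
  have /eqP : m == 0 by rewrite m0.
  rewrite /m => /eqP; rewrite modulus_eq0 => /eqP ->.
  by rewrite mul0r ltxx.
pose rho := modulus u.
have rho0 : 0 <= rho := modulus_ge0 u.
have rho2 : rho ^+ 2 = 1 - 2 * a + m ^+ 2.
  rewrite /rho mE !modulus_sq ReB ImB /= /a; ring.
have key : cos t1 * m <= 1 - rho ^+ 2.
  have : m * m <= cos t1 * m by rewrite ler_wpM2r ?(ltW m0).
  by rewrite rho2 expr2; lra.
have rho1 : rho < 1.
  rewrite -(@ltr_pXn2r _ 2) ?nnegrE// expr1n.
  have k1 : 0 < cos t1 * m by rewrite mulr_gt0.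
  lra.
have key2 : cos t1 * m <= 2 * (1 - rho).
  have : rho ^+ 2 = rho * rho by rewrite expr2.
  have : 0 <= (1 - rho) * (1 - rho) by rewrite mulr_ge0 ?subr_ge0 ?ltW.
  lra.
have xa : 2^-1 <= Re u.
  have : `|Re (1 - u)| <= m by rewrite mE ler_Re_modulus.
  by move: m2; rewrite -/m ReB /= ler_norml => ? /andP[_ ?]; lra.
have x0 : 0 < Re u by apply: lt_le_trans xa; rewrite invr_gt0.
have uE := polar_pos x0.
exists rho, (t0 + atan (Im u / Re u)); split => //.
- by rewrite expiD mulrCA -uE mulrC -zE.
- rewrite -/m mE; have := modulusD (1 - u) u; rewrite subrK modulus1 -/rho; lra.
rewrite addrAC subrr add0r (le_trans (ler_norm_atan _))//.
have ym : `|Im u| <= m.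
  by have := ler_Im_modulus (1 - u); rewrite ImB /= sub0r normrN mE.
apply: (@le_trans _ _ (2 * m)).
  rewrite normrM normfV (ger0_norm (ltW x0)) ler_pdivrMr//.
  have : m * 1 <= m * (2 * Re u) by apply: ler_wpM2l; [exact: ltW|lra].
  lra.
rewrite mulrAC ler_pdivlMr//; lra.
Qed.

End Cones.

(** * Nontangential limits *)

Section NTLimit.
Context {R : realType}.
Local Notation C := (Cplx R).
Local Notation mu := (@lebesgue_measure R).

Lemma nt_filterP (Gamma : C -> set C) (zeta : C) (A : set C) :
  nt_filter Gamma zeta A <->
  exists2 e : R, 0 < e & forall z, Gamma zeta z -> modulus (z - zeta) < e -> A z.
Proof.
rewrite /nt_filter /within /=; split.
  by move=> /nbhs_modulusP[e e0 he]; exists e => // z Gz ze; exact: he.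
by move=> [e e0 he]; apply/nbhs_modulusP; exists e => // z ze Gz; exact: he.
Qed.

Lemma nt_filter_filter (Gamma : C -> set C) (zeta : C) : Filter (nt_filter Gamma zeta).
Proof. exact: within_filter. Qed.

(** The tilt is smaller than the half-aperture, by at least the inner bound [t0], so the inner
    normal lies in the cone; the lower bound on the sizes gives radial segments of uniform
    length. *)
Lemma approach_radial (Gamma : C -> set C) : approach_regions Gamma ->
  exists2 h0 : R, 0 < h0 & forall t r : R, 0 < r -> r < h0 -> Gamma (expi t) (rC (1 - r) * expi t).
Proof.
move=> [theta [phi [h [_ [t0 [t1 [t00 t1p ang]]] [h0 [h1 [h00 hh]]] GE]]]].
exists h0 => // t r r0 rh; have [-> _] := GE t.
have dE : rC (1 - r) * expi t - expi t = - (rC r * expi t) by rewrite rCB rC1; ring.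
have mE : modulus (rC (1 - r) * expi t - expi t) = r.
  by rewrite dE modulusN modulusM modulusR modulus_expi mulr1 gtr0_norm.
have [ang1 ang2] := ang t.
split; first by rewrite mE (lt_le_trans rh)//; case/andP: (hh t).
rewrite mE.
have -> : (rC (1 - r) * expi t - expi t) * conjc (- expi t * expi (phi t)) =
    rC r * cj (expi (phi t)).
  rewrite -/(cj (- expi t * expi (phi t))) dE cjM cjN.
  transitivity (rC r * cj (expi (phi t)) * (expi t * cj (expi t))); first by ring.
  by rewrite expi_cj mulr1.
rewrite ReZ mulrC ltr_pM2l// Re_cj /=.
have -> : cos (phi t) = cos `|phi t| by case: (ger0P (phi t)) => // _; rewrite cosN.
have ph0 : 0 <= `|phi t| := normr_ge0 _.
have pp := pi_gt0 R.
by rewrite ltr_cos ?in_itv /=; [lra|apply/andP; split; lra|apply/andP; split; lra].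
Qed.

Lemma nt_filter_proper (Gamma : C -> set C) (t : R) : approach_regions Gamma ->
  ProperFilter (nt_filter Gamma (expi t)).
Proof.
move=> /approach_radial[h0 h00 hr]; apply: Build_ProperFilter_ex; try exact: nt_filter_filter.
move=> A /nt_filterP[e e0 he].
pose r := Num.min (h0 / 2) (e / 2).
have r0 : 0 < r by rewrite lt_min !divr_gt0.
have rh : r < h0.
  have : r <= h0 / 2 by rewrite ge_min lexx.
  by lra.
have re : r < e.
  have : r <= e / 2 by rewrite ge_min lexx orbT.
  by lra.
exists (rC (1 - r) * expi t); apply: he; first exact: hr.
have -> : rC (1 - r) * expi t - expi t = - (rC r * expi t) by rewrite rCB rC1; ring.
by rewrite modulusN modulusM modulusR modulus_expi mulr1 gtr0_norm.
Qed.

Lemma nt_lim_radial (Gamma : C -> set C) (F : C -> C) (t : R) (r : nat -> R) :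
  approach_regions Gamma -> nt_converges Gamma F (expi t) ->
  (forall n, r n < 1) -> r n @[n --> \oo] --> (1 : R) ->
  F (rC (r n) * expi t) @[n --> \oo] --> nt_lim Gamma F (expi t).
Proof.
move=> hG cF r1 rcv.
have [h0 h00 hr] := approach_radial hG.
apply/(@cvg_modulusP R nat \oo) => e e0.
have FF := nt_filter_filter Gamma (expi t).
have := (@cvg_modulusP R C (nt_filter Gamma (expi t)) F _ FF).1 cF e e0.
move=> /nt_filterP[d d0 hd].
move/cvgrPdist_lt : rcv => H.
have m0 : 0 < Num.min h0 d by rewrite lt_min h00.
have := H _ m0; apply: filterS => n; rewrite lt_min => /andP[k1 k2].
have p : 0 < 1 - r n by rewrite subr_gt0.
rewrite (gtr0_norm p) in k1 k2.
have := hr t (1 - r n) p k1; rewrite opprB addrCA subrr addr0 => Gz.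
apply: hd => //.
have -> : rC (r n) * expi t - expi t = - (rC (1 - r n) * expi t) by rewrite rCB rC1; ring.
by rewrite modulusN modulusM modulusR modulus_expi mulr1 gtr0_norm.
Qed.

Lemma nt_max_ge (Gamma : C -> set C) (F : C -> C) (zeta z : C) : Gamma zeta z ->
  ((modulus (F z))%:E <= nt_max Gamma F zeta)%E.
Proof. by move=> Gz; apply: ereal_sup_ubound; exists z. Qed.

Section Fatou.
Variables (G : C -> C) (Gamma : C -> set C).
Hypothesis hGamma : approach_regions Gamma.
Hypothesis hG : holomorphic G.
Hypothesis hF : holomorphic (cderiv G).
Local Notation F := (cderiv G).
Variables (h : R -> R) (N : set R) (r0 : R).
Hypothesis h_ge0 : forall t, 0 <= h t.
Hypothesis ih : mu.-integrable setT (EFin \o h).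
Hypothesis mN : measurable N.
Hypothesis N0 : mu N = 0%E.
Hypothesis r0_ge0 : 0 <= r0.
Hypothesis r0_lt1 : r0 < 1.
Hypothesis Fh : forall t r : R, 0 <= t -> t <= 2 * pi -> ~ N t -> r0 < r -> r < 1 ->
  modulus (F (rC r * expi t)) <= h t.

(* [dpoisson] is minus the [tau]-derivative of the kernel, and Poisson's formula
   for [Re (c G)] turns the integral of [fatou_kernel] into
   [- 2 pi Re (c i z G' z)]. *)
Lemma fatou_part (c : C) (t0 : R) : modulus c <= 1 -> 0 < t0 -> t0 < 2 * pi ->
  derivable (bfun G r0 c) t0 1 ->
  exists D : R, Re (c * (iC * z * F z)) @[z --> nt_filter Gamma (expi t0)] --> D.
Proof.
move=> c1 t00 t02 db; pose D : R := 'D_(1 : R) (bfun G r0 c) t0; exists D.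
have dD : is_derive t0 1 (bfun G r0 c) D by apply: DeriveDef.
have [theta [phi [hh [_ [a0 [a1 [a00 a1p ang]]] [h0 [h1 [h00 hb]]] GE]]]] := hGamma.
have [ang1 ang2] := ang t0; have [GE1 _] := GE t0.
have k0 : 0 < cos a1.
  have pp := pi_gt0 R; have ph0 : 0 <= `|phi t0| := normr_ge0 _.
  by rewrite cos_gt0_pihalf//; apply/andP; split; lra.
have th0 : 0 <= theta t0 by have : 0 <= `|phi t0| := normr_ge0 _; lra.
have A0 : 0 <= 4 / cos a1 by rewrite divr_ge0// ltW.
have cb := bfun_continuous hG hF h_ge0 ih mN N0 r0_ge0 r0_lt1 Fh c1.
have FF := nt_filter_filter Gamma (expi t0).
apply/cvgrPdist_lt => e e0.
have [d d0 hd] := fatou_kernel t00 t02 cb dD A0 e0.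
apply/nt_filterP; exists (Num.min d (Num.min (cos a1) 2^-1)).
  by rewrite !lt_min d0 k0 invr_gt0 /=.
move=> z; rewrite GE1 !lt_min => Gz /and3P[zd zk z2].
have [rho [tau [zE rho0 rho1 rhom taum]]] := cone_polar th0 ang2 a1p Gz (ltW zk) (ltW z2).
have := hd rho tau rho0 rho1 (le_lt_trans rhom zd) taum.
rewrite (bfun_poisson hG hF h_ge0 ih mN N0 r0_ge0 r0_lt1 Fh tau c1 rho0 rho1) -zE.
rewrite addrC -mulrBr normrM; apply: le_lt_trans.
rewrite ler_peMl// ger0_norm ?mulr_ge0 ?pi_ge0//.
by have := pi_ge2 R; lra.
Qed.

Lemma fatou_nt (t0 : R) : 0 < t0 -> t0 < 2 * pi ->
  derivable (bfun G r0 1) t0 1 -> derivable (bfun G r0 (- iC)) t0 1 ->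
  nt_converges Gamma F (expi t0).
Proof.
move=> t00 t02 d1 d2.
have c1 : modulus (1 : C) <= 1 by rewrite modulus1.
have c2 : modulus (- iC : C) <= 1 by rewrite modulusN modulus_iC.
have [D1 H1] := fatou_part c1 t00 t02 d1.
have [D2 H2] := fatou_part c2 t00 t02 d2.
have FF := nt_filter_filter Gamma (expi t0).
pose l : C := (D1 +i* D2)%C.
have HH : (fun z => iC * z * F z) @ nt_filter Gamma (expi t0) --> l.
  apply/cvg_ReImP; split => /=.
    by under eq_fun do rewrite -[iC * _ * _]mul1r.
  have -> : (fun x => Im (iC * x * F x)) = (fun x => Re (- iC * (iC * x * F x))).
    by apply/funext => x; rewrite mulNr ReN Re_iC opprK.
  exact: H2.
have idz : (fun z : C => z) @ nt_filter Gamma (expi t0) --> (expi t0 : C).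
  by apply: cvg_within.
have i0 : iC * expi t0 != 0 :> C.
  by rewrite mulf_neq0 ?expi_neq0// -modulus_gt0 modulus_iC.
have HV : (fun z : C => (iC * z)^-1) @ nt_filter Gamma (expi t0) --> (iC * expi t0)^-1.
  exact: (cvgCV i0 (cvgCM (cvgC_cst iC) idz)).
have HM := cvgCM (FX := FF) HV HH.
rewrite /nt_converges; apply/cvg_ex; exists ((iC * expi t0)^-1 * l).
apply/cvg_modulusP => e e0.
have := (@cvg_modulusP R C (nt_filter Gamma (expi t0)) _ _ FF).1 HM e e0.
(* Distance below 1 from the vertex keeps [z] off 0, so that [i z] can be cancelled. *)
move=> /nt_filterP[d dd0 hd]; apply/nt_filterP; exists (Num.min d 1).
  by rewrite lt_min dd0 ltr01.
move=> z Gz; rewrite lt_min => /andP[zd z1].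
have z0 : z != 0.
  by apply: contraTneq z1 => ->; rewrite sub0r modulusN modulus_expi ltxx.
have := hd z Gz zd; rewrite mulrA mulVf ?mul1r//.
by rewrite mulf_neq0// -modulus_gt0 modulus_iC.
Qed.

Lemma fatou_ae : exists N' : set R, [/\ measurable N', mu N' = 0%E &
  forall t, 0 < t -> t < 2 * pi -> ~ N' t -> nt_converges Gamma F (expi t)].
Proof.
have c1 : modulus (1 : C) <= 1 by rewrite modulus1.
have c2 : modulus (- iC : C) <= 1 by rewrite modulusN modulus_iC.
have [N1 [mN1 N10 s1]] := bfun_derivable_ae hG hF h_ge0 ih mN N0 r0_ge0 r0_lt1 Fh c1.
have [N2 [mN2 N20 s2]] := bfun_derivable_ae hG hF h_ge0 ih mN N0 r0_ge0 r0_lt1 Fh c2.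
exists (N1 `|` N2); split; [exact: measurableU|by rewrite measureU0|].
move=> t t0 t2 /not_orP[n1 n2]; apply: fatou_nt => //.
  by apply: contrapT => k; apply: n1; exact: s1.
by apply: contrapT => k; apply: n2; exact: s2.
Qed.

End Fatou.
End NTLimit.

(** * Integrals of functions known off a null set *)

Section AeIntegral.
Context d (T : measurableType d) (R : realType) (m : {measure set T -> \bar R}).
Local Open Scope ereal_scope.
Import HBNNSimple.

(* Boundary data are arbitrary functions, so [f] and [g] are not assumed
   measurable: the simple functions below [f] are cut off on [N]. *)
Lemma ge0_le_integral_off_null (f g : T -> \bar R) (N : set T) : measurable N -> m N = 0 ->
  (forall x, 0 <= f x) -> (forall x, 0 <= g x) ->
  (forall x, ~ N x -> f x = g x) -> \int[m]_x f x <= \int[m]_x g x.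
Proof.
move=> mN N0 f0 g0 fg; rewrite !ge0_integralTE//.
apply: ge_ereal_sup => _ [h /= hf <-].
have mNC : measurable (~` N) by exact: measurableC.
pose k : {nnsfun T >-> R} := proj_nnsfun h mNC.
have kE x : k x = (h \_ (~` N)) x by rewrite (mrestrict h mNC).
apply: ereal_sup_ubound; exists k.
  move=> x; change ((k x)%:E <= g x); rewrite kE patchE; case: ifPn => [|_]; last exact: g0.
  by rewrite inE => Nx; rewrite -fg.
have -> : sintegral m k = sintegral m (h \_ (~` N)).
  by congr (sintegral m _); apply/funext => x; exact: kE.
rewrite -integral_nnsfun//.
have -> : sintegral m h = sintegral m (h \_ setT) by rewrite patch_setT.
rewrite -integral_nnsfun//.
rewrite [RHS](ge0_negligible_integral mN)//.
- by rewrite setTD.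
- exact/measurable_EFinP.
- by move=> x _; rewrite lee_fin fun_ge0.
Qed.

Lemma integral_off_null (f g : T -> \bar R) (N : set T) : measurable N -> m N = 0 ->
  (forall x, ~ N x -> f x = g x) -> \int[m]_x f x = \int[m]_x g x.
Proof.
move=> mN N0 fg; rewrite integralE [RHS]integralE.
have key (f1 g1 : T -> \bar R) : (forall x, 0 <= f1 x) -> (forall x, 0 <= g1 x) ->
    (forall x, ~ N x -> f1 x = g1 x) -> \int[m]_x f1 x = \int[m]_x g1 x.
  move=> f0 g0 H; apply/eqP; rewrite eq_le; apply/andP; split.
    exact: (ge0_le_integral_off_null mN N0).
  by apply: (ge0_le_integral_off_null mN N0) => // x /H.
congr (_ - _); apply: key => // x Nx; by rewrite ?funeposE ?funenegE fg.
Qed.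

End AeIntegral.

Section Sigma.
Context {R : realType}.
Local Notation mu := (@lebesgue_measure R).
Local Notation D := (`[0%R, (2 * pi)%R[%classic : set (measurableTypeR R)).

Lemma sigmaE (A : set (measurableTypeR R)) : @sigma R A = mu (A `&` D).
Proof. by []. Qed.

Lemma sigma_Rintegral (f g : R -> R) (N : set R) : measurable N -> mu N = 0%E ->
  (forall t, 0 < t -> t < 2 * pi -> ~ N t -> f t = g t) ->
  mu.-integrable `[0, 2 * pi] (EFin \o g) ->
  Rintegral (@sigma R) setT f = \int[mu]_(t in `[0, 2 * pi]) g t.
Proof.
move=> mN N0 fg ig.
(* Nothing is known about [f] outside the open interval either; of that complement [sigma] sees only
   the angle 0. *)
pose E : set (measurableTypeR R) := N `|` ~` `]0, 2 * pi[%classic.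
have mE : measurable E.
  by apply: measurableU; [exact: mN|apply: measurableC; exact: measurable_itv].
have E0 : @sigma R E = 0%E.
  rewrite sigmaE; apply/eqP; rewrite -measure_le0.
  have sub : E `&` D `<=` N `|` [set 0].
    move=> t [[Nt _|tn]]; first by left.
    rewrite /= in_itv /= => /andP[t0 t2]; right.
    move: tn; rewrite /= in_itv /= t2 andbT => /negP; rewrite -leNgt => t0'.
    by apply/eqP; rewrite eq_le t0 t0'.
  apply: (@le_trans _ _ (mu (N `|` [set 0]))).
    apply: le_measure => //; rewrite ?inE.
      by apply: measurableI => //; exact: measurable_itv.
    by apply: measurableU => //; exact: measurable_set1.
  rewrite measureU0//; last exact: lebesgue_measure_set1.
  by rewrite le_eqVlt; apply/orP; left; apply/eqP; exact: N0.
rewrite /Rintegral; congr fine.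
rewrite (@integral_off_null _ _ _ (@sigma R) _ ((EFin \o g) \_ D) E mE E0); last first.
  move=> t /not_orP[Nt]; rewrite /= notE in_itv /= => /andP[t0 t2].
  by rewrite patchE mem_set /= ?in_itv /= ?t2 ?ltW// fg.
rewrite -integral_mkcond (@eq_measure_integral _ _ _ D mu).
  rewrite integral_itv_bndo_bndc//.
  have [mg _] := integrableP _ _ _ ig.
  apply: measurable_funS mg; first exact: measurable_itv.
  by move=> t /=; rewrite !in_itv /= => /andP[-> /ltW].
by move=> A mA AD; rewrite sigmaE setIidl.
Qed.

Lemma sigma_fin (A : set (measurableTypeR R)) : measurable A -> (@sigma R A < +oo)%E.
Proof.
move=> mA; rewrite sigmaE (@le_lt_trans _ _ (mu D))//.
  by apply: le_measure; rewrite ?inE//; exact: measurableI.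
by rewrite /= lebesgue_measure_itv /= lte_fin; case: ifP; rewrite ?ltry.
Qed.

End Sigma.

(** * An integrable majorant from the maximal function *)

Section HardyData.
Context {R : realType}.
Local Notation C := (Cplx R).
Local Notation mu := (@lebesgue_measure R).
Local Notation D := (`[0%R, (2 * pi)%R[%classic : set (measurableTypeR R)).
Local Notation sg := (@sigma R).

Lemma sigma_setT_gt0 : (0 < sg setT)%E.
Proof.
rewrite sigmaE setTI lebesgue_measure_itv /= lte_fin mulr_gt0 ?pi_gt0//.
by rewrite -EFinD lte_fin subr0 mulr_gt0 ?pi_gt0.
Qed.

(** On a space of finite measure this pointwise bound puts [L^r] into [L^1]. *)
Lemma le_addr1_poweR (x : \bar R) (r : R) : (0 <= x)%E -> 1 <= r ->
  (x <= 1 + x `^ r)%E.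
Proof.
case: x => [x| |//] x0 r1; last first.
  rewrite poweRyr ?addey// gt_eqF//; exact: lt_le_trans r1.
rewrite lee_fin in x0; rewrite poweR_EFin -EFinD lee_fin.
have [x1|x1] := leP x 1; first by rewrite (le_trans x1)// lerDl powR_ge0.
rewrite (@le_trans _ _ (x `^ r))//; last by rewrite lerDr.
by rewrite le1r_powR// ltW.
Qed.

Lemma circle_Lp_integrable (p : \bar R) (f : C -> \bar R) : (1 <= p)%E ->
  circle_Lp p f -> sg.-integrable setT (f \o expi).
Proof.
move=> p1 [mf]; rewrite unlock /Lnorm => Lf; apply/integrableP; split; first exact: mf.
have mabs : measurable_fun [set: measurableTypeR R] (abse \o (f \o expi)).
  by apply: measurableT_comp => //; exact: mf.
have cfin (M : R) : (\int[sg]_x (cst M%:E x) < +oo)%E.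
  have sfin : sg setT \is a fin_num by rewrite ge0_fin_numE//; exact: sigma_fin.
  by rewrite integral_cst// -(fineK sfin) -EFinM ltry.
case: p p1 Lf => [r| |//] r1 Lf.
- rewrite lee_fin in r1; have r0 : 0 < r by exact: lt_le_trans r1.
  have Lr : (\int[sg]_x (`|(f \o expi) x| `^ r) < +oo)%E.
    rewrite ltNge; apply/negP; rewrite leye_eq => /eqP e.
    by move: Lf; rewrite e poweRyr ?ltxx// invr_neq0// gt_eqF.
  have mp : measurable_fun [set: measurableTypeR R] (fun x => (`|(f \o expi) x| `^ r)%E).
    by apply: (measurableT_comp (measurable_poweR r)); exact: mabs.
  apply: (@le_lt_trans _ _ (\int[sg]_x (1 + `|(f \o expi) x| `^ r))%E).
    apply: ge0_le_integral => //.
    - by apply: emeasurable_funD => //; exact: mp.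
    - by move=> x _; exact: le_addr1_poweR.
  rewrite ge0_integralD//; last by move=> x _; exact: poweR_ge0.
  by rewrite lte_add_pinfty//; exact: (cfin 1).
(* The norm of exponent infinity is the essential supremum only when the whole space has positive
   measure. *)
- rewrite sigma_setT_gt0 in Lf.
  have e0 : (0 <= ess_sup sg (abse \o (f \o expi)))%E.
    apply: ess_sup_gee; first exact: sigma_setT_gt0.
    by apply: aeW => x /=.
  have efin : ess_sup sg (abse \o (f \o expi)) \is a fin_num by rewrite ge0_fin_numE.
  apply: le_lt_trans (cfin (fine (ess_sup sg (abse \o (f \o expi))))).
  apply: ae_ge0_le_integral => //.
  - by move=> x _; rewrite lee_fin fine_ge0.
  - have [N [mN N0 sub]] := ess_sup_ge sg (abse \o (f \o expi)).
    exists N; split => // x H; apply: sub => H'; apply: H => _ /=.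
    by rewrite fineK.
Qed.

(** Radial segments lie in the approach regions, so the maximal function dominates [F] on them. The
    boundary arguments use only this domination by one integrable real function. *)
Lemma hardy_data (Gamma : C -> set C) (p : \bar R) (F : C -> C) :
  approach_regions Gamma -> (1 <= p)%E -> circle_Lp p (nt_max Gamma F) ->
  exists (h : R -> R) (N : set R) (r0 : R),
    [/\ forall t, 0 <= h t, mu.-integrable setT (EFin \o h),
        [/\ measurable N & mu N = 0%E], [/\ 0 <= r0 & r0 < 1] &
        forall t r : R, 0 <= t -> t <= 2 * pi -> ~ N t -> r0 < r -> r < 1 ->
          modulus (F (rC r * expi t)) <= h t].
Proof.
move=> hG p1 hp.
have fi := circle_Lp_integrable p1 hp.
set f := (nt_max Gamma F \o expi) in fi.
have [h0 h00 hrad] := approach_radial hG.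
have f0 t : (0 <= f t)%E.
  have k2 : 0 < h0 / 2 by lra.
  have Gz := hrad t (h0 / 2) k2.
  have k : h0 / 2 < h0 by lra.
  by apply: (le_trans _ (nt_max_ge F (Gz k))); rewrite lee_fin modulus_ge0.
have mf : measurable_fun [set: measurableTypeR R] f by exact: measurable_int fi.
have mD : measurable D by exact: measurable_itv.
have fD : mu.-integrable D f.
  have [_ fT] := integrableP _ _ _ fi.
  apply/integrableP; split; first exact: measurable_funS mf.
  rewrite -(@eq_measure_integral _ _ _ D mu sg); last first.
    by move=> A mA AD; rewrite sigmaE setIidl.
  apply: le_lt_trans fT; apply: ge0_subset_integral => //.
  by apply: measurableT_comp => //.
have [N1 [mN1 N10 sub]] := integrable_ae mD fD.
(* [fine] sends infinity to 0, so the angles with infinite maximal function go into the null set; so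
   does [2 pi], which [D] omits and where the majorant is 0. Radii above [1 - h0] lie in the
   regions. *)
exists ((fine \o f) \_ D), (N1 `|` [set 2 * pi]), (Num.max 0 (1 - h0)); split.
- move=> t; rewrite patchE; case: ifP => // _; exact: fine_ge0.
- rewrite -restrict_EFin -integrable_mkcond//.
  apply/integrableP; split.
    apply: measurable_funS measurableT _ _ => //.
    apply/measurable_EFinP; exact: (measurableT_comp (fine_measurable _)).
  have [_ fT] := integrableP _ _ _ fD; apply: le_lt_trans fT.
  apply: ge0_le_integral => //.
  - apply: measurableT_comp => //; apply/measurable_EFinP.
    apply: (@measurable_funTS) => //.
    exact: (measurableT_comp (fine_measurable _)).
  - by apply: measurableT_comp => //; exact: measurable_funS mf.
  - move=> t _ /=; have := f0 t; case: (f t) => [x| |] //= x0.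
    by rewrite normr0 leey.
- split; first by apply: measurableU => //; exact: measurable_set1.
  rewrite measureU0//; exact: lebesgue_measure_set1.
- by rewrite le_max lexx gt_max ltr01 ltrBlDr ltrDl h00.
move=> t r t0 t2 /not_orP[n1 /eqP n2]; rewrite gt_max => /andP[r0 rh] r1.
have tD : D t by rewrite /= in_itv /= t0 lt_neqAle n2 t2.
have ft : f t \is a fin_num by apply: contrapT => k; apply: n1; apply: sub => /(_ tD).
rewrite patchE mem_set// -lee_fin fineK//.
have Gz := hrad t (1 - r); rewrite opprB addrCA subrr addr0 in Gz.
by apply: nt_max_ge; apply: Gz; lra.
Qed.

End HardyData.

(** * The logarithmic representation *)

Section LogFormula.
Context {R : realType}.
Local Notation C := (Cplx R).
Local Notation mu := (@lebesgue_measure R).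

(** The limit [f] is unconstrained on [N]. Cutting everything to 0 outside [E] gives convergence at
    every point, hence a measurable limit, and the cut changes no integral. *)
Lemma circle_dominated (fn : nat -> R -> R) (f h : R -> R) (N : set R) :
  (forall n, continuous (fn n)) -> measurable N -> mu N = 0%E ->
  mu.-integrable setT (EFin \o h) ->
  (forall t, 0 < t -> t < 2 * pi -> ~ N t -> fn n t @[n --> \oo] --> f t) ->
  (forall n t, 0 < t -> t < 2 * pi -> ~ N t -> `|fn n t| <= h t) ->
  \int[mu]_(t in `[0, 2 * pi]) fn n t @[n --> \oo] --> Rintegral (@sigma R) setT f.
Proof.
move=> cf mN N0 ih fnf fnh.
pose E : set R := `]0, 2 * pi[%classic `\` N.
have mE : measurable E by apply: measurableD => //; exact: measurable_itv.
pose gn n := fn n \_ E; pose f0 := f \_ E; pose h0 := h \_ E.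
have EP t : E t -> [/\ 0 < t, t < 2 * pi & ~ N t].
  by move=> [/=]; rewrite in_itv /= => /andP[].
have gnf t : gn n t @[n --> \oo] --> f0 t.
  rewrite /gn /f0; have [tE|tE] := boolP (t \in E); last first.
    by under eq_fun do rewrite patchE (negbTE tE); rewrite patchE (negbTE tE); exact: cvg_cst.
  under eq_fun do rewrite patchE tE; rewrite patchE tE.
  by move: tE; rewrite inE => /EP[t0 t2 tN]; exact: fnf.
have mgn n : measurable_fun `[0, 2 * pi] (gn n).
  apply: measurable_funTS; apply/(measurable_restrictT _ _).1 => //.
  by apply: measurable_funTS; exact: continuous_measurable_fun.
have ih0 : mu.-integrable `[0, 2 * pi] (EFin \o h).
  exact: (integrableS (mu := mu) measurableT (measurable_itv _) (@subsetT _ _) ih).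
have ih1 : mu.-integrable `[0, 2 * pi] (EFin \o h0).
  rewrite /h0 -restrict_EFin.
  apply: (integrableS (mu := mu) measurableT (measurable_itv _) (@subsetT _ _)).
  rewrite -integrable_mkcond//.
  exact: (integrableS (mu := mu) measurableT mE (@subsetT _ _) ih).
have mf0 : measurable_fun `[0, 2 * pi] f0.
  by apply: measurable_fun_cvg => [n|t _]; [exact: mgn|exact: gnf].
have [||h1 _ h3] := @dominated_convergence _ _ _ mu `[0, 2 * pi]%classic (measurable_itv _)
  (fun n => EFin \o gn n) (EFin \o f0) (EFin \o h0) (fun n => (measurable_EFinP _ _).2 (mgn n))
  ((measurable_EFinP _ _).2 mf0) _ ih1.
- by apply: aeW => t _; apply/cvg_EFin; [exact: nearW|exact: gnf].
- apply: aeW => t n _; rewrite /= /gn /h0 !patchE lee_fin.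
  case: ifPn => [|_]; last by rewrite normr0.
  by rewrite inE => /EP[t0 t2 tN]; exact: fnh.
rewrite (@sigma_Rintegral _ f f0 N mN N0 _ h1); last first.
  move=> t t0 t2 tN; rewrite /f0 patchE mem_set//; split => //.
  by rewrite /= in_itv /= t0.
have -> : (fun n => \int[mu]_(t in `[0, 2 * pi]) fn n t) =
    (fun n => \int[mu]_(t in `[0, 2 * pi]) gn n t).
  apply/funext => n.
  have ign : mu.-integrable `[0, 2 * pi] (EFin \o gn n).
    apply: (le_integrable (mu := mu) (measurable_itv _) _ _ (continuous_itv_integrable 0 (2 * pi) (cf n))).
      exact: ((measurable_EFinP _ _).2 (mgn n)).
    move=> t _; rewrite /= lee_fin /gn patchE; case: ifP => // _.
    by rewrite normr0.
  have ifn := continuous_itv_integrable 0 (2 * pi) (cf n).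
  pose N2 := N `|` [set 0; 2 * pi].
  have mN2 : measurable N2 by apply: measurableU => //; apply: measurableU; exact: measurable_set1.
  have N20 : mu N2 = 0%E.
    have m2 : mu ([set 0] `|` [set 2 * pi]) = 0%E.
      by rewrite measureU0//; exact: lebesgue_measure_set1.
    by rewrite measureU0//; apply: measurableU; exact: measurable_set1.
  have eqo t : `[0, 2 * pi]%classic t -> ~ N2 t -> fn n t = gn n t.
    rewrite /= in_itv /= => /andP[t0 t2] /not_orP[Nt /not_orP[/eqP n0 /eqP n2]].
    rewrite /gn patchE mem_set//; split => //.
    by rewrite /= in_itv /= !lt_neqAle t0 t2 n2 eq_sym n0.
  apply/eqP; rewrite eq_le; apply/andP; split;
    apply: (le_Rintegral_ae _ _ _ mN2 N20) => //= t tI tN.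
    by rewrite eqo.
  by rewrite eqo.
by apply: fine_cvg; rewrite fineK; [exact: h3|exact: (integrable_fin_num _ h1)].
Qed.

(* [Log] on the right half-plane, in a form that can be differentiated. *)
Definition Lg (w : C) : C :=
  (2^-1 * ln (Re w ^+ 2 + Im w ^+ 2) +i* atan (Im w / Re w))%C.

(** In the right half-plane the angle [atan (Im w / Re w)] is within [pi / 2] of 0; [acos] of its
    cosine returns its absolute value, and the test on [Im w] restores the sign. *)
Lemma LogE (w : C) : 0 < Re w -> Log w = Lg w.
Proof.
move=> w0; have wE := polar_pos w0.
have m0 := Re_gt0_modulus w0.
set v := Im w / Re w in wE.
have cE : Re w / modulus w = cos (atan v).
  by rewrite {1}wE ReZ /= mulrC mulKf// gt_eqF.
have a1 := atan_gtNpi2 v; have a2 := atan_ltpi2 v; have pp := pi_gt0 R.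
rewrite /Log /Lg; congr (_ +i* _)%C.
  rewrite -modulus_sq -powR_mulrn ?modulus_ge0// ln_powR ?mulrA ?mulVf ?mul1r//.
rewrite /Arg cE -/v; have [i0|i0] := ltP (Im w) 0.
  have v0 : v < 0 by rewrite /v pmulr_llt0 ?invr_gt0.
  have av : atan v < 0 by rewrite -atan0; exact: lt_atan.
  by rewrite cosKN ?opprK//; apply/andP; split; lra.
have v0 : 0 <= v by rewrite /v divr_ge0// ltW.
have av : 0 <= atan v.
  by move: v0; rewrite le_eqVlt => /predU1P[<-|v0]; rewrite ?atan0// -atan0 ltW// lt_atan.
by rewrite cosK// in_itv /= av; lra.
Qed.

End LogFormula.

(** * The logarithmic kernel and its derivative in the angle *)

Section LogDerivative.
Context {R : realType}.
Local Notation C := (Cplx R).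

Lemma is_derive_ln_comp (f : R -> R) (t d : R) : 0 < f t -> is_derive t 1 f d ->
  is_derive t 1 (fun s => ln (f s)) ((f t)^-1 * d).
Proof. by move=> f0 hf; exact: (@is_derive1_comp _ (@ln R) f t _ _ (is_derive1_ln f0) hf). Qed.

Lemma is_derive_atan_comp (f : R -> R) (t d : R) : is_derive t 1 f d ->
  is_derive t 1 (fun s => atan (f s)) ((1 + f t ^+ 2)^-1 * d).
Proof. by move=> hf; exact: (@is_derive1_comp _ (@atan R) f t _ _ (is_derive1_atan (f t)) hf). Qed.

Lemma is_derive_mul (f g : R -> R) (t a b : R) : is_derive t 1 f a -> is_derive t 1 g b ->
  is_derive t 1 (fun s => f s * g s) (f t * b + g t * a).
Proof. by move=> hf hg; exact: (@is_deriveM R R f g t 1 a b hf hg). Qed.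

Lemma is_derive_inv (f : R -> R) (t a : R) : f t != 0 -> is_derive t 1 f a ->
  is_derive t 1 (fun s => (f s)^-1) (- (f t ^- 2 * a)).
Proof.
move=> f0 hf; have h := @is_deriveV _ f t a 1 f0 hf.
by apply: is_derive_eq h _; rewrite /GRing.scale /= mulNr.
Qed.

Lemma is_cder_Lg (g : R -> C) (t : R) (d : C) : 0 < Re (g t) -> is_cder g t d ->
  is_cder (fun s => Lg (g s)) t (d / g t).
Proof.
move=> g0 /is_cderP[hr hi].
set a := Re (g t) in g0 *; set b := Im (g t).
have ab : 0 < a ^+ 2 + b ^+ 2 by rewrite ltr_wpDr ?sqr_ge0// exprn_gt0.
have a0 : a != 0 by rewrite gt_eqF.
have gV : (g t)^-1 = rC (a ^+ 2 + b ^+ 2)^-1 * cj (g t).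
  have gn0 : g t != 0 by apply/eqP => e; move: g0; rewrite /a e /= ltxx.
  apply: (mulfI gn0); rewrite divff// mulrCA modulus_cj_mul modulus_sq -/a -/b -rCM mulVf ?gt_eqF//.
rewrite gV; apply/is_cderP; split => /=.
- have h := is_derive_ln_comp (f := fun s => Re (g s) * Re (g s) + Im (g s) * Im (g s)) (t := t) (d := a * Re d + a * Re d + (b * Im d + b * Im d)).
  have hd : is_derive t 1 (fun s => Re (g s) * Re (g s) + Im (g s) * Im (g s))
      (a * Re d + a * Re d + (b * Im d + b * Im d)).
    exact: (is_deriveD (is_derive_mul hr hr) (is_derive_mul hi hi)).
  have := h _ hd; rewrite -/a -/b -!expr2 => /(_ ab) {}h.
  have := @is_deriveZ R R R _ 2^-1 t 1 _ h.
  have -> : 2^-1 *: ((a ^+ 2 + b ^+ 2)^-1 * (a * Re d + a * Re d + (b * Im d + b * Im d))) =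
     Re (d * (rC (a ^+ 2 + b ^+ 2)^-1 * cj (g t))).
    rewrite mulrCA ReZ ReM Re_cj Im_cj -/a -/b /GRing.scale /=; field.
    by rewrite gt_eqF.
  by congr (is_derive _ _ _ _); apply/funext => s; rewrite /GRing.scale /= !expr2.
- have hb := is_derive_mul hi (is_derive_inv a0 hr).
  have H := is_derive_atan_comp hb; apply: (is_derive_eq H); rewrite -/a -/b.
  rewrite mulrCA ImZ ImM Re_cj Im_cj -/a -/b; field.
  by apply/andP; split; [exact: (lt0r_neq0 ab)|exact: a0].
Qed.

Variables (z : C).
Hypothesis z1 : modulus z < 1.

Lemma Re_den_gt0 (t : R) : 0 < Re (1 - z * cj (expi t)).
Proof.
rewrite ReB /= subr_gt0 (le_lt_trans (ler_norm _))// (le_lt_trans (ler_Re_modulus _))//.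
by rewrite modulus_mul_cj_expi.
Qed.

Lemma Re_inv_gt0 (w : C) : 0 < Re w -> 0 < Re (1 / w).
Proof.
move=> w0; rewrite mul1r.
have m0 := Re_gt0_modulus w0.
have wn0 : w != 0 by rewrite -modulus_gt0.
have -> : w^-1 = rC (modulus w ^- 2) * cj w.
  apply: (mulfI wn0); rewrite divff// mulrCA modulus_cj_mul -rCM mulVf//.
  by rewrite expf_neq0// gt_eqF.
by rewrite ReZ Re_cj mulr_gt0// invr_gt0 exprn_gt0.
Qed.

Lemma Lg_inv (w : C) : 0 < Re w -> Lg (1 / w) = - Lg w.
Proof.
move=> w0.
have m0 := Re_gt0_modulus w0.
have wn0 : w != 0 by rewrite -modulus_gt0.
have E : 1 / w = rC (modulus w ^- 2) * cj w.
  rewrite mul1r; apply: (mulfI wn0); rewrite divff// mulrCA modulus_cj_mul -rCM mulVf//.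
  by rewrite expf_neq0// gt_eqF.
have k0 : 0 < modulus w ^- 2 by rewrite invr_gt0 exprn_gt0.
apply: complex_eqP; rewrite (ReN, ImN) /=.
  have -> : Re (1 / w) ^+ 2 + Im (1 / w) ^+ 2 = (Re w ^+ 2 + Im w ^+ 2)^-1.
    rewrite -!modulus_sq E modulusM modulusR modulusJ (ger0_norm (ltW k0)).
    field; exact: lt0r_neq0.
  by rewrite lnV ?mulrN// posrE -modulus_sq exprn_gt0.
rewrite E ReZ ImZ Re_cj Im_cj -atanN; congr atan.
rewrite mulrN; field; rewrite !gt_eqF//.
Qed.

Definition logk (t : R) : C := - Lg (1 - z * cj (expi t)).

Lemma logkE (t : R) : Log (1 / (1 - z * cj (expi t))) = logk t.
Proof.
rewrite LogE; last exact/Re_inv_gt0/Re_den_gt0.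
by rewrite Lg_inv//; exact: Re_den_gt0.
Qed.

Lemma is_cder_cj_expi (t : R) : is_cder (fun s : R => cj (expi s)) t (- iC * cj (expi t)).
Proof.
have /is_cderP[h1 h2] := is_cder_expi t; apply/is_cderP; split.
  have -> : Re (- iC * cj (expi t)) = Re (iC * expi t).
    by rewrite mulNr ReN !Re_iC Im_cj opprK.
  by congr (is_derive _ _ _ _): h1; apply/funext => s; rewrite Re_cj.
have -> : Im (- iC * cj (expi t)) = - Im (iC * expi t).
  by rewrite mulNr ImN !Im_iC Re_cj.
have h3 := @is_deriveN R R R (fun s : R => Im (expi s)) t 1 _ h2.
by congr (is_derive _ _ _ _): h3; apply/funext => s; rewrite Im_cj.
Qed.

Lemma is_cder_logk (t : R) :
  is_cder logk t (- (iC * (z * cj (expi t)) * ckernel z t)).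
Proof.
have h : is_cder (fun s => 1 + - z * cj (expi s)) t (0 + - z * (- iC * cj (expi t))).
  exact: (is_cderD (is_cder_cst 1 t) (is_cderZ (- z) (is_cder_cj_expi (t := t)))).
have g0 : 0 < Re (1 + - z * cj (expi t)) by rewrite mulNr Re_den_gt0.
have := is_cderZ (-1) (is_cder_Lg (g := fun s => 1 + - z * cj (expi s)) g0 h).
congr (is_cder _ _ _).
  by apply/funext => s; rewrite /logk mulN1r mulNr.
have -> : 1 + - z * cj (expi t) = 1 - z * cj (expi t) by rewrite mulNr.
rewrite /ckernel; ring.
Qed.

Lemma continuous_logk : continuous logk.
Proof. by move=> t; exact: (is_cder_continuous (is_cder_logk (t := t))). Qed.

End LogDerivative.

(** * Integration by parts and passage to the boundary *)

Section Representation.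
Context {R : realType}.
Local Notation C := (Cplx R).
Local Notation mu := (@lebesgue_measure R).
Variables (G : C -> C).
Hypothesis hG : holomorphic G.
Hypothesis hF : holomorphic (cderiv G).
Local Notation F := (cderiv G).

Lemma continuous_F_circle (r : R) : 0 < r -> r < 1 ->
  continuous (fun t : R => F (rC r * expi t)).
Proof.
move=> r0 r1 t.
have zd : unit_disc (rC r * expi t).
  by rewrite /unit_disc /= modulusM modulusR modulus_expi mulr1 gtr0_norm.
apply: (@continuousC_comp_at R F (fun t => rC r * expi t)); last exact: hol_continuous.
exact: (continuousCZ (c := rC r) continuous_expi (x := t)).
Qed.

(* Integration by parts of [G (r expi t) * logk z t] over a period. *)
Lemma log_formula_radius (z : C) (r : R) : modulus z < 1 -> 0 < r -> r < 1 ->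
  rC r * cint (fun t => expi t * F (rC r * expi t) * logk z t) =
  rC (2 * pi) * (G (rC r * z) - G 0).
Proof.
move=> z1 r0 r1.
have ri : 1 < r^-1 by rewrite invf_gt1.
have dQ w : modulus w < r^-1 -> _ := @dilate_hder R G hG r w r0.
have cq w : modulus w < r^-1 -> _ := @dilate_cont R G hF r w r0.
have cA : continuous (fun t : R => G (rC r * expi t)) by exact: (continuous_Q_expi ri dQ).
have ck := continuous_ckernel z1.
have cF := continuous_F_circle r0 r1.
have cL := continuous_logk z1.
have czc : continuous (fun t : R => z * cj (expi t)) by exact: (continuousCZ (c := z) continuous_cj_expi).
pose U t := expi t * F (rC r * expi t) * logk z t.
pose V t := G (rC r * expi t) * (z * cj (expi t) * ckernel z t).
have cU : continuous U by exact: (continuousCM (continuousCM continuous_expi cF) cL).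
have cV : continuous V by exact: (continuousCM cA (continuousCM czc ck)).
have crU : continuous (fun t => rC r * U t) by exact: (continuousCZ (c := rC r) cU).
have cW : continuous (fun t => rC r * U t - V t) by exact: (continuousCB crU cV).
have E1 : cint (fun t => iC * (rC r * U t - V t)) = 0.
  have dAB t : is_cder (fun t => G (rC r * expi t) * logk z t) t (iC * (rC r * U t - V t)).
    have := is_cderM (is_cder_dilate hG (t := t) r0 r1) (is_cder_logk z1 (t := t)).
    congr (is_cder _ _ _); rewrite /U /V; ring.
  rewrite (cint_FTC dAB); last exact: (continuousCZ (c := iC) cW).
  by rewrite /logk expi0 expi2pi subrr.
have E2 : rC r * cint U = cint V.
  move: E1; rewrite cintZ; last exact: cW.
  move/eqP; rewrite mulf_eq0 -modulus_eq0 modulus_iC oner_eq0 /=.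
  rewrite cintB; [|exact: crU|exact: cV].
  by rewrite cintZ; [rewrite subr_eq0 => /eqP|exact: cU].
rewrite E2.
(* [z cj zeta / (1 - z cj zeta)] is the Cauchy kernel minus 1: Cauchy's formula produces [G (r z)]
   and the mean value property [G 0]. *)
have -> : cint V = cint (fun t => G (rC r * expi t) * ckernel z t - G (rC r * expi t)).
  apply: eq_cint => t; rewrite /V -{3}[G _]mulr1 -mulrBr; congr (_ * _).
  rewrite /ckernel; field; exact: ckernel_den_neq0.
rewrite cintB; [|exact: (continuousCM cA ck)|exact: cA].
rewrite (cauchy_formula ri dQ cq z1) (mean_value ri dQ cq) mulr0; ring.
Qed.

Variables (Gamma : C -> set C) (p : \bar R).
Hypothesis hGamma : approach_regions Gamma.
Hypothesis p1 : (1 <= p)%E.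
Hypothesis hp : circle_Lp p (nt_max Gamma F).

Lemma hardy_nt_converges : exists N : set R, [/\ measurable N, mu N = 0%E &
  forall t, 0 < t -> t < 2 * pi -> ~ N t -> nt_converges Gamma F (expi t)].
Proof.
have [h [N [r0 [h0 ih [mN N0] [r00 r01] Fh]]]] := hardy_data hGamma p1 hp.
exact: (fatou_ae hGamma hG hF h0 ih mN N0 r00 r01 Fh).
Qed.

Lemma radial_limit (L : R -> C) (f : C -> C) (N : set R) : continuous L ->
  measurable N -> mu N = 0%E ->
  (forall t, 0 < t -> t < 2 * pi -> ~ N t -> nt_converges Gamma F (expi t) /\
     f (expi t) = expi t * nt_lim Gamma F (expi t) * L t) ->
  exists2 r : nat -> R, (forall n, 0 < r n < 1) & r n @[n --> \oo] --> (1 : R) /\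
    cint (fun t => expi t * F (rC (r n) * expi t) * L t) @[n --> \oo] --> circle_integral f.
Proof.
move=> cL mN' N'0 hf.
have [h [N1 [r0 [h0 ih [mN1 N10] [r00 r01] Fh]]]] := hardy_data hGamma p1 hp.
pose N2 := N `|` N1.
have mN2 : measurable N2 by exact: measurableU.
have N20 : mu N2 = 0%E by rewrite measureU0.
have [M1 hM1] := itv_bounded 0 (2 * pi) (continuous_Re cL).
have [M2 hM2] := itv_bounded 0 (2 * pi) (continuous_Im cL).
pose M := M1 + M2.
have hM t : t \in `[0, 2 * pi] -> modulus (L t) <= M.
  by move=> tI; rewrite (le_trans (modulus_le_ReIm _))// lerD ?hM1 ?hM2.
pose rn := rseq r0.
have rn0 n : 0 < rn n := rseq_gt0 r00 r01 n.
have rn1 n : rn n < 1 := rseq_lt1 r01 n.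
have rnr n : r0 < rn n := rseq_gt r01 n.
have rncv : rn n @[n --> \oo] --> (1 : R) := rseq_cvg r0.
pose U n t := expi t * F (rC (rn n) * expi t) * L t.
have cU n : continuous (U n).
  exact: (continuousCM (continuousCM continuous_expi (continuous_F_circle (rn0 n) (rn1 n))) cL).
have ihM : mu.-integrable setT (EFin \o (fun t => h t * M)).
  by under [X in _.-integrable _ X]eq_fun do rewrite /= EFinM; exact: integrableZr.
have Ub n t : 0 < t -> t < 2 * pi -> ~ N2 t -> modulus (U n t) <= h t * M.
  move=> t0 t2 /not_orP[_ n1]; rewrite /U !modulusM modulus_expi mul1r.
  apply: ler_pM; rewrite ?modulus_ge0//.
    by apply: Fh => //; exact: ltW.
  by apply: hM; rewrite in_itv /= !ltW.
have Ucv t : 0 < t -> t < 2 * pi -> ~ N2 t -> U n t @[n --> \oo] --> f (expi t).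
  move=> t0 t2 /not_orP[n0 _]; have [ct ->] := hf t t0 t2 n0.
  have k := nt_lim_radial hGamma ct rn1 rncv.
  exact: (cvgCM (cvgCM (cvgC_cst (expi t)) k) (cvgC_cst (L t))).
have LR : \int[mu]_(t in `[0, 2 * pi]) Re (U n t) @[n --> \oo] -->
    Rintegral (@sigma R) setT (fun t => Re (f (expi t))).
  apply: (circle_dominated (fn := fun n t => Re (U n t)) (h := fun t => h t * M) _ mN2 N20 ihM).
  - by move=> n; exact: (continuous_Re (cU n)).
  - by move=> t t0 t2 nt; have [] := (@cvg_ReImP R nat \oo _ _ _).1 (Ucv t t0 t2 nt).
  - by move=> n t t0 t2 nt; rewrite (le_trans (ler_Re_modulus _))// Ub.
have LI : \int[mu]_(t in `[0, 2 * pi]) Im (U n t) @[n --> \oo] -->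
    Rintegral (@sigma R) setT (fun t => Im (f (expi t))).
  apply: (circle_dominated (fn := fun n t => Im (U n t)) (h := fun t => h t * M) _ mN2 N20 ihM).
  - by move=> n; exact: (continuous_Im (cU n)).
  - by move=> t t0 t2 nt; have [] := (@cvg_ReImP R nat \oo _ _ _).1 (Ucv t t0 t2 nt).
  - by move=> n t t0 t2 nt; rewrite (le_trans (ler_Im_modulus _))// Ub.
exists rn; first by move=> n; rewrite rn0 rn1.
split; first exact: rncv.
by apply/(@cvg_ReImP R nat \oo); split; [exact: LR|exact: LI].
Qed.

(** The difference of two logarithms and the factor [k] serve both statements: [w = alpha] and
    [k = 1 / (2 pi)] for the kernel, [w = 0] and [k = 1] for the Neumann problem, where [logk 0]
    vanishes. *)
Lemma log_representation (z w k : C) (f : C -> C) (N : set R) : modulus z < 1 -> modulus w < 1 ->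
  measurable N -> mu N = 0%E ->
  (forall t, 0 < t -> t < 2 * pi -> ~ N t -> nt_converges Gamma F (expi t) /\
     f (expi t) = expi t * nt_lim Gamma F (expi t) * (k * (logk z t - logk w t))) ->
  circle_integral f = rC (2 * pi) * k * (G z - G w).
Proof.
move=> z1 w1 mN N0 hf.
have cz := continuous_logk z1; have cw := continuous_logk w1.
have cL : continuous (fun t => k * (logk z t - logk w t)).
  exact: (continuousCZ (c := k) (continuousCB cz cw)).
have [r r01 [rncv L1]] := radial_limit cL mN N0 hf.
have rz : rC (r n) @[n --> \oo] --> (1 : C).
  by apply/(@cvg_ReImP R nat \oo); split => /=; [exact: rncv|exact: cvg_cst].
have L2 : rC (r n) * cint (fun t => expi t * F (rC (r n) * expi t) *
    (k * (logk z t - logk w t))) @[n --> \oo] --> 1 * circle_integral f.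
  exact: (cvgCM rz L1).
have rG (v : C) : modulus v < 1 -> G (rC (r n) * v) @[n --> \oo] --> G v.
  move=> v1.
  have rz2 : rC (r n) * v @[n --> \oo] --> 1 * v by exact: (cvgCM rz (cvgC_cst v)).
  rewrite mul1r in rz2.
  exact: (cvg_comp _ _ rz2 (hol_continuous hG v1)).
have L3 : rC (2 * pi) * k * (G (rC (r n) * z) - G (rC (r n) * w)) @[n --> \oo] -->
    rC (2 * pi) * k * (G z - G w).
  exact: (cvgCM (cvgC_cst (rC (2 * pi) * k)) (cvgCB (rG z z1) (rG w w1))).
have E : (fun n => rC (r n) * cint (fun t => expi t * F (rC (r n) * expi t) *
      (k * (logk z t - logk w t)))) =
    (fun n => rC (2 * pi) * k * (G (rC (r n) * z) - G (rC (r n) * w))).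
  apply/funext => n; have /andP[p0 pl1] := r01 n.
  have cF := continuousCM continuous_expi (continuous_F_circle p0 pl1).
  have cFz := continuousCM cF cz; have cFw := continuousCM cF cw.
  have -> : cint (fun t => expi t * F (rC (r n) * expi t) * (k * (logk z t - logk w t))) =
    cint (fun t => k * (expi t * F (rC (r n) * expi t) * logk z t - expi t * F (rC (r n) * expi t) * logk w t)).
    by apply: eq_cint => t; ring.
  rewrite cintZ; last exact: (continuousCB cFz cFw).
  rewrite cintB; [|exact: cFz|exact: cFw].
  rewrite mulrCA mulrBr (log_formula_radius z1 p0 pl1) (log_formula_radius w1 p0 pl1); ring.
rewrite E mul1r in L2.
exact: (cvg_unique _ L2 L3).
Qed.

End Representation.

(** * Power series and the kernel *)

Section PowerSeries.
Context {R : realType}.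
Local Notation C := (Cplx R).
Implicit Types (a b c : nat -> C).

(** Taken on real and imaginary parts, so that comparison with a real geometric series gives
    convergence. *)
Definition csum a : C :=
  (limn (series (fun k => Re (a k))) +i* limn (series (fun k => Im (a k))))%C.

Definition geo_bounded (B x : R) a := forall k, modulus (a k) <= B * x ^+ k.

Lemma sum_geo_le (x : R) n : 0 <= x -> x < 1 -> \sum_(0 <= k < n) x ^+ k <= (1 - x)^-1.
Proof.
move=> x0 x1; have p : 0 < 1 - x by rewrite subr_gt0.
rewrite -[leRHS]mul1r ler_pdivlMr//.
have -> : (\sum_(0 <= k < n) x ^+ k) * (1 - x) = 1 - x ^+ n.
  elim: n => [|n IH]; first by rewrite big_nil mul0r expr0 subrr.
  rewrite big_nat_recr//= mulrDl IH exprS; ring.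
by rewrite lerBlDr lerDl exprn_ge0.
Qed.

Lemma mul_expn_le (x : R) k : 0 <= x -> x < 1 -> k%:R * x ^+ k <= (1 - x)^-1.
Proof.
move=> x0 x1; apply: le_trans (sum_geo_le k x0 x1).
rewrite mulr_natl -[X in _ *+ X]subn0 -(sumr_const_nat k 0%N (x ^+ k)).
rewrite big_nat_cond [leRHS]big_nat_cond; apply: ler_sum => i /andP[/andP[_ ik] _].
by apply: ler_wiXn2l; [exact: x0|exact: ltW|exact: ltnW].
Qed.

Section Geo.
Variables (B x : R).
Hypothesis x0 : 0 <= x.
Hypothesis x1 : x < 1.

Lemma geo_bounded_ge0 a : geo_bounded B x a -> 0 <= B.
Proof. by move=> /(_ 0%N); rewrite expr0 mulr1; exact: le_trans (modulus_ge0 _). Qed.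

Lemma real_series_cvg (u : nat -> R) : (forall k, `|u k| <= B * x ^+ k) -> cvgn (series u).
Proof.
move=> ub; apply: normed_cvg.
apply: (@series_le_cvg _ _ (geometric B x)).
- by move=> k /=.
- by move=> k; rewrite /geometric /= (le_trans _ (ub k)).
- by move=> k; exact: ub.
- by apply: is_cvg_geometric_series; rewrite ger0_norm.
Qed.

Lemma csum_cvg a : geo_bounded B x a ->
  (fun n => \sum_(0 <= k < n) a k) @ \oo --> csum a.
Proof.
move=> ab; apply/(@cvg_ReImP R nat \oo); split.
  have -> : (fun n => Re (\sum_(0 <= k < n) a k)) = series (fun k => Re (a k)).
    apply/funext => n; rewrite /series /=.
    by elim/big_ind2 : _ => [//|x1' x2 y1 y2 <- <-|//]; rewrite ReD.
  by apply: real_series_cvg => k; exact: le_trans (ler_Re_modulus _) (ab k).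
have -> : (fun n => Im (\sum_(0 <= k < n) a k)) = series (fun k => Im (a k)).
  apply/funext => n; rewrite /series /=.
  by elim/big_ind2 : _ => [//|x1' x2 y1 y2 <- <-|//]; rewrite ImD.
by apply: real_series_cvg => k; exact: le_trans (ler_Im_modulus _) (ab k).
Qed.

Lemma csum_unique a (l : C) : geo_bounded B x a ->
  (fun n => \sum_(0 <= k < n) a k) @ \oo --> l -> csum a = l.
Proof. by move=> /csum_cvg h1 h2; exact: (cvg_unique _ h1 h2). Qed.

Lemma csum_bound a : geo_bounded B x a -> modulus (csum a) <= B / (1 - x).
Proof.
move=> ab; have B0 := geo_bounded_ge0 ab.
have h : modulus (\sum_(0 <= k < n) a k) @[n --> \oo] --> modulus (csum a).
  exact: (cvg_modulus (csum_cvg ab)).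
rewrite -(cvg_lim _ h)//; apply: limr_le; first exact: cvgP h.
apply: nearW => n; apply: (le_trans (modulus_sum _ _ _)).
apply: (@le_trans _ _ (\sum_(0 <= k < n) B * x ^+ k)).
  by apply: ler_sum => k _; exact: ab.
by rewrite -mulr_sumr; apply: ler_wpM2l => //; exact: sum_geo_le.
Qed.

End Geo.

Lemma csumB (B1 B2 x1 x2 : R) a b : 0 <= x1 -> x1 < 1 -> 0 <= x2 -> x2 < 1 ->
  geo_bounded B1 x1 a -> geo_bounded B2 x2 b ->
  (fun n => \sum_(0 <= k < n) (a k - b k)) @ \oo --> csum a - csum b.
Proof.
move=> x10 x11 x20 x21 ha hb.
have -> : (fun n => \sum_(0 <= k < n) (a k - b k)) =
    (fun n => \sum_(0 <= k < n) a k - \sum_(0 <= k < n) b k).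
  by apply/funext => n; rewrite sumrB.
exact: (cvgCB (csum_cvg x10 x11 ha) (csum_cvg x20 x21 hb)).
Qed.

Definition psum a (w : C) : C := csum (fun k => a k * w ^+ k).

Lemma modulus_expn_le1 (w : C) k : modulus w <= 1 -> modulus (w ^+ k) <= 1.
Proof. by move=> w1; rewrite modulusX exprn_ile1// modulus_ge0. Qed.

Lemma expn_dist (v w : C) k : modulus v <= 1 -> modulus w <= 1 ->
  modulus (v ^+ k - w ^+ k) <= k%:R * modulus (v - w).
Proof.
move=> v1 w1; elim: k => [|k IH]; first by rewrite !expr0 subrr modulus0 mul0r.
have -> : v ^+ k.+1 - w ^+ k.+1 = v * (v ^+ k - w ^+ k) + w ^+ k * (v - w).
  by rewrite !exprS; ring.
rewrite (le_trans (modulusD _ _))// !modulusM -natr1 mulrDl mul1r lerD//.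
  by apply: le_trans IH; rewrite ler_piMl// modulus_ge0.
by rewrite ler_piMl ?modulus_ge0// modulus_expn_le1.
Qed.

(** The crude constant [k^2] passes through the induction because [k^2 + k <= (k + 1)^2], and
    [coef_geo3] makes the resulting bounds summable. *)
Lemma expn_remainder (v w : C) k : modulus v <= 1 -> modulus w <= 1 ->
  modulus (v ^+ k - w ^+ k - k%:R * w ^+ k.-1 * (v - w)) <= k%:R ^+ 2 * modulus (v - w) ^+ 2.
Proof.
move=> v1 w1; elim: k => [|k IH].
  by rewrite !expr0 subrr mul0r mul0r subr0 modulus0 expr0n mul0r.
have -> : v ^+ k.+1 - w ^+ k.+1 - k.+1%:R * w ^+ k.+1.-1 * (v - w) =
    v * (v ^+ k - w ^+ k - k%:R * w ^+ k.-1 * (v - w)) + k%:R * w ^+ k.-1 * (v - w) ^+ 2.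
  case: k {IH} => [|k]; first by rewrite !expr0 !expr1; ring.
  by rewrite -![in LHS]natr1 !exprS /=; ring.
have nm : modulus (k%:R : C) = k%:R by rewrite -rC_nat modulusR normr_nat.
rewrite (le_trans (modulusD _ _))// !modulusM nm -(expr2 (modulus (v - w))).
have h1 : modulus v * modulus (v ^+ k - w ^+ k - k%:R * w ^+ k.-1 * (v - w)) <=
    k%:R ^+ 2 * modulus (v - w) ^+ 2.
  by apply: le_trans IH; rewrite ler_piMl// modulus_ge0.
have h2 : k%:R * modulus (w ^+ k.-1) * modulus (v - w) ^+ 2 <= k%:R * modulus (v - w) ^+ 2.
  by apply: ler_wpM2r; [exact: sqr_ge0|rewrite ler_piMr// modulus_expn_le1].
have h3 : k%:R * modulus (v - w) ^+ 2 + k%:R ^+ 2 * modulus (v - w) ^+ 2 <=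
    k.+1%:R ^+ 2 * modulus (v - w) ^+ 2.
  rewrite -mulrDl; apply: ler_wpM2r; first exact: sqr_ge0.
  by rewrite -natr1 !expr2; have : 0 <= k%:R :> R by []; lra.
by apply: le_trans h3; rewrite [leRHS]addrC; exact: (lerD h1 h2).
Qed.

Section Coefficients.
Variables (c : nat -> C) (B x : R).
Hypothesis x0 : 0 <= x.
Hypothesis x1 : x < 1.
(* The cube absorbs two factors [k], as [k x ^ k] is bounded. *)
Hypothesis cB : forall k, modulus (c k) <= B * (x ^+ k) ^+ 3.

Let B0 : 0 <= B.
Proof. by have := cB 0; rewrite expr0 expr1n mulr1; exact: le_trans (modulus_ge0 _). Qed.

Let K := (1 - x)^-1.
Let K0 : 0 <= K. Proof. by rewrite invr_ge0 subr_ge0 ltW. Qed.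
Let X0 k : 0 <= x ^+ k. Proof. exact: exprn_ge0. Qed.
Let X1 k : x ^+ k <= 1. Proof. by apply: exprn_ile1 => //; exact: ltW. Qed.

Lemma coef_geo1 k : modulus (c k) <= B * x ^+ k.
Proof.
apply: (le_trans (cB k)); apply: ler_wpM2l; first exact: B0.
rewrite exprS ler_piMr ?X0// exprn_ile1 ?X0 ?X1//.
Qed.

Lemma coef_geo2 k : k%:R * modulus (c k) <= B * K * x ^+ k.
Proof.
have h := mul_expn_le k x0 x1; rewrite -/K in h.
apply: (le_trans (ler_wpM2l (ler0n R k) (cB k))).
have -> : k%:R * (B * (x ^+ k) ^+ 3) = B * ((k%:R * x ^+ k) * (x ^+ k * x ^+ k)).
  by rewrite !exprS expr0; ring.
rewrite -[leRHS]mulrA; apply: ler_wpM2l; first exact: B0.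
apply: ler_pM => //; first by rewrite mulr_ge0.
  by rewrite mulr_ge0.
by rewrite ler_piMr.
Qed.

Lemma coef_geo3 k : k%:R ^+ 2 * modulus (c k) <= B * K ^+ 2 * x ^+ k.
Proof.
have h := mul_expn_le k x0 x1; rewrite -/K in h.
apply: (le_trans (ler_wpM2l (sqr_ge0 _) (cB k))).
have -> : k%:R ^+ 2 * (B * (x ^+ k) ^+ 3) = B * (((k%:R * x ^+ k) * (k%:R * x ^+ k)) * x ^+ k).
  by rewrite !exprS !expr0; ring.
rewrite -[leRHS]mulrA; apply: ler_wpM2l; first exact: B0.
apply: ler_wpM2r => //; rewrite expr2; apply: ler_pM => //; by rewrite mulr_ge0.
Qed.

Lemma psum_geo (w : C) : modulus w <= 1 -> geo_bounded B x (fun k => c k * w ^+ k).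
Proof.
move=> w1 k; rewrite modulusM; apply: le_trans (coef_geo1 k).
by rewrite ler_piMr ?modulus_ge0// modulus_expn_le1.
Qed.

Lemma psum_cvg (w : C) : modulus w <= 1 ->
  (fun n => \sum_(0 <= k < n) c k * w ^+ k) @ \oo --> psum c w.
Proof. by move=> w1; exact: (csum_cvg x0 x1 (psum_geo w1)). Qed.

Lemma psum_bound (w : C) : modulus w <= 1 -> modulus (psum c w) <= B * K.
Proof. by move=> w1; exact: (csum_bound x0 x1 (psum_geo w1)). Qed.

Lemma psum_lipschitz (v w : C) : modulus v <= 1 -> modulus w <= 1 ->
  modulus (psum c v - psum c w) <= B * K * K * modulus (v - w).
Proof.
move=> v1 w1.
pose a k := c k * v ^+ k - c k * w ^+ k.
have ab : geo_bounded (B * K * modulus (v - w)) x a.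
  move=> k; rewrite /a -mulrBr modulusM.
  apply: (le_trans (ler_wpM2l (modulus_ge0 _) (expn_dist k v1 w1))).
  have -> : modulus (c k) * (k%:R * modulus (v - w)) = k%:R * modulus (c k) * modulus (v - w) by ring.
  by rewrite [leRHS]mulrAC; apply: ler_wpM2r; [exact: modulus_ge0|exact: coef_geo2].
have <- : csum a = psum c v - psum c w.
  apply: (csum_unique x0 x1 ab).
  exact: (csumB x0 x1 x0 x1 (psum_geo v1) (psum_geo w1)).
by apply: (le_trans (csum_bound x0 x1 ab)); rewrite mulrAC.
Qed.

Definition dcoef k : C := k.+1%:R * c k.+1.

(** Summing the second-order remainders of the powers shows that the series differs from its linear
    part at [w] by at most [L |v - w|^2] on the closed disc; hence the slope is continuous at
    [w]. *)
Lemma psum_deriv (w : C) : modulus w < 1 -> is_derive w (1:C) (psum c) (psum dcoef w).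
Proof.
move=> w1; have w1' := ltW w1.
have nm k : modulus (k%:R : C) = k%:R by rewrite -rC_nat modulusR normr_nat.
pose a k := c k * (k%:R * w ^+ k.-1).
have ab : geo_bounded (B * K) x a.
  move=> k; rewrite /a !modulusM nm.
  have -> : modulus (c k) * (k%:R * modulus (w ^+ k.-1)) =
    k%:R * modulus (c k) * modulus (w ^+ k.-1) by ring.
  apply: le_trans (coef_geo2 k); rewrite ler_piMr ?modulus_expn_le1//.
  by rewrite mulr_ge0// modulus_ge0.
have aE : csum a = psum dcoef w.
  have h1 := csum_cvg x0 x1 ab.
  (* The term [a 0] vanishes, so the derived series is the series of [a] shifted by one. *)
  have h2 : (fun n => \sum_(0 <= k < n.+1) a k) @ \oo --> csum a.
    by have := h1; rewrite -(cvg_shiftS (fun n => \sum_(0 <= k < n) a k)); exact.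
  have h3 : (fun n => \sum_(0 <= k < n) dcoef k * w ^+ k) @ \oo --> csum a.
    have -> : (fun n => \sum_(0 <= k < n) dcoef k * w ^+ k) = (fun n => \sum_(0 <= k < n.+1) a k).
      apply/funext => n; rewrite big_nat_recl//= {1}/a mul0r mulr0 add0r.
      by apply: eq_bigr => k _; rewrite /a /dcoef /=; ring.
    exact: h2.
  have gb : geo_bounded (B * K * 1) x (fun k => dcoef k * w ^+ k).
    move=> k; have := ab k.+1; rewrite /a /dcoef /= mulr1.
    have -> : c k.+1 * (k.+1%:R * w ^+ k) = k.+1%:R * c k.+1 * w ^+ k by ring.
    move=> /le_trans; apply; apply: ler_wpM2l; first by rewrite mulr_ge0.
    by rewrite exprS ler_piMl// ltW.
  by rewrite /psum (csum_unique x0 x1 gb h3).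
rewrite -aE.
have quad v : modulus v <= 1 ->
    modulus (psum c v - psum c w - csum a * (v - w)) <= B * K ^+ 2 * K * modulus (v - w) ^+ 2.
  move=> v1.
  pose b k := c k * (v ^+ k - w ^+ k - k%:R * w ^+ k.-1 * (v - w)).
  have bb : geo_bounded (B * K ^+ 2 * modulus (v - w) ^+ 2) x b.
    move=> k; rewrite /b modulusM.
    apply: (le_trans (ler_wpM2l (modulus_ge0 _) (expn_remainder k v1 w1'))).
    have -> : modulus (c k) * (k%:R ^+ 2 * modulus (v - w) ^+ 2) =
      k%:R ^+ 2 * modulus (c k) * modulus (v - w) ^+ 2 by ring.
    by rewrite [leRHS]mulrAC; apply: ler_wpM2r; [exact: sqr_ge0|exact: coef_geo3].
  have <- : csum b = psum c v - psum c w - csum a * (v - w).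
    apply: (csum_unique x0 x1 bb).
    have -> : (fun n => \sum_(0 <= k < n) b k) =
      (fun n => \sum_(0 <= k < n) c k * v ^+ k - \sum_(0 <= k < n) c k * w ^+ k -
        (\sum_(0 <= k < n) a k) * (v - w)).
      apply/funext => n; rewrite mulr_suml -!sumrB; apply: eq_bigr => k _.
      by rewrite /b /a; ring.
    exact: (cvgCB (cvgCB (psum_cvg v1) (psum_cvg w1')) (cvgCM (csum_cvg x0 x1 ab) (cvgC_cst (v - w)))).
  by apply: (le_trans (csum_bound x0 x1 bb)); rewrite mulrAC.
set L := B * K ^+ 2 * K in quad.
have L0 : 0 <= L by rewrite /L !mulr_ge0// sqr_ge0.
pose Q v : C := if v == w then csum a else (psum c v - psum c w) / (v - w).
have Qw : Q w = csum a by rewrite /Q eqxx.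
have QE v : psum c v - psum c w = Q v * (v - w).
  rewrite /Q; case: eqVneq => [->|vw]; first by rewrite !subrr mulr0.
  by rewrite divfK// subr_eq0.
rewrite -Qw; apply: slope_hder.
  apply/(@cvg_modulusP R C (nbhs w)) => e e0.
  have L1 : 0 < L + 1 by lra.
  (* The first bound keeps [v] in the closed disc, where [quad] holds; [L + 1] avoids a zero
     denominator. *)
  apply/nbhs_modulusP; exists (Num.min (1 - modulus w) (e / (L + 1))).
    by rewrite lt_min subr_gt0 w1 divr_gt0.
  move=> v; rewrite lt_min => /andP[d1 d2]; rewrite Qw.
  have [->|vw] := eqVneq v w; first by rewrite Qw subrr modulus0.
  have vw0 : 0 < modulus (v - w) by rewrite modulus_gt0 subr_eq0.
  have v1 : modulus v <= 1.
    by have := modulusD (v - w) w; rewrite subrK; lra.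
  have := quad v v1; rewrite QE -mulrBl modulusM expr2 mulrA ler_pM2r// => h.
  apply: (le_lt_trans h); rewrite ltr_pdivlMr// in d2.
  by have := modulus_ge0 (v - w); lra.
by apply/nbhs_modulusP; exists 1 => // v _; exact: QE.
Qed.

End Coefficients.

End PowerSeries.

(** * The logarithmic series *)

Section LogSeries.
Context {R : realType}.
Local Notation C := (Cplx R).

(** Bernoulli's inequality [(1 - s)^3 >= 1 - 3 s] with [s = (1 - q) / 3]; no cube root has to be
    taken. *)
Lemma cube_root_bound (q : R) : 0 <= q -> q < 1 ->
  exists x : R, [/\ 0 <= x, x < 1 & q <= x ^+ 3].
Proof.
move=> q0 q1; exists (1 - (1 - q) / 3); split; [lra|lra|].
set s := (1 - q) / 3.
have s0 : 0 <= s by rewrite /s; lra.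
have s1 : s <= 1 by rewrite /s; lra.
have -> : (1 - s) ^+ 3 = 1 - 3 * s + s ^+ 2 * (3 - s) by ring.
have : 0 <= s ^+ 2 * (3 - s) by rewrite mulr_ge0 ?sqr_ge0//; lra.
by rewrite /s; lra.
Qed.

Lemma expn_cube_le (q x : R) k : 0 <= q -> q <= x ^+ 3 -> q ^+ k <= (x ^+ k) ^+ 3.
Proof. by move=> q0 qx; rewrite -exprM mulnC exprM lerXn2r// nnegrE ?(le_trans q0 qx). Qed.

Lemma modulus_nat k : modulus (k%:R : C) = k%:R.
Proof. by rewrite -rC_nat modulusR normr_nat. Qed.

Lemma cvg_expn0 (y : C) : modulus y < 1 -> y ^+ n @[n --> \oo] --> (0 : C).
Proof.
move=> y1; apply/(@cvg_modulusP R nat \oo) => e e0.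
have h : modulus y ^+ n @[n --> \oo] --> (0 : R).
  by apply: cvg_expr; rewrite ger0_norm// modulus_ge0.
move/cvgrPdist_lt: h => /(_ e e0); apply: filterS => n.
by rewrite sub0r normrN subr0 modulusX ger0_norm// exprn_ge0// modulus_ge0.
Qed.

Lemma cvg_geometricC (y : C) : modulus y < 1 ->
  (fun n => \sum_(0 <= k < n) y ^+ k) @ \oo --> (1 - y)^-1.
Proof.
move=> y1; have d0 := modulus_lt_neq0 y1.
have -> : (fun n => \sum_(0 <= k < n) y ^+ k) = (fun n => (1 - y)^-1 * (1 - y ^+ n)).
  apply/funext => n; apply: (mulfI d0); rewrite mulrA divff// mul1r.
  elim: n => [|n IH]; first by rewrite big_nil mulr0 expr0 subrr.
  by rewrite big_nat_recr//= mulrDr IH exprS; ring.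
have h : (1 - y)^-1 * (1 - y ^+ n) @[n --> \oo] --> (1 - y)^-1 * (1 - 0).
  exact: (cvgCM (cvgC_cst (1 - y)^-1) (cvgCB (cvgC_cst 1) (cvg_expn0 y1))).
by rewrite subr0 mulr1 in h.
Qed.

Lemma Lg1 : Lg (1 : C) = 0.
Proof.
apply: complex_eqP => /=; first by rewrite expr1n expr0n addr0 ln1 mulr0.
by rewrite mul0r atan0.
Qed.

(** Along the segment from 0 to [u] the series and [- Lg (1 - s u)] have the same derivative
    [u / (1 - s u)], and both vanish at [s = 0]. *)
Lemma csum_log (u : C) : modulus u < 1 -> csum (fun k => u ^+ k / k%:R) = - Lg (1 - u).
Proof.
move=> u1; have q0 := modulus_ge0 u; set q := modulus u in u1 q0.
(* [rho > 1] and [rho q < 1]: with [v = rho u] the coefficients still decay geometrically, while the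
   segment ends at the interior point [1 / rho], where the series can be differentiated. *)
pose rho : R := 2 / (1 + q).
have rho1 : 1 < rho by rewrite /rho ltr_pdivlMr; lra.
have rho0 : 0 < rho by lra.
pose v := rC rho * u.
have v1 : modulus v < 1.
  by rewrite modulusM modulusR gtr0_norm// /rho mulrAC ltr_pdivrMr; rewrite -/q; lra.
have [x [x0 x1 qx]] := cube_root_bound (modulus_ge0 v) v1.
(* At [k = 0] the inverse of 0 is 0, so there is no constant term. *)
pose e k : C := v ^+ k / k%:R.
have inv1 k : (k%:R : R)^-1 <= 1.
  by case: k => [|k]; rewrite ?invr0// invf_le1// ler1n.
have eb k : modulus (e k) <= 1 * (x ^+ k) ^+ 3.
  rewrite mul1r modulusM modulusV modulus_nat modulusX.
  apply: le_trans (expn_cube_le k (modulus_ge0 v) qx).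
  by rewrite ler_piMr// exprn_ge0// modulus_ge0.
have de (w : C) : modulus w < 1 -> psum (dcoef e) w = v / (1 - v * w).
  move=> w1; have vw : modulus (v * w) < 1.
    by rewrite (modulusM v) (le_lt_trans _ v1)// ler_piMr ?modulus_ge0// ltW.
  have E k : dcoef e k * w ^+ k = v * (v * w) ^+ k.
    have k0 : (k.+1%:R : C) != 0 by rewrite pnatr_eq0.
    have -> : dcoef e k = v ^+ k.+1 by rewrite /dcoef /e mulrC divfK.
    by rewrite (exprMn_comm k (mulrC v w)) mulrA -exprS.
  apply: (@csum_unique _ 1 (modulus v)) => //; first exact: modulus_ge0.
    move=> k; rewrite E (modulusM v) modulusX.
    apply: ler_pM; rewrite ?exprn_ge0 ?modulus_ge0//; first exact: ltW.
    apply: lerXn2r; rewrite ?nnegrE ?modulus_ge0// (modulusM v) ler_piMr ?modulus_ge0//.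
    exact: ltW.
  have -> : (fun n => \sum_(0 <= k < n) dcoef e k * w ^+ k) =
            (fun n => v * \sum_(0 <= k < n) (v * w) ^+ k).
    by apply/funext => n; rewrite mulr_sumr; apply: eq_bigr => k _; exact: E.
  exact: (cvgCM (cvgC_cst v) (cvg_geometricC vw)).
pose ir : C := rC rho^-1.
pose f (s : R) : C := psum e (0 + rC s * ir) + Lg (1 + rC s * - u).
have irv : v * ir = u by rewrite /v /ir mulrAC -rCM divff ?gt_eqF// rC1 mul1r.
have dt (s : R) : - rho < s -> s < rho -> modulus (rC s * u) < 1.
  move=> s1 s2; have sr : `|s| <= rho by rewrite ler_norml !ltW.
  rewrite modulusM modulusR; apply: le_lt_trans v1.
  by rewrite modulusM modulusR (gtr0_norm rho0) ler_wpM2r// modulus_ge0.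
have fE : f 1 = f 0.
  apply: (@cder0_eq R f (fun s => psum (dcoef e) (0 + rC s * ir) * ir + (- u) / (1 + rC s * - u)) (- rho) rho).
  - by rewrite oppr_lt0.
  - exact: rho1.
  - move=> s s1 s2; apply: is_cderD.
      apply: (@is_cder_comp R (psum e) (fun s => 0 + rC s * ir)); last exact: is_cder_affine.
      apply: (psum_deriv x0 x1 eb); rewrite add0r modulusM !modulusR.
      rewrite (ger0_norm (x := rho^-1)) ?invr_ge0 ?ltW// ltr_pdivrMr// mul1r ltr_norml.
      by rewrite s1 s2.
    apply: is_cder_Lg; last exact: is_cder_affine.
    have := dt s s1 s2; have := ler_Re_modulus (rC s * u).
    rewrite mulrN ReB /= => h1 h2; have := ler_norm (Re (rC s * u)).
    by move: h1 h2; rewrite /=; lra.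
  - move=> s s0 s1.
    have s3 : s < rho by lra.
    have s2 : - rho < s by lra.
    have h := modulus_lt_neq0 (dt s s2 s3).
    rewrite de; last first.
      rewrite add0r modulusM !modulusR (ger0_norm (x := rho^-1)) ?invr_ge0 ?ltW//.
      by rewrite ltr_pdivrMr// mul1r gtr0_norm.
    have -> : v * (0 + rC s * ir) = rC s * u by rewrite add0r mulrCA irv.
    rewrite mulrAC irv mulrN; field; exact: h.
have a1 : 0 + rC 1 * ir = ir by rewrite add0r rC1 mul1r.
have a2 : 1 + rC 1 * - u = 1 - u by rewrite rC1 mul1r.
have a3 : 0 + rC 0 * ir = 0 by rewrite add0r rC0 mul0r.
have a4 : 1 + rC 0 * - u = 1 by rewrite rC0 mul0r addr0.
have f1 : f 1 = psum e ir + Lg (1 - u) := congr2 (fun a b : C => psum e a + Lg b) a1 a2.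
have f0 : f 0 = psum e 0 + Lg 1 := congr2 (fun a b : C => psum e a + Lg b) a3 a4.
move: fE; rewrite f1 f0 Lg1.
have -> : psum e 0 = 0; last first.
  rewrite (addr0 (0 : C)) => /eqP; rewrite addr_eq0 => /eqP <-.
  rewrite /psum; congr csum; apply/funext => k.
  by rewrite /e mulrAC -(exprMn_comm k (mulrC v ir)) irv.
have zk k : e k * 0 ^+ k = 0.
  case: k => [|k]; last by rewrite expr0n /= mulr0.
  by have -> : e 0 = 0; [rewrite /e invr0 mulr0|rewrite mul0r].
apply: (@csum_unique _ 0 0) => //; first by move=> k; rewrite zk modulus0 mul0r.
have -> : (fun n => \sum_(0 <= k < n) e k * 0 ^+ k) = (fun=> 0).
  by apply/funext => n; rewrite big1// => k _; exact: zk.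
exact: cvgC_cst.
Qed.

Lemma log_series (u : C) : modulus u < 1 ->
  (fun n => \sum_(0 <= k < n) u ^+ k.+1 / k.+1%:R) @ \oo --> - Lg (1 - u).
Proof.
move=> u1; have gb : geo_bounded 1 (modulus u) (fun k => u ^+ k / k%:R).
  move=> k; rewrite mul1r modulusM modulusV modulus_nat modulusX.
  rewrite ler_piMr// ?exprn_ge0 ?modulus_ge0//.
  by case: k => [|k]; rewrite ?invr0// invf_le1// ler1n.
have h1 := csum_cvg (modulus_ge0 u) u1 gb; rewrite (csum_log u1) in h1.
have h2 : (fun n => \sum_(0 <= k < n.+1) u ^+ k / k%:R) @ \oo --> - Lg (1 - u).
  by have := h1; rewrite -(cvg_shiftS (fun n => \sum_(0 <= k < n) u ^+ k / k%:R)); exact.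
have -> : (fun n => \sum_(0 <= k < n) u ^+ k.+1 / k.+1%:R) =
  (fun n => \sum_(0 <= k < n.+1) u ^+ k / k%:R).
  by apply/funext => n; rewrite big_nat_recl//= invr0 mulr0 add0r.
exact: h2.
Qed.

Lemma near_hder (F G : C -> C) (z a : C) : is_derive z (1:C) F a ->
  (\forall w \near z, G w = F w) -> is_derive z (1:C) G a.
Proof.
move=> /hol_slope[Q [Qz cQ QE]] nGF; rewrite -Qz; apply: slope_hder => //.
have Gz : G z = F z by exact: (nbhs_singleton nGF).
by apply: filterS nGF => w ->; rewrite Gz.
Qed.

End LogSeries.

(** * The kernel and the boundary values of its derivative *)

Section Kernel.
Context {R : realType}.
Local Notation C := (Cplx R).
Variables (z alpha : C).

(* The term [k = 0] vanishes. *)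
Definition kcoef k : C := cj (z ^+ k - alpha ^+ k) * rC (2 * pi * k%:R ^+ 2)^-1.

Definition kernel (w : C) : C := psum kcoef w - psum kcoef alpha.

Lemma dcoef_kcoef k :
  dcoef kcoef k = cj (z ^+ k.+1 - alpha ^+ k.+1) * rC (2 * pi * k.+1%:R)^-1.
Proof.
rewrite /dcoef /kcoef mulrCA; congr (_ * _); rewrite -rC_nat -rCM; congr rC.
have r0 : (k.+1%:R : R) != 0 by rewrite pnatr_eq0.
by rewrite expr2 mulrA invfM mulrCA divff// mulr1.
Qed.

Lemma inv_2pi_le (r : R) : 1 <= r -> `|(2 * pi * r)^-1| <= 1.
Proof.
move=> r1; have p2 : 2 <= pi :> R := pi_ge2 R.
have h : 1 <= 2 * pi * r by rewrite -[1]mulr1 ler_pM//; lra.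
by rewrite ger0_norm ?invr_ge0 ?invf_le1//; lra.
Qed.

Lemma rC_inv2pi (r : R) : rC (2 * pi * r)^-1 = (rC (2 * pi))^-1 * (rC r)^-1.
Proof. by rewrite invfM -!rCV -rCM. Qed.

Hypothesis z1 : modulus z < 1.
Hypothesis a1 : modulus alpha < 1.

(** The decay comes from [max (|z|, |alpha|) < 1]. The same bound for the derived coefficients makes
    the derivative of the kernel holomorphic in turn, and Lipschitz up to the circle. *)
Lemma kcoef_bounded : exists x : R, [/\ 0 <= x, x < 1,
  forall k, modulus (kcoef k) <= 2 * (x ^+ k) ^+ 3 &
  forall k, modulus (dcoef kcoef k) <= 2 * (x ^+ k) ^+ 3].
Proof.
pose q := Num.max (modulus z) (modulus alpha).
have q0 : 0 <= q by rewrite le_max modulus_ge0.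
have q1 : q < 1 by rewrite gt_max z1.
have [x [x0 x1 qx]] := cube_root_bound q0 q1.
have dk k : modulus (cj (z ^+ k - alpha ^+ k)) <= 2 * q ^+ k.
  rewrite modulusJ (le_trans (modulusB _ _))// !modulusX mulr_natl mulr2n.
  by apply: lerD; apply: lerXn2r; rewrite ?nnegrE ?modulus_ge0// le_max lexx ?orbT.
exists x; split=> // k.
- have [->|k0] := eqVneq k 0%N.
    by rewrite /kcoef !expr0 subrr cj0 mul0r modulus0 expr1n mulr1.
  rewrite modulusM modulusR; apply: (@le_trans _ _ (2 * q ^+ k * 1)).
    apply: ler_pM => //; first exact: modulus_ge0.
    by apply: inv_2pi_le; rewrite -natrX ler1n expn_gt0 lt0n k0.
  by rewrite mulr1 ler_wpM2l// expn_cube_le.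
- rewrite dcoef_kcoef modulusM modulusR; apply: (@le_trans _ _ (2 * q ^+ k.+1 * 1)).
    apply: ler_pM => //; first exact: modulus_ge0.
    by apply: inv_2pi_le; rewrite ler1n.
  rewrite mulr1 ler_wpM2l//; apply: le_trans (expn_cube_le k q0 qx).
  by rewrite exprS ler_piMl ?exprn_ge0// ltW.
Qed.

Local Notation kder := (psum (dcoef kcoef)).

Lemma kernel_derive w : modulus w < 1 -> is_derive w (1:C) kernel (kder w).
Proof.
move=> w1; have [x [x0 x1 b1 _]] := kcoef_bounded.
rewrite -[kder w]addr0; exact: (hderD (psum_deriv x0 x1 b1 w1) (hder_cst (- psum kcoef alpha) w)).
Qed.

Lemma cderiv_kernel w : modulus w < 1 -> cderiv kernel w = kder w.
Proof. by move=> /kernel_derive[_]. Qed.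

Lemma kernel_hol : holomorphic kernel.
Proof. by move=> w /kernel_derive[]. Qed.

Lemma cderiv_kernel_hol : holomorphic (cderiv kernel).
Proof.
move=> w w1; have w1' : modulus w < 1 := w1.
have [x [x0 x1 _ b2]] := kcoef_bounded.
have h := psum_deriv x0 x1 b2 w1'.
suff [] : is_derive w (1:C) (cderiv kernel) (psum (dcoef (dcoef kcoef)) w) by [].
apply: (near_hder h); apply/nbhs_modulusP; exists (1 - modulus w); first by rewrite subr_gt0.
move=> v vw; apply: cderiv_kernel; have := modulusD (v - w) w; rewrite subrK.
by move=> hh; lra.
Qed.

Lemma kernel_alpha : kernel alpha = 0.
Proof. exact: subrr. Qed.

Lemma cderiv_kernel_bounded : exists M : R, forall w, modulus w < 1 ->
  modulus (cderiv kernel w) <= M.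
Proof.
have [x [x0 x1 _ b2]] := kcoef_bounded; exists (2 / (1 - x)) => w w1.
by rewrite cderiv_kernel//; apply: (psum_bound x0 x1 b2); exact: ltW.
Qed.

Variable Gamma : C -> set C.
Hypothesis hGamma : approach_regions Gamma.

Lemma approach_disc (t : R) w : Gamma (expi t) w -> modulus w < 1.
Proof.
move: hGamma => [theta [phi [h [_ _ _ GE]]]].
by have [_ sub] := GE t; move=> /sub.
Qed.

(** The derived series is Lipschitz on the closed disc, so the limit from any approach region is its
    value on the circle. *)
Lemma kernel_nt_cvg (t : R) :
  (cderiv kernel @ nt_filter Gamma (expi t)) --> kder (expi t).
Proof.
have FF := nt_filter_filter Gamma (expi t).
have [x [x0 x1 _ b2]] := kcoef_bounded.
apply/(@cvg_modulusP R C (nt_filter Gamma (expi t))) => e e0.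
set K := 2 / (1 - x) / (1 - x).
have K0 : 0 <= K by rewrite !divr_ge0//; lra.
apply/nt_filterP; exists (e / (K + 1)); first by rewrite divr_gt0//; lra.
move=> w /approach_disc w1; rewrite cderiv_kernel// ltr_pdivlMr; last lra.
move=> h; have m1 : modulus (expi t) <= 1 by rewrite modulus_expi.
apply: (le_lt_trans (psum_lipschitz x0 x1 b2 (ltW w1) m1)).
rewrite -/K; have := modulus_ge0 (w - expi t).
set m := modulus _ in h *; move=> m0; have : K * m <= m * (K + 1) by lra.
by move=> hh; exact: le_lt_trans hh h.
Qed.

Lemma kernel_nt_lim (t : R) : nt_lim Gamma (cderiv kernel) (expi t) = kder (expi t).
Proof.
have FF := nt_filter_proper t hGamma.
have h := kernel_nt_cvg (t := t); exact: (cvg_lim _ h).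
Qed.

Lemma kder_boundary (t : R) : cj (kder (expi t)) =
  expi t * ((rC (2 * pi))^-1 * (logk z t - logk alpha t)).
Proof.
have [x [x0 x1 _ b2]] := kcoef_bounded.
have m1 : modulus (expi t) <= 1 by rewrite modulus_expi.
have h1 : (fun n => cj (\sum_(0 <= k < n) dcoef kcoef k * expi t ^+ k)) @ \oo --> cj (kder (expi t)).
  exact: (cvgC_cj (psum_cvg x0 x1 b2 m1)).
have mc (v : C) : modulus v < 1 -> modulus (v * cj (expi t)) < 1.
  by move=> v1; rewrite modulus_mul_cj_expi.
have h2 : (fun n => expi t * ((rC (2 * pi))^-1 *
    (\sum_(0 <= k < n) (z * cj (expi t)) ^+ k.+1 / k.+1%:R -
     \sum_(0 <= k < n) (alpha * cj (expi t)) ^+ k.+1 / k.+1%:R))) @ \oo -->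
   expi t * ((rC (2 * pi))^-1 * (logk z t - logk alpha t)).
  exact: (cvgCM (cvgC_cst (expi t)) (cvgCM (cvgC_cst (rC (2 * pi))^-1)
    (cvgCB (log_series (mc z z1)) (log_series (mc alpha a1))))).
suff E : (fun n => cj (\sum_(0 <= k < n) dcoef kcoef k * expi t ^+ k)) =
  (fun n => expi t * ((rC (2 * pi))^-1 *
    (\sum_(0 <= k < n) (z * cj (expi t)) ^+ k.+1 / k.+1%:R -
     \sum_(0 <= k < n) (alpha * cj (expi t)) ^+ k.+1 / k.+1%:R))).
  by rewrite E in h1; exact: (cvg_unique _ h1 h2).
apply/funext => n; rewrite -sumrB !mulr_sumr.
have -> : cj (\sum_(0 <= k < n) dcoef kcoef k * expi t ^+ k) =
  \sum_(0 <= k < n) cj (dcoef kcoef k * expi t ^+ k) by exact: rmorph_sum.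
apply: eq_bigr => k _; rewrite dcoef_kcoef !cjM cjK cj_rC cjX.
rewrite rC_inv2pi rC_nat. rewrite -mulrBl !(exprMn_comm _ (mulrC _ _)) -mulrBl.
(* The factor [zeta] cancels one [cj zeta], matching the exponent [k + 1] of the logarithmic series
   with the exponent [k] of the derived one. *)
have e1 : expi t * cj (expi t) ^+ k.+1 = cj (expi t) ^+ k.
  by rewrite exprS mulrA expi_cj mul1r.
rewrite -e1; set A := z ^+ k.+1 - _; set E := cj (expi t) ^+ k.+1.
set I := (rC (2 * pi))^-1; set J := k.+1%:R^-1; ring.
Qed.

Lemma kernel_cvg w : modulus w < 1 ->
  (fun n : nat => \sum_(1 <= k < n.+1)
     (w ^+ k - alpha ^+ k) * conjc (z ^+ k - alpha ^+ k)
       / (2 * pi * k%:R ^+ 2)%:C%C : C) @ \oo --> kernel w.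
Proof.
move=> w1; have [x [x0 x1 b1 _]] := kcoef_bounded.
have h : (fun n => \sum_(0 <= k < n) kcoef k * w ^+ k - \sum_(0 <= k < n) kcoef k * alpha ^+ k)
    @ \oo --> kernel w.
  exact: (cvgCB (psum_cvg x0 x1 b1 (ltW w1)) (psum_cvg x0 x1 b1 (ltW a1))).
have h2 : (fun n => \sum_(0 <= k < n.+1) kcoef k * w ^+ k - \sum_(0 <= k < n.+1) kcoef k * alpha ^+ k)
    @ \oo --> kernel w.
  by have := h; rewrite -(cvg_shiftS (fun n => \sum_(0 <= k < n) kcoef k * w ^+ k - \sum_(0 <= k < n) kcoef k * alpha ^+ k)); exact.
suff -> : (fun n : nat => \sum_(1 <= k < n.+1)
     (w ^+ k - alpha ^+ k) * conjc (z ^+ k - alpha ^+ k)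
       / (2 * pi * k%:R ^+ 2)%:C%C : C) = (fun n => \sum_(0 <= k < n.+1) kcoef k * w ^+ k -
    \sum_(0 <= k < n.+1) kcoef k * alpha ^+ k) by exact: h2.
apply/funext => n; rewrite -sumrB big_add1 /= [RHS]big_nat_recl//=.
rewrite !expr0 subrr add0r; apply: eq_bigr => k _.
by rewrite -[RHS]mulrBr /kcoef [RHS]mulrC rCV [RHS]mulrA.
Qed.

End Kernel.

(** * The reproducing property and the Neumann problem *)

Section Maximal.
Context {R : realType}.
Local Notation C := (Cplx R).
Variable Gamma : C -> set C.
Hypothesis hGamma : approach_regions Gamma.

Definition rational_point (q : rat * rat) : C := rC (ratr q.1) + iC * rC (ratr q.2).

Lemma rational_point_dense (z : C) (A : set C) : nbhs z A -> exists q, A (rational_point q).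
Proof.
move=> /nbhs_modulusP[e e0 eA].
have e2 : 0 < e / 2 by lra.
have [p hp] := @rat_in_itvoo R (Re z - e / 2) (Re z + e / 2) ltac:(lra).
have [q hq] := @rat_in_itvoo R (Im z - e / 2) (Im z + e / 2) ltac:(lra).
exists (p, q); apply: eA; rewrite /rational_point.
apply: (le_lt_trans (modulus_le_ReIm _)).
have -> : Re (rC (ratr p) + iC * rC (ratr q) - z) = ratr p - Re z.
  by rewrite ReB ReD Re_iC /= oppr0 addr0.
have -> : Im (rC (ratr p) + iC * rC (ratr q) - z) = ratr q - Im z.
  by rewrite ImB ImD Im_iC /= add0r.
move: hp hq; rewrite !in_itv /= => /andP[p1 p2] /andP[q1 q2].
by rewrite [ltRHS]splitr; apply: ltrD; rewrite ltr_norml; apply/andP; split; lra.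
Qed.

Lemma truncated_cone_open (zeta v z : C) (theta h : R) :
  truncated_cone zeta v theta h z -> \forall w \near z, truncated_cone zeta v theta h w.
Proof.
move=> [h1 h2]; have FF : Filter (nbhs z) := nbhs_filter z.
have idz : (fun w : C => w) @ z --> z by exact: cvg_id.
have dz : (fun w : C => w - zeta) @ z --> z - zeta by exact: (cvgCB idz (cvgC_cst zeta)).
have mz : modulus (w - zeta) @[w --> z] --> modulus (z - zeta) by exact: (cvg_modulus dz).
have pz : (w - zeta) * cj v @[w --> z] --> (z - zeta) * cj v by exact: (cvgCM dz (cvgC_cst (cj v))).
have [rz _] := (@cvg_ReImP R C (nbhs z) _ _ _).1 pz.
have dd : Re ((w - zeta) * cj v) - cos theta * modulus (w - zeta) @[w --> z] -->
   Re ((z - zeta) * cj v) - cos theta * modulus (z - zeta).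
  have h3 : (fun w : C => cos theta * modulus (w - zeta)) @ z --> cos theta * modulus (z - zeta).
    exact: (cvgM (cvg_cst (cos theta)) mz).
  exact: (cvgB rz h3).
have n1 := @cvgr_lt R C (nbhs z) FF _ _ mz _ h1.
have p0 : 0 < Re ((z - zeta) * cj v) - cos theta * modulus (z - zeta) by rewrite subr_gt0.
have n2 := @cvgr_gt R C (nbhs z) FF _ _ dd _ p0.
apply: filterS (filterI n1 n2) => w [w1]; rewrite subr_gt0 => w2; split; [exact: w1|exact: w2].
Qed.

(** For a fixed point the two cone conditions compare Borel functions of the vertex angle, as the
    parameters of the regions are Borel. *)
Lemma measurable_approach (q : C) : measurable [set t : R | Gamma (expi t) q].
Proof.
move: hGamma => [theta [phi [h [[mth mph mh] _ _ GE]]]].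
have mcos : measurable_fun setT (@cos R) by apply: continuous_measurable_fun; exact: continuous_cos.
have msin : measurable_fun setT (@sin R) by apply: continuous_measurable_fun; exact: continuous_sin.
have mm : measurable_fun setT (fun t : R => modulus (q - expi t)).
  apply: continuous_measurable_fun => t.
  exact: (cvg_modulus (cvgCB (cvgC_cst q) (continuous_expi (x := t)))).
have mi : measurable_fun setT (fun t : R => t + phi t) by apply: measurable_funD.
pose rhs t := - ((Re q - cos t) * cos (t + phi t) + (Im q - sin t) * sin (t + phi t)).
have mrhs : measurable_fun setT rhs.
  apply: measurableT_comp => //; apply: measurable_funD; apply: measurable_funM.
  - exact: measurable_funB.
  - exact: (measurableT_comp mcos mi).
  - exact: measurable_funB.
  - exact: (measurableT_comp msin mi).
have -> : [set t : R | Gamma (expi t) q] =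
   [set t | modulus (q - expi t) < h t] `&` [set t | cos (theta t) * modulus (q - expi t) < rhs t].
  apply/funext => t /=; have [-> _] := GE t; rewrite /truncated_cone /=.
  congr (_ /\ (_ < _)).
  by rewrite ReM ReB ImB /= /rhs cosD sinD; ring.
have mlt (f g : R -> R) : measurable_fun setT f -> measurable_fun setT g -> measurable [set t | f t < g t].
  move=> mf mg; have mt : measurable [set true] by [].
  by have := measurable_fun_ltr mf mg measurableT mt; rewrite setTI.
apply: measurableI; apply: mlt => //.
by apply: measurable_funM => //; exact: (measurableT_comp mcos mth).
Qed.

(* By continuity the supremum may be taken over rational points. *)
Lemma nt_max_measurable (F : C -> C) : (forall w, modulus w < 1 -> {for w, continuous F}) ->
  measurable_fun setT (nt_max Gamma F \o expi).
Proof.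
move=> cF mD; apply: (measurability _ (ErealGenOInfty.measurableE R)) => //.
move=> _ [_ [c ->] <-]; rewrite setTI.
pose S (q : rat * rat) := [set t : R | Gamma (expi t) (rational_point q) /\
  c < modulus (F (rational_point q))].
have -> : (nt_max Gamma F \o expi) @^-1` `]c%:E, +oo[%classic = \bigcup_q S q.
  apply/seteqP; split => t /=; rewrite in_itv /= andbT.
    move=> /ereal_sup_gt[_ [z Gz <-]]; rewrite lte_fin => cz.
    have z1 := approach_disc hGamma Gz.
    have ng : \forall w \near z, Gamma (expi t) w.
      move: Gz; move: hGamma => [theta [phi [h [_ _ _ GE]]]].
      by have [-> _] := GE t; exact: truncated_cone_open.
    have nF : \forall w \near z, c < modulus (F w).
      have h : modulus (F w) @[w --> z] --> modulus (F z) by exact: (cvg_modulus (cF z z1)).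
      exact: (@cvgr_gt R C (nbhs z) (nbhs_filter z) _ _ h _ cz).
    have [q [q1 q2]] := rational_point_dense (filterI ng nF).
    by exists q.
  move=> [q _ [q1 q2]]; apply: lt_le_trans (nt_max_ge F q1).
  by rewrite lte_fin.
apply: countable_bigcupT_measurable => // q.
have [cq|cq] := boolP (c < modulus (F (rational_point q))).
  have -> : S q = [set t : R | Gamma (expi t) (rational_point q)] by apply/seteqP; split => [t []|t ?].
  exact: measurable_approach.
have -> : S q = set0; last by [].
by apply/seteqP; split => [t [_ h]|t []]; move: cq; rewrite h.
Qed.

Lemma circle_Lp_bounded (F : C -> C) (M : R) :
  (forall w, modulus w < 1 -> {for w, continuous F}) ->
  (forall w, modulus w < 1 -> modulus (F w) <= M) ->
  circle_Lp 2%:E (nt_max Gamma F).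
Proof.
move=> cF FM; have mf := nt_max_measurable cF; split; first exact: mf.
have fM t : (nt_max Gamma F (expi t) <= M%:E)%E.
  by apply: ge_ereal_sup => _ [z Gz <-]; rewrite lee_fin; apply: FM; exact: (approach_disc hGamma Gz).
(* A supremum over an empty region would be minus infinity; the radial points exclude this. *)
have f0 t : (0 <= nt_max Gamma F (expi t))%E.
  have [h0 h00 hrad] := approach_radial hGamma.
  have k2 : 0 < h0 / 2 by lra.
  have k : h0 / 2 < h0 by lra.
  by apply: (le_trans _ (nt_max_ge F (hrad t (h0 / 2) k2 k))); rewrite lee_fin modulus_ge0.
rewrite unlock /Lnorm poweR_lty//.
have cfin : (\int[sigma]_x (cst (M `^ 2)%:E x) < +oo)%E.
  have sfin : @sigma R setT \is a fin_num by rewrite ge0_fin_numE//; exact: sigma_fin.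
  by rewrite integral_cst// -(fineK sfin) -EFinM ltry.
apply: le_lt_trans cfin; apply: ge0_le_integral => //.
- by move=> t _; exact: poweR_ge0.
- have mabs : measurable_fun [set: measurableTypeR R] (abse \o (nt_max Gamma F \o expi)).
    by apply: measurableT_comp => //; exact: mf.
  by apply: (measurableT_comp (measurable_poweR 2)); exact: mabs.
- move=> t _; rewrite /= gee0_abs ?f0// -poweR_EFin.
  by apply: gt0_ler_poweR => //; rewrite ?in_itv /= ?f0 ?leey// (le_trans (f0 t) (fM t)).
Qed.

End Maximal.

(** * The reproducing property *)

Section Reproducing.
Context {R : realType}.
Local Notation C := (Cplx R).
Variable Gamma : C -> set C.
Hypothesis hGamma : approach_regions Gamma.

Lemma kernel_hardy1_at (z alpha : C) : modulus z < 1 -> modulus alpha < 1 ->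
  hardy1_at Gamma 2%:E alpha (kernel z alpha).
Proof.
move=> z1 a1; have hK := kernel_hol z1 a1; have hF := cderiv_kernel_hol z1 a1.
split; last exact: kernel_alpha.
split; [exact: hK|split; first exact: hF].
have [M FM] := cderiv_kernel_bounded z1 a1.
apply: (circle_Lp_bounded hGamma _ FM).
by move=> w w1; exact: hol_continuous.
Qed.

Lemma kernel_reproduces (z alpha : C) (F : C -> C) : modulus z < 1 -> modulus alpha < 1 ->
  hardy1_at Gamma 2%:E alpha F -> F z = inner_product Gamma F (kernel z alpha).
Proof.
move=> z1 a1 [[hF [hF' hp]] Fa].
have p1 : (1 <= 2%:E :> \bar R)%E by rewrite lee_fin ler1n.
have [N [mN N0 hN]] := hardy_nt_converges hF hF' hGamma p1 hp.
pose k : C := (rC (2 * pi))^-1.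
rewrite /inner_product (log_representation (k := k) hF hF' hGamma p1 hp z1 a1 mN N0).
  rewrite Fa subr0 divff ?mul1r// rC_eq0 gt_eqF// mulr_gt0 ?pi_gt0//.
move=> t t0 t2 nN; split; first exact: hN.
have E : cj (nt_lim Gamma (cderiv (kernel z alpha)) (expi t)) = expi t * (k * (logk z t - logk alpha t)).
  by rewrite (kernel_nt_lim z1 a1 hGamma t); exact: kder_boundary.
have E2 (a b d : C) : b = expi t * d -> a * b = expi t * a * d.
  by move=> ->; rewrite mulrCA mulrA.
exact: (E2 _ _ _ E).
Qed.

(** Negation exchanges the positive and negative parts, and [fine] sends an infinite integral to 0
    on both sides. Thus integrability need not be known when products are conjugated. *)
Lemma Rintegral_opp (f : R -> R) :
  Rintegral (@sigma R) setT (fun t => - f t) = - Rintegral (@sigma R) setT f.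
Proof.
rewrite /Rintegral integralE [in RHS]integralE.
have -> : (fun t => (- f t)%:E)^\+%E = (fun t => (f t)%:E)^\-%E.
  by apply/funext => t; rewrite funeposE funenegE EFinN.
have -> : (fun t => (- f t)%:E)^\-%E = (fun t => (f t)%:E)^\+%E.
  by apply/funext => t; rewrite funeposE funenegE EFinN oppeK.
set a := integral _ _ _; set b := integral _ _ _.
case: a => [a| |]; case: b => [b| |] //=; rewrite ?oppr0 ?opprB//.
Qed.

Lemma circle_integral_cj (f : C -> C) :
  circle_integral (fun zeta => cj (f zeta)) = cj (circle_integral f).
Proof.
apply: complex_eqP; rewrite (Re_cj, Im_cj) /=.
  by congr (Rintegral _ _ _); apply/funext => t; rewrite Re_cj.
rewrite -Rintegral_opp.
by congr (Rintegral _ _ _); apply/funext => t; rewrite Im_cj.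
Qed.

Lemma inner_product_cj (F G : C -> C) : inner_product Gamma F G = cj (inner_product Gamma G F).
Proof.
rewrite /inner_product -circle_integral_cj; congr circle_integral; apply/funext => zeta.
by rewrite cjM cjK mulrC.
Qed.

Lemma kernel_reproducing (alpha : C) : modulus alpha < 1 ->
  reproducing_kernel Gamma alpha (fun z => kernel z alpha).
Proof.
by move=> a1 z z1; split=> [|F hF]; [exact: kernel_hardy1_at|exact: kernel_reproduces].
Qed.

(* [K z w] is the product of [K z] with the kernel at [w], the conjugate of the
   product of that kernel with [K z]. *)
Lemma reproducing_kernel_cj (alpha z w : C) (K : C -> C -> C) : modulus alpha < 1 ->
  modulus z < 1 -> modulus w < 1 -> reproducing_kernel Gamma alpha K ->
  K z w = cj (kernel w alpha z).
Proof.
move=> a1 z1 w1 hK; have [Kz Kr] := hK z z1.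
rewrite (Kr _ (kernel_hardy1_at w1 a1)) -inner_product_cj.
exact: kernel_reproduces.
Qed.

Lemma reproducing_kernel_unique (alpha z w : C) (K : C -> C -> C) : modulus alpha < 1 ->
  modulus z < 1 -> modulus w < 1 -> reproducing_kernel Gamma alpha K ->
  K z w = kernel z alpha w.
Proof.
move=> a1 z1 w1 hK; rewrite (reproducing_kernel_cj a1 z1 w1 hK).
by rewrite -(reproducing_kernel_cj a1 z1 w1 (kernel_reproducing a1)).
Qed.

End Reproducing.

(** * The Neumann problem *)

Section Neumann.
Context {R : realType}.
Local Notation C := (Cplx R).
Local Notation mu := (@lebesgue_measure R).
Variable Gamma : C -> set C.
Hypothesis hGamma : approach_regions Gamma.

Lemma cderiv_addc (G : C -> C) (c : C) : cderiv (fun w => G w + c) = cderiv G.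
Proof.
apply/funext => w; rewrite /cderiv /derive; congr (lim _).
suff -> : (fun h : C => h^-1 *: (((fun w => G w + c) \o shift w) (h *: 1) - (G w + c))) =
  (fun h : C => h^-1 *: ((G \o shift w) (h *: 1) - G w)) by [].
by apply/funext => h /=; rewrite opprD addrACA subrr addr0.
Qed.

Lemma holomorphic_addc (G : C -> C) (c : C) : holomorphic G -> holomorphic (fun w => G w + c).
Proof. by move=> hG w w1; have [] := hderD (hol_is_derive hG w1) (hder_cst c w). Qed.

Lemma normal_derivativeE (G : C -> C) (zeta v : C) :
  has_normal_derivative Gamma G zeta v ->
  nt_converges Gamma (cderiv G) zeta /\ v = zeta * nt_lim Gamma (cderiv G) zeta.
Proof.
move=> [h ->]; split => //; congr (_ * _).
by rewrite /unit_tangent mulNr mulrA -expr2 sqrCi mulN1r opprK.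
Qed.

(** A datum comes with a function that has it as normal derivative; subtracting the value at 0
    leaves the complex derivative unchanged. *)
Lemma neumann_exists (p : \bar R) (g : C -> C) : neumann_data Gamma p g ->
  exists G, hardy1_at Gamma p 0 G /\ neumann_solution Gamma p g G.
Proof.
move=> [G0 [hG0 [hF0 hp]] hae].
exists (fun w => G0 w + - G0 0); split.
  split; last exact: subrr.
  by split; [exact: (holomorphic_addc (c := - G0 0) hG0)|rewrite cderiv_addc].
split; [exact: (holomorphic_addc (c := - G0 0) hG0)| |by rewrite cderiv_addc].
by rewrite /has_normal_derivative cderiv_addc.
Qed.

Lemma neumann_representation (p : \bar R) (g G : C -> C) (z : C) : (1 <= p)%E ->
  modulus z < 1 -> hardy1_at Gamma p 0 G -> neumann_solution Gamma p g G ->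
  circle_integral (fun zeta => g zeta * Log (1 / (1 - z * cj zeta))) =
  rC (2 * pi) * G z.
Proof.
move=> p1 z1 [[hG [hF hp]] G00] [_ [N0 [mN0 N00 sub]] _].
have z01 : modulus (0 : C) < 1 by rewrite modulus0.
(* A [sigma]-null set is Lebesgue-null only after restriction to one period. *)
pose N := N0 `&` `[0, 2 * pi[%classic.
have mN : measurable N by apply: measurableI.
have N1 : mu N = 0%E by exact: N00.
rewrite (log_representation (k := 1) hG hF hGamma p1 hp z1 z01 mN N1).
  by rewrite G00 subr0 mulr1.
move=> t t0 t2 nN.
have nN0 : ~ N0 t by move=> h; apply: nN; split => //=; rewrite in_itv /= ltW.
have [ct gE] : nt_converges Gamma (cderiv G) (expi t) /\ g (expi t) = expi t * nt_lim Gamma (cderiv G) (expi t).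
  by apply: normal_derivativeE; apply: contrapT => h; apply: nN0; exact: sub.
split => //; rewrite gE (logkE z1); congr (_ * _).
have -> : logk 0 t = 0 by rewrite /logk mul0r subr0 Lg1 oppr0.
by rewrite subr0 mul1r.
Qed.

End Neumann.

Unset Implicit Arguments.

Theorem theorem3p2 (R : realType) (Gamma : Cplx R -> set (Cplx R))
    (hGamma : approach_regions Gamma) :
  (forall alpha : Cplx R, unit_disc alpha ->
     (exists K : Cplx R -> Cplx R -> Cplx R,
        reproducing_kernel Gamma alpha K) /\
     (forall K : Cplx R -> Cplx R -> Cplx R,
        reproducing_kernel Gamma alpha K ->
        forall z w : Cplx R, unit_disc z -> unit_disc w ->
          (fun n : nat => \sum_(1 <= k < n.+1)
             (w ^+ k - alpha ^+ k) * conjc (z ^+ k - alpha ^+ k)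
               / (2 * pi * k%:R ^+ 2)%:C%C : Cplx R) @ \oo --> K z w))
  /\
  (forall (p : \bar R) (g : Cplx R -> Cplx R),
     (1 <= p)%E -> neumann_data Gamma p g ->
     (exists G : Cplx R -> Cplx R,
        hardy1_at Gamma p 0 G /\ neumann_solution Gamma p g G) /\
     (forall G : Cplx R -> Cplx R,
        hardy1_at Gamma p 0 G -> neumann_solution Gamma p g G ->
        forall z : Cplx R, unit_disc z ->
          G z = (2 * pi)^-1%:C%C *
                circle_integral (fun zeta : Cplx R =>
                  g zeta * Log (1 / (1 - z * conjc zeta))))).
Proof.
split=> [alpha a1|p g p1 hg]; split.
- by exists (fun z => kernel z alpha); exact: kernel_reproducing.
- move=> K hK z w z1 w1; rewrite (reproducing_kernel_unique hGamma a1 z1 w1 hK).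
  exact: kernel_cvg.
- exact: neumann_exists.
- move=> G hG sG z z1.
  have E := neumann_representation hGamma p1 z1 hG sG.
  have E2 (I : Cplx R) : I = rC (2 * pi) * G z -> G z = rC (2 * pi)^-1 * I.
    move=> ->; rewrite rCV mulrA mulVf ?mul1r//.
    by rewrite rC_eq0 gt_eqF// mulr_gt0 ?pi_gt0.
  exact: (E2 _ E).
Qed.
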